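(* Fix $\alpha>0$ and $n\in\mathbb N$ with $n>2\alpha$. There is a constant $C_\alpha$ (depending on $\alpha$ and $n$) such that for $0<\lambda<1$ and $x\ne y$ in $\mathbb R^n$, with $r=|x-y|$, $$\mathcal R_0^+(\lambda^{2\alpha})(x,y)=\frac{C_\alpha}{|x-y|^{n-2\alpha}}+\mathcal E(\lambda,r),$$ where \begin{itemize} \item $\mathcal E(\lambda,r)=O(\lambda^{n-2\alpha})$ when $4\alpha>n$; \item $\mathcal E(\lambda,r)=O\big(\lambda^{n-2\alpha}(1+\log^-(\lambda r))\big)$ when $n=4\alpha$; \item $\mathcal E(\lambda,r)=O\big(\lambda^{n-2\alpha}+\lambda^{2\alpha}r^{4\alpha-n}\big)$ when $n>4\alpha$, \end{itemize} with implicit constants independent of $\lambda$ and $r$.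
   Context: $(-\Delta)^\alpha$ is the Fourier multiplier operator on $\mathbb R^n$ with symbol $|\xi|^{2\alpha}$. The limiting free resolvent is $\mathcal R_0^+(\lambda)=\lim_{\epsilon\to0^+}[(-\Delta)^\alpha-(\lambda+ i\epsilon)]^{-1}$ for $\lambda>0$, and $\mathcal R_0^+(\lambda)(x,y)$ denotes its integral kernel. For $y>0$, $\log^-(y)=-\log(y)$ if $0<y<1$ and $\log^-(y)=0$ otherwise. *)

(* Defs.v *)
From HB Require Import structures.
From mathcomp Require Import all_boot all_order all_algebra.
From mathcomp Require Import all_classical all_reals all_analysis.
From mathcomp Require Import complex.

Set Implicit Arguments.
Unset Strict Implicit.
Unset Printing Implicit Defensive.

Import Order.TTheory GRing.Theory Num.Theory.
Import numFieldNormedType.Exports.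

Local Open Scope classical_set_scope.
Local Open Scope ring_scope.
Local Open Scope complex_scope.

Section lebesgue_measure_tuple.
Context {R : realType}.
Local Open Scope ereal_scope.

Definition tuple_cons n (p : measurableTypeR R * n.-tuple (measurableTypeR R)) :
  n.+1.-tuple (measurableTypeR R) := [tuple of p.1 :: p.2].

Lemma measurable_tuple_cons n : measurable_fun setT (@tuple_cons n).
Proof. exact: measurable_cons. Qed.

Section step.
Variables (n : nat) (mu : {sigma_finite_measure set (n.-tuple (measurableTypeR R)) -> \bar R}).

Definition lebesgue_cons : set (n.+1.-tuple (measurableTypeR R)) -> \bar R :=
  pushforward (lebesgue_measure \x mu) (@tuple_cons n).

Let prod : {measure set (measurableTypeR R * n.-tuple (measurableTypeR R))%type -> \bar R} :=
  @lebesgue_measure R \x mu.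

Let lebesgue_cons0 : lebesgue_cons set0 = 0.
Proof. by rewrite /lebesgue_cons /pushforward preimage_set0 (measure0 prod). Qed.

Let lebesgue_cons_ge0 A : 0 <= lebesgue_cons A.
Proof. exact: (measure_ge0 prod). Qed.

Let lebesgue_cons_sigma_additive : semi_sigma_additive lebesgue_cons.
Proof.
have mcons A : measurable A -> measurable (@tuple_cons n @^-1` A).
  by move=> mA; rewrite -[X in measurable X]setTI; exact: measurable_tuple_cons.
move=> F mF tF mUF; rewrite /lebesgue_cons /pushforward preimage_bigcup.
apply: (@measure_semi_sigma_additive _ _ _ prod).
- by move=> k; exact: mcons.
- apply/trivIsetP => /= i j _ _ ij; rewrite -preimage_setI.
  by move/trivIsetP : tF => /(_ _ _ _ _ ij) ->//; rewrite preimage_set0.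
- by rewrite -preimage_bigcup; exact: mcons.
Qed.

HB.instance Definition _ := isMeasure.Build _ _ _ lebesgue_cons
  lebesgue_cons0 lebesgue_cons_ge0 lebesgue_cons_sigma_additive.

Let prod_sigma_finite : sigma_finite setT prod.
Proof.
have /sigma_finiteP[F [TF ndF Foo]] := sigma_finiteT (@lebesgue_measure R).
have /sigma_finiteP[G [TG ndG Goo]] := sigma_finiteT mu.
exists (fun k => F k `*` G k).
  rewrite -setXTT TF TG predeqE => -[x y]; split.
    move=> [/= [i _ Fix] [k _ Gky]]; exists (maxn i k) => //; split.
    - by move: x Fix; exact/subsetPset/ndF/leq_maxl.
    - by move: y Gky; exact/subsetPset/ndG/leq_maxr.
  by move=> [i _ []/= ? ?]; split; exists i.
move=> k; have [? ?] := Foo k; have [? ?] := Goo k.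
split; first exact: measurableX.
by rewrite /prod /= product_measure1E// lte_mul_pinfty// ge0_fin_numE.
Qed.

Let lebesgue_cons_sigma_finite : sigma_finite setT lebesgue_cons.
Proof.
have [F FT Foo] := prod_sigma_finite.
pose split_tuple (t : n.+1.-tuple (measurableTypeR R)) :=
  (thead t, [tuple of behead t]).
have consK : cancel (@tuple_cons n) split_tuple.
  by case=> a t; congr pair; exact/val_inj.
exists (fun i => split_tuple @^-1` F i).
  by rewrite -preimage_bigcup -FT preimage_setT.
move=> i; have [mF Fi] := Foo i; split.
  rewrite -[X in measurable X]setTI; apply: measurable_fun_pair => //.
    exact: measurable_tnth.
  exact: measurable_behead.
by rewrite /lebesgue_cons /pushforward -comp_preimage (_ : _ \o _ = id)//;
  apply/funext.
Qed.

HB.instance Definition _ := Measure_isSigmaFinite.Build _ _ _ lebesgue_cons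
  lebesgue_cons_sigma_finite.

End step.

Fixpoint lebesgue_tuple n :
    {sigma_finite_measure set (n.-tuple (measurableTypeR R)) -> \bar R} :=
  if n is m.+1 then lebesgue_cons (lebesgue_tuple m)
  else @dirac _ (0.-tuple (measurableTypeR R)) [tuple] R.

Lemma lebesgue_tuple_box n (a b : 'I_n -> R) : (forall i, a i <= b i)%R ->
  lebesgue_tuple n [set t | forall i, (a i <= tnth t i <= b i)%R] =
  (\prod_i (b i - a i))%:E.
Proof.
elim: n a b => [|n IHn] a b ab.
  by rewrite big_ord0 /= diracE mem_set// => -[].
have mbox : measurable [set t : n.-tuple (measurableTypeR R) |
    forall i, (a (lift ord0 i) <= tnth t i <= b (lift ord0 i))%R].
  rewrite (_ : [set _ | _] = \bigcap_(i in [set: 'I_n])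
      ((fun t : n.-tuple (measurableTypeR R) => tnth t i) @^-1`
       `[a (lift ord0 i), b (lift ord0 i)])); last first.
    apply/seteqP; split=> [t /= h i _ /=|t h i /=]; first by rewrite in_itv /=.
    by have := h i I; rewrite /= in_itv.
  apply: fin_bigcap_measurable => [|i _]; first exact: finite_finset.
  by rewrite -[X in measurable X]setTI; exact: measurable_tnth.
rewrite /= /lebesgue_cons /pushforward
  (_ : _ @^-1` _ = `[a ord0, b ord0] `*` [set t : n.-tuple (measurableTypeR R) |
    forall i, (a (lift ord0 i) <= tnth t i <= b (lift ord0 i))%R]); last first.
  apply/seteqP; split=> [[x t] /= h|[x t] /= [+ h] i].
    split; first by have := h ord0; rewrite in_itv.
    by move=> i; have := h (lift ord0 i); rewrite tnthS.
  by case: (unliftP ord0 i) => [j|] ->; rewrite ?tnthS// in_itv.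
rewrite product_measure1E//= IHn; last by move=> i; exact: ab.
rewrite lebesgue_measure_itv /= lte_fin big_ord_recl EFinM.
have [_|ba] := ltP (a ord0) (b ord0); first by rewrite EFinB.
by rewrite (@le_anti _ _ (a ord0) (b ord0)) ?ab ?ba// subrr.
Qed.

End lebesgue_measure_tuple.

Arguments tuple_cons {R n}.
Arguments lebesgue_cons {R n}.
Arguments lebesgue_tuple {R}.

Section complex_integral.
Context {R : realType} {n : nat}.
Implicit Types (f g : 'rV[R]_n -> R[i]).

Definition vec_of_tuple (t : n.-tuple (measurableTypeR R)) : 'rV[R]_n :=
  \row_i tnth t i.

Definition integrable_Rn (f : 'rV[R]_n -> R) : Prop :=
  (lebesgue_tuple n).-integrable setT (EFin \o f \o vec_of_tuple).

Definition integral_Rn (f : 'rV[R]_n -> R) : R :=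
  \int[lebesgue_tuple n]_t f (vec_of_tuple t).

Definition integrableC f : Prop :=
  integrable_Rn (fun x => complex.Re (f x)) /\
  integrable_Rn (fun x => complex.Im (f x)).

Definition integralC f : R[i] :=
  integral_Rn (fun x => complex.Re (f x)) +i*
  integral_Rn (fun x => complex.Im (f x)).

Definition L1_L2 f : Prop :=
  integrableC f /\ integrable_Rn (fun x => Normc.normc (f x) ^+ 2).

End complex_integral.

Section schwartz.
Context {R : realType} {n : nat}.

Definition dot (x y : 'rV[R]_n) : R := \sum_i x 0 i * y 0 i.

(* Not the norm [`|x|] of ['rV[R]_n], which is the sup norm. *)
Definition enorm (x : 'rV[R]_n) : R := Num.sqrt (dot x x).

Definition partials (s : seq 'I_n) (f : 'rV[R]_n -> R) : 'rV[R]_n -> R :=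
  foldr (fun i g => 'D_(delta_mx 0 i) g) f s.

Definition schwartzR (f : 'rV[R]_n -> R) : Prop :=
  forall s : seq 'I_n,
    (forall i x, derivable (partials s f) x (delta_mx 0 i)) /\
    (forall k : nat, exists M : R,
      forall x, (1 + enorm x) ^+ k * `|partials s f x| <= M).

Definition schwartz (f : 'rV[R]_n -> R[i]) : Prop :=
  schwartzR (fun x => complex.Re (f x)) /\
  schwartzR (fun x => complex.Im (f x)).

End schwartz.

Section fractional_laplacian.
Context {R : realType} {n : nat}.
Implicit Types (u v f : 'rV[R]_n -> R[i]).

Definition expi (t : R) : R[i] := cos t +i* sin t.

Definition inv_fourier (w : 'rV[R]_n -> R[i]) (x : 'rV[R]_n) : R[i] :=
  ((2 * pi) ^- n)%:C * integralC (fun xi => w xi * expi (dot x xi)).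

(* The graph of the Fourier multiplier operator with symbol [m], on the [u] in
   its L^2 domain for which the Fourier transforms [w] of [u] and [m w] of its
   image are moreover integrable: both are then continuous functions, given at
   every point by the inversion formula. *)
Definition fourier_multiplier (m : 'rV[R]_n -> R) u v : Prop :=
  exists w : 'rV[R]_n -> R[i],
    [/\ L1_L2 w, L1_L2 (fun xi => (m xi)%:C * w xi),
        u =1 inv_fourier w & v =1 inv_fourier (fun xi => (m xi)%:C * w xi)].

Definition fractional_laplacian (alpha : R) u v : Prop :=
  fourier_multiplier (fun xi => enorm xi `^ (2 * alpha)) u v.

(* [u = ((-Delta)^alpha - z)^-1 f] *)
Definition resolvent (alpha : R) (z : R[i]) f u : Prop :=
  exists2 v, fractional_laplacian alpha u v & forall x, v x - z * u x = f x.

(* [u0 = R_0^+(lambda) f]. For nonreal [z] and Schwartz [f] there is exactly one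
   [u] with [resolvent alpha z f u] (its Fourier transform is that of [f]
   divided by [|xi|^(2 alpha) - z]), so [u eps] below is
   [((-Delta)^alpha - (lambda + i eps))^-1 f]. *)
Definition limiting_resolvent (alpha lambda : R) f (u0 : 'rV[R]_n -> R[i]) : Prop :=
  forall u : R -> 'rV[R]_n -> R[i],
    (forall eps, 0 < eps -> resolvent alpha (lambda +i* eps) f (u eps)) ->
    forall x,
      complex.Re (u eps x) @[eps --> 0^'+] --> complex.Re (u0 x) /\
      complex.Im (u eps x) @[eps --> 0^'+] --> complex.Im (u0 x).

(* An integral kernel is determined only almost everywhere; the continuity
   requirement pins down its value at every point off the diagonal. *)
Definition limiting_resolvent_kernel (alpha lambda : R)
    (K : 'rV[R]_n -> 'rV[R]_n -> R[i]) : Prop :=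
  [/\ forall x y, x != y ->
        {for (x, y), continuous (fun p => complex.Re (K p.1 p.2))} /\
        {for (x, y), continuous (fun p => complex.Im (K p.1 p.2))},
      forall f, schwartz f -> forall x, integrableC (fun y => K x y * f y) &
      forall f, schwartz f ->
        limiting_resolvent alpha lambda f
          (fun x => integralC (fun y => K x y * f y))].

End fractional_laplacian.

Definition log_minus {R : realType} (y : R) : R := if 0 < y < 1 then - ln y else 0.

(* Main.v *)
(** Testing the kernel [K x y] against Gaussians centred at [y] turns it into the
    iterated limit of [(2 pi)^(-n)] times
    [\int exp(- t |xi|^2) cos ((x - y).xi) / (|xi|^(2 a) - lam^(2 a) - i eps) dxi]
    as [eps -> 0+] and then [t -> 0+], with [a = alpha]. This integral is invariant under
    rotations and dilations of [x - y] (checked on polynomials in [exp (- |xi|^2)], which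
    suffices by Bernstein approximation), so one may take [lam = 1] and [x - y = r e_1].

    With [p = |xi|^2], the real part [(p^a - 1) / ((p^a - 1)^2 + eps^2)] of the symbol is
    [p^(-a)], whose transform is the main term [C r^(2 a - n)], plus:
    - finitely many powers [p^(-k a)], [k >= 2], cut off at low frequency as
      [\int_0^1 s^(k a - 1) exp(- s p) ds]; the transform of the worst one, [k = 2], is
      [\int_0^1 s^(2 a - 1 - n/2) exp(- r^2 / (4 s)) ds], which has the three claimed sizes;
    - the singular part [exp (- p) (p - 1) / ((p - 1)^2 + d^2)] at the sphere [p = 1],
      [d = eps / a];
    - a remainder dominated by an integrable function, up to [O(eps)].
    The transform of the singular part is bounded uniformly in [d] and [r]: in the variable
    [s = xi_1] it is the one-dimensional resolvent
    [(s^2 - c) / ((s^2 - c)^2 + d^2) = \int_0^oo cos (s u) k u du], [c = 1 - |xi'|^2], with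
    [\int |k| = O((|c| + d)^(-1/2))], and this weight is integrable in the remaining
    variables. The imaginary part is handled in the same way. *)
Require Import Defs.
From mathcomp Require Import all_boot all_order all_algebra.
From mathcomp Require Import all_classical all_reals all_analysis.
From mathcomp Require Import measurable_realfun complex ring lra.

Set Implicit Arguments.
Unset Strict Implicit.
Unset Printing Implicit Defensive.

Import Order.TTheory GRing.Theory Num.Theory.
Import numFieldNormedType.Exports.

Local Open Scope classical_set_scope.
Local Open Scope ring_scope.

(** * Gaussian integrals on the line *)

(** [C] and [E] have to be named before [K] is given. So [E] is extracted from the iterated limit
    itself ([kernel_limit]), which is unique when it exists and depends only on [lam] and [r]
    (besides [n] and [a]); a kernel [K] serves only to show that the limit exists. Consequently no
    oscillatory integral has to be shown convergent as eps -> 0: bounds uniform in eps are enough.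

    The order of the limits matters. The remainder contains a part of size O(eps) without decay in
    xi, which costs eps times the mass of exp(-t |xi|^2). That mass blows up as t -> 0, but the
    product vanishes when eps -> 0 at fixed t.

    At the sphere the line kernel enters only through its supremum, of order |c + i d|^(-1/2),
    paired with the transform of a Gaussian, which is positive and has a fixed mass. Its integral
    would be useless: for c > 0 the exponential decay is lost as d -> 0. *)

Lemma integrable_le_norm {d} {T : measurableType d} {R : realType}
    (mu : {measure set T -> \bar R}) (D : set T) (f g : T -> R) :
  measurable D -> measurable_fun D f -> (forall x, D x -> `|f x| <= g x) ->
  mu.-integrable D (EFin \o g) -> mu.-integrable D (EFin \o f).
Proof.
move=> mD mf fg; apply: le_integrable => //; first exact/measurable_EFinP.
by move=> x Dx /=; rewrite lee_fin (le_trans (fg x Dx))// ler_norm.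
Qed.

Lemma integrable_scale {d} {T : measurableType d} {R : realType}
    (mu : {measure set T -> \bar R}) (D : set T) (a : R) (f : T -> R) : measurable D ->
  mu.-integrable D (EFin \o f) -> mu.-integrable D (EFin \o (fun x => a * f x)).
Proof. by move=> mD; exact: integrableZl. Qed.

(** Dominated convergence with majorant [|f|]. It reduces improper integrals of signed functions to
    compact intervals, where the fundamental theorem of calculus applies. *)
Lemma integral_exhaustion {d} {T : measurableType d} {R : realType}
    (mu : {measure set T -> \bar R}) (D : set T) (A : nat -> set T) (f : T -> R) :
  measurable D -> (forall k, measurable (A k)) -> (forall k, A k `<=` D) ->
  (forall x, D x -> \forall k \near \oo, A k x) ->
  mu.-integrable D (EFin \o f) ->
  (\int[mu]_(x in A k) (f x)%:E)%E @[k --> \oo] --> (\int[mu]_(x in D) (f x)%:E)%E.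
Proof.
move=> mD mA AD Ax intf.
have mf := measurable_int _ intf.
pose h k := (EFin \o f) \_ (A k).
have hE : (fun k => (\int[mu]_(x in A k) (f x)%:E)%E) =
          (fun k => (\int[mu]_(x in D) h k x)%E).
  apply/funext => k; rewrite /h -integral_mkcondr.
  by rewrite (setIidr (AD k)).
rewrite hE.
apply: (@dominated_cvg _ _ _ mu D mD _ _ (fun x => `|(f x)%:E|%E)) => //.
- move=> k; apply/(measurable_restrict _ _ _) => //.
  rewrite (setIidr (AD k)); exact: measurable_funS mf.
- move=> x Dx; apply: (@cvg_trans _ (nbhs (f x)%:E)); last exact: cvg_id.
  apply: cvg_near_cst.
  near=> k; rewrite /h patchE mem_set//.
  by near: k; exact: Ax.
- exact: integrable_abse.
- by move=> k x Dx; rewrite /h patchE; case: ifP => _; rewrite ?abse0 ?abse_ge0.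
Unshelve. all: by end_near. Qed.

Section gaussian_line.
Context {R : realType}.
Notation mu := (@lebesgue_measure R).

Lemma continuous_measurable (f : R -> R) : continuous f -> measurable_fun setT f.
Proof. exact: continuous_measurable_fun. Qed.

Lemma sqrt_pi_div_gt0 (s : R) : 0 < s -> 0 < Num.sqrt (pi / s).
Proof. by move=> s0; rewrite sqrtr_gt0 divr_gt0 ?pi_gt0. Qed.

(** This is the total mass 1 of the normal density with mean [m] and variance 1 / (2 s). *)
Lemma integral_gauss_center (s m : R) : 0 < s ->
  (\int[mu]_y (expR (- (s * (y - m) ^+ 2)))%:E = (Num.sqrt (pi / s))%:E)%E.
Proof.
move=> s0; pose sg := Num.sqrt ((2 * s)^-1).
have sg2 : sg ^+ 2 = (2 * s)^-1 by rewrite sqr_sqrtr// invr_ge0 mulr_ge0// ltW.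
have sg0 : sg != 0 by rewrite gt_eqF// sqrtr_gt0 invr_gt0 mulr_gt0.
have peak : normal_peak sg = (Num.sqrt (pi / s))^-1.
  rewrite /normal_peak sg2; congr (Num.sqrt _)^-1; rewrite -mulr_natr.
  by field; rewrite gt_eqF.
have := @integral_normal_pdf R m sg; rewrite normal_pdfE//.
under eq_integral => y _.
  rewrite peak /normal_fun sg2.
  rewrite (_ : - (y - m) ^+ 2 / ((2 * s)^-1 *+ 2) = - (s * (y - m) ^+ 2)); last first.
    by rewrite -mulr_natr; field; rewrite gt_eqF.
  rewrite EFinM; over.
have me : measurable_fun setT (fun y : R => (expR (- (s * (y - m) ^+ 2)))%:E).
  apply/measurable_EFinP; apply: continuous_measurable => y.
  apply: continuous_comp; last exact: continuous_expR.
  apply: cvgN; apply: cvgMr; apply: cvgM; apply: cvgB; try exact: cvg_id; exact: cvg_cst.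
rewrite ge0_integralZl//=.
move=> h; have q0 := sqrt_pi_div_gt0 s0.
rewrite -[LHS]mul1e -(divff (lt0r_neq0 q0)) EFinM -muleA h mule1 //.
Qed.

Lemma integral_gauss (s : R) : 0 < s ->
  (\int[mu]_y (expR (- (s * y ^+ 2)))%:E = (Num.sqrt (pi / s))%:E)%E.
Proof.
move=> s0; rewrite -(integral_gauss_center 0 s0).
by apply: eq_integral => y _; rewrite subr0.
Qed.

Lemma expR_quad_cont (s m : R) : continuous (fun y : R => expR (- (s * (y - m) ^+ 2))).
Proof.
move=> y; apply: continuous_comp; last exact: continuous_expR.
apply: cvgN; apply: cvgMr; apply: cvgM; apply: cvgB; try exact: cvg_id; exact: cvg_cst.
Qed.

Lemma expR_sqr_cont (s : R) : continuous (fun y : R => expR (- (s * y ^+ 2))).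
Proof.
move=> y; have := @expR_quad_cont s 0 y; rewrite /continuous_at subr0.
by under eq_fun do rewrite subr0.
Qed.

Lemma is_derive_continuous (G : R -> R) (g : R -> R) :
  (forall x : R, is_derive x 1 G (g x)) -> continuous G.
Proof.
move=> dG x; apply/differentiable_continuous/derivable1_diffP.
by have := dG x; case.
Qed.

Lemma integral_itv_derive (g G : R -> R) (a b : R) : a < b -> continuous g ->
  (forall x : R, is_derive x 1 G (g x)) ->
  (\int[mu]_(x in `[a, b]) (g x)%:E = (G b - G a)%:E)%E.
Proof.
move=> ab cg dG; have cG := is_derive_continuous dG.
rewrite (@continuous_FTC2 _ g G)//.
- exact: continuous_subspaceT.
- split.
  + by move=> x _; have := dG x; case.
  + exact/cvg_at_right_filter/cG.
  + exact/cvg_at_left_filter/cG.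
- by move=> x _; rewrite derive1E; have := dG x; case.
Qed.

Lemma integral_y_derive (g G : R -> R) (a l : R) : continuous g ->
  (forall x : R, is_derive x 1 G (g x)) ->
  mu.-integrable `[a, +oo[ (EFin \o g) ->
  G (a + k.+1%:R) @[k --> \oo] --> l ->
  (\int[mu]_(x in `[a, +oo[) (g x)%:E = (l - G a)%:E)%E.
Proof.
move=> cg dG ig Gl.
have h1 : (\int[mu]_(x in `[a, (a + k.+1%:R)%R]) (g x)%:E)%E @[k --> \oo] -->
    (\int[mu]_(x in `[a, +oo[) (g x)%:E)%E.
  apply: (@integral_exhaustion _ _ _ mu `[a, +oo[ (fun k => `[a, (a + k.+1%:R)%R]%classic)) => //.
  - by move=> k x /=; rewrite !in_itv/= => /andP[-> _].
  - move=> x /=; rewrite in_itv/= andbT => ax.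
    near=> k; rewrite /= in_itv/= ax/= -lerBlDl.
    rewrite (@le_trans _ _ k%:R)// ?ler_nat//.
    by near: k; exact: nbhs_infty_ger.
have h2 : (\int[mu]_(x in `[a, (a + k.+1%:R)%R]) (g x)%:E)%E @[k --> \oo] --> (l - G a)%:E.
  rewrite (_ : (fun k => _) = (fun k => (G (a + k.+1%:R) - G a)%:E)); last first.
    by apply/funext => k; rewrite (integral_itv_derive _ cg dG)// ltrDl.
  apply: cvg_EFin; first exact: nearW.
  by apply: cvgB => //; exact: cvg_cst.
exact: (cvg_unique _ h1 h2).
Unshelve. all: by end_near. Qed.

Lemma integralT_derive (g G : R -> R) : continuous g ->
  (forall x : R, is_derive x 1 G (g x)) ->
  mu.-integrable setT (EFin \o g) ->
  G k.+1%:R @[k --> \oo] --> (0 : R) ->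
  G (- k.+1%:R) @[k --> \oo] --> (0 : R) ->
  (\int[mu]_x (g x)%:E = 0)%E.
Proof.
move=> cg dG ig Gl Gr.
have h1 : (\int[mu]_(x in `[(- k.+1%:R)%R, k.+1%:R%R]) (g x)%:E)%E @[k --> \oo] -->
    (\int[mu]_x (g x)%:E)%E.
  apply: (@integral_exhaustion _ _ _ mu setT (fun k => `[(- k.+1%:R : R)%R, (k.+1%:R : R)%R]%classic)) => //.
  move=> x _; near=> k; rewrite /= in_itv/= -ler_norml.
  rewrite (@le_trans _ _ k%:R)// ?ler_nat//.
  by near: k; exact: nbhs_infty_ger.
have h2 : (\int[mu]_(x in `[(- k.+1%:R)%R, k.+1%:R%R]) (g x)%:E)%E @[k --> \oo] --> (0 : \bar R).
  rewrite (_ : (fun k => _) = (fun k => (G k.+1%:R - G (- k.+1%:R))%:E)); last first.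
    apply/funext => k; rewrite (integral_itv_derive _ cg dG)// gtrN//.
  apply: cvg_EFin; first exact: nearW.
  by rewrite -[X in _ --> X](subr0 0); exact: cvgB.
exact: (cvg_unique _ h1 h2).
Unshelve. all: by end_near. Qed.

Lemma integrable_gauss (s : R) : 0 < s ->
  mu.-integrable setT (fun u : R => (expR (- (s * u ^+ 2)))%:E).
Proof.
move=> s0; apply/integrableP; split.
  apply/measurable_EFinP; apply: continuous_measurable => y.
  apply: continuous_comp; last exact: continuous_expR.
  apply: cvgN; apply: cvgMr; apply: cvgM; exact: cvg_id.
have := integral_gauss_center 0 s0.
under eq_integral do rewrite subr0.
move=> h; under eq_integral do rewrite gee0_abs ?lee_fin ?expR_ge0//.
by rewrite h ltry.
Qed.

Lemma sqr_expR_le (c u : R) : 0 < c -> u ^+ 2 * expR (- (c * u ^+ 2)) <= c^-1.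
Proof.
move=> c0; rewrite expRN ler_pdivrMr ?expR_gt0// ler_pdivlMl//.
by rewrite (le_trans _ (expR_ge1Dx _))// lerDr.
Qed.

Lemma norm_expR_le (c u : R) : 0 < c -> `|u| * expR (- (c * u ^+ 2)) <= 1 + c^-1.
Proof.
move=> c0; have [u1|u1] := lerP `|u| 1.
  rewrite (le_trans (ler_pM _ _ u1 (_ : _ <= 1)))// ?expR_ge0//.
    by rewrite -expR0 ler_expR oppr_le0 mulr_ge0// ?sqr_ge0// ltW.
  by rewrite mulr1 lerDl invr_ge0 ltW.
rewrite (le_trans _ (_ : u ^+ 2 * expR (- (c * u ^+ 2)) <= _))//; last first.
  by rewrite (le_trans (sqr_expR_le _ c0))// lerDr.
rewrite ler_wpM2r ?expR_ge0// -real_normK ?num_real// expr2 ler_peMr// ltW//.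
Qed.

Lemma is_derive_gauss_cos (s x th u : R) :
  is_derive u 1 (fun u : R => expR (- (s * u ^+ 2)) * sin (x * u + th))
   (x * (expR (- (s * u ^+ 2)) * cos (x * u + th)) -
    2 * s * (u * expR (- (s * u ^+ 2)) * sin (x * u + th))).
Proof.
have d1 : is_derive u 1 (fun u : R => - (s * u ^+ 2)) (- (s * (2 * u))).
  by apply: is_derive_eq; rewrite /GRing.scale/=; ring.
have d2 : is_derive u 1 (fun u : R => x * u + th) x.
  by apply: is_derive_eq; rewrite /GRing.scale/=; ring.
have d3 : is_derive u 1 (expR \o (fun u : R => - (s * u ^+ 2))) (expR (- (s * u ^+ 2)) * (- (s * (2 * u)))).
  exact: is_derive1_comp.
have d4 : is_derive u 1 (sin \o (fun u : R => x * u + th)) (cos (x * u + th) * x).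
  exact: is_derive1_comp.
have := is_deriveM d3 d4 => d5; apply: is_derive_eq; rewrite /GRing.scale/=; ring.
Qed.

Lemma gauss_cos_cont (s x th : R) :
  continuous (fun u : R => expR (- (s * u ^+ 2)) * cos (x * u + th)).
Proof.
move=> u; apply: cvgM.
  exact: expR_sqr_cont.
apply: continuous_comp; last exact: continuous_cos.
by apply: cvgD; [apply: cvgMr; exact: cvg_id|exact: cvg_cst].
Qed.

(** One half of the exponent absorbs a factor [u], the other half stays integrable. *)
Lemma gauss_half (s u : R) :
  expR (- (s * u ^+ 2)) = expR (- (s / 2 * u ^+ 2)) * expR (- (s / 2 * u ^+ 2)).
Proof. by rewrite -expRD; congr expR; field. Qed.

Lemma integrable_gauss_cos (s x th : R) : 0 < s ->
  mu.-integrable setT (EFin \o (fun u : R => expR (- (s * u ^+ 2)) * cos (x * u + th))).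
Proof.
move=> s0; apply: (@integrable_le_norm _ _ _ mu setT _ (fun u => expR (- (s * u ^+ 2)))) => //.
- by apply: continuous_measurable; exact: gauss_cos_cont.
- move=> u _; rewrite normrM (ger0_norm (expR_ge0 _)) ler_piMr ?expR_ge0//.
  by rewrite ler_norml cos_geN1 cos_le1.
- exact: integrable_gauss.
Qed.

Lemma gauss_sin_cont (s x th : R) :
  continuous (fun u : R => u * expR (- (s * u ^+ 2)) * sin (x * u + th)).
Proof.
move=> u; apply: cvgM.
  apply: cvgM; first exact: cvg_id.
  exact: expR_sqr_cont.
apply: continuous_comp; last exact: continuous_sin.
by apply: cvgD; [apply: cvgMr; exact: cvg_id|exact: cvg_cst].
Qed.

(** The majorant does not depend on [x], so that it also serves for differentiation under the
    integral sign. *)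
Lemma norm_gauss_sin_le (s x th u : R) : 0 < s ->
  `|u * expR (- (s * u ^+ 2)) * sin (x * u + th)| <=
  (1 + (s / 2)^-1) * expR (- (s / 2 * u ^+ 2)).
Proof.
move=> s0; rewrite !normrM (ger0_norm (expR_ge0 _)).
rewrite (@le_trans _ _ (`|u| * expR (- (s * u ^+ 2))))//.
  by rewrite ler_piMr ?mulr_ge0 ?expR_ge0// ler_norml sin_geN1 sin_le1.
rewrite gauss_half mulrA ler_wpM2r ?expR_ge0// norm_expR_le// divr_gt0//.
Qed.

Lemma integrable_gauss_scaled (s C : R) : 0 < s ->
  mu.-integrable setT (EFin \o (fun u : R => C * expR (- (s * u ^+ 2)))).
Proof. by move=> s0; apply: (integrableZl measurableT C (integrable_gauss s0)). Qed.

Lemma integrable_gauss_sin (s x th : R) : 0 < s ->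
  mu.-integrable setT (EFin \o (fun u : R => u * expR (- (s * u ^+ 2)) * sin (x * u + th))).
Proof.
move=> s0; apply: (@integrable_le_norm _ _ _ mu setT _ (fun u => (1 + (s / 2)^-1) * expR (- (s / 2 * u ^+ 2)))) => //.
- by apply: continuous_measurable; exact: gauss_sin_cont.
- by move=> u _; exact: norm_gauss_sin_le.
- by apply: integrable_gauss_scaled; rewrite divr_gt0.
Qed.

(** Only the square of [v k] is prescribed, which covers both ends k + 1 and -(k + 1) of the growing
    intervals. *)
Lemma gauss_vanish (s : R) (v f : nat -> R) : 0 < s ->
  (forall k, v k ^+ 2 = k.+1%:R ^+ 2) ->
  (forall k, `|f k| <= expR (- (s * v k ^+ 2))) -> f k @[k --> \oo] --> (0 : R).
Proof.
move=> s0 vk fk.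
have b k : `|f k| <= s^-1 * k.+1%:R^-1.
  rewrite (le_trans (fk k))// vk -[leLHS]mul1r -ler_pdivlMr ?expR_gt0// -expRN opprK.
  rewrite (@le_trans _ _ (s^-1 / k.+1%:R * (s * k.+1%:R ^+ 2)))//.
    rewrite (_ : _ * _ = k.+1%:R) ?ler1n//; field.
    by rewrite nat1r pnatr_eq0 (gt_eqF s0).
  rewrite ler_wpM2l ?divr_ge0 ?invr_ge0 ?ler0n ?(ltW s0)//.
  by rewrite (le_trans _ (expR_ge1Dx _))// lerDr.
apply: (@squeeze_cvgr _ _ _ _ (fun k => - (s^-1 * k.+1%:R^-1)) (fun k => s^-1 * k.+1%:R^-1)).
- by apply: nearW => k; rewrite -ler_norml.
- rewrite -oppr0; apply: cvgN; rewrite -(mulr0 s^-1); apply: cvgMr; exact: cvg_harmonic.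
- rewrite -(mulr0 s^-1); apply: cvgMr; exact: cvg_harmonic.
Qed.

(** Integration by parts: the derivative of exp(-s u^2) sin(x u + th) has integral 0 over the
    line. *)
Lemma Rintegral_gauss_sin (s x th : R) : 0 < s ->
  2 * s * \int[mu]_u (u * expR (- (s * u ^+ 2)) * sin (x * u + th)) =
  x * \int[mu]_u (expR (- (s * u ^+ 2)) * cos (x * u + th)).
Proof.
move=> s0.
have i1 := integrable_gauss_cos x th s0; have i2 := integrable_gauss_sin x th s0.
have j1 := integrableZl measurableT x i1.
have j2 := integrableZl measurableT (2 * s) i2.
have z : (\int[mu]_u ((x * (expR (- (s * u ^+ 2)) * cos (x * u + th)) -
    2 * s * (u * expR (- (s * u ^+ 2)) * sin (x * u + th)))%:E) = 0)%E.
  apply: (integralT_derive _ (is_derive_gauss_cos s x th)).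
  - move=> u; apply: cvgB; apply: cvgMr; [exact: gauss_cos_cont|exact: gauss_sin_cont].
  - have := integrableB measurableT j1 j2; apply: eq_integrable => // u _ /=.
  - apply: (@gauss_vanish s (fun k => k.+1%:R)) => // k.
    rewrite normrM (ger0_norm (expR_ge0 _)) ler_piMr ?expR_ge0//.
    by rewrite ler_norml sin_geN1 sin_le1.
  - apply: (@gauss_vanish s (fun k => - k.+1%:R)) => // k; first by rewrite sqrrN.
    rewrite normrM (ger0_norm (expR_ge0 _)) ler_piMr ?expR_ge0//.
    by rewrite ler_norml sin_geN1 sin_le1.
apply/eqP; rewrite eq_sym -subr_eq0 -!RintegralZl// -RintegralB//.
by rewrite /Rintegral z.
Qed.

Lemma is_derive_gauss_fourier (s x th : R) : 0 < s ->
  is_derive x 1 (fun x => \int[mu]_u (expR (- (s * u ^+ 2)) * cos (x * u + th)))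
    (- \int[mu]_u (u * expR (- (s * u ^+ 2)) * sin (x * u + th))).
Proof.
move=> s0.
pose f (x u : R) := expR (- (s * u ^+ 2)) * cos (x * u + th).
pose G (u : R) := (1 + (s / 2)^-1) * expR (- (s / 2 * u ^+ 2)).
have df (y u : R) : is_derive y 1 (f ^~ u) (- (u * expR (- (s * u ^+ 2)) * sin (y * u + th))).
  have d2 : is_derive y 1 (fun y : R => y * u + th) u.
    by apply: is_derive_eq; rewrite /GRing.scale/=; ring.
  have d3 : is_derive y 1 (cos \o (fun y : R => y * u + th)) (- sin (y * u + th) * u).
    exact: is_derive1_comp.
  have := is_deriveZ (expR (- (s * u ^+ 2))) d3 => d5.
  by apply: is_derive_eq; rewrite /GRing.scale/=; ring.
have Ix : `](x - 1), (x + 1)[%classic x by rewrite /= in_itv/= ltrBlDr ltrDl ltr01.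
have If y : `](x - 1), (x + 1)[%classic y -> mu.-integrable setT (EFin \o f y).
  by move=> _; exact: integrable_gauss_cos.
have Df y u : `](x - 1), (x + 1)[%classic y -> setT u -> derivable (f ^~ u) y 1.
  by move=> _ _; have := df y u; case.
have G0 u : 0 <= G u by rewrite mulr_ge0 ?expR_ge0// addr_ge0// invr_ge0 divr_ge0// ltW.
have IG : mu.-integrable setT (EFin \o G).
  by apply: integrable_gauss_scaled; rewrite divr_gt0.
have bd y u : `](x - 1), (x + 1)[%classic y -> setT u -> `|partial1of2 f y u| <= G u.
  move=> _ _; rewrite partial1of2E; have := df y u; case => _ ->.
  by rewrite normrN norm_gauss_sin_le.
apply: DeriveDef.
  exact: (derivable_under_integral measurableT Ix If Df G0 IG bd).
rewrite -derive1E (differentiation_under_integral measurableT Ix If Df G0 IG bd).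
rewrite -[RHS]mulN1r -RintegralZl//; last exact: integrable_gauss_sin.
apply: eq_Rintegral => u _; rewrite partial1of2E; have := df x u; case => _ ->.
by rewrite mulN1r.
Qed.

(* The left side solves [2 s F' = - x F]. *)
Lemma Rintegral_gauss_fourier (s x th : R) : 0 < s ->
  \int[mu]_u (expR (- (s * u ^+ 2)) * cos (x * u + th)) =
  cos th * Num.sqrt (pi / s) * expR (- (x ^+ 2 / (4 * s))).
Proof.
move=> s0.
pose F (x : R) := \int[mu]_u (expR (- (s * u ^+ 2)) * cos (x * u + th)).
pose H (x : R) := expR (x ^+ 2 / (4 * s)) * F x.
have dF (y : R) : is_derive y 1 F (- (y / (2 * s) * F y)).
  have := is_derive_gauss_fourier y th s0; rewrite -/F => d; apply: is_derive_eq.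
  congr (- _); rewrite /F.
  apply: (mulfI (_ : 2 * s != 0)); first by rewrite mulf_neq0// gt_eqF.
  rewrite Rintegral_gauss_sin//; field; rewrite gt_eqF//.
have dH (y : R) : is_derive y 1 H 0.
  have d1 : is_derive y 1 (fun y : R => y ^+ 2 / (4 * s)) (2 * y / (4 * s)).
    by apply: is_derive_eq; rewrite /GRing.scale/=; ring.
  have d2 : is_derive y 1 (expR \o (fun y : R => y ^+ 2 / (4 * s))) (expR (y ^+ 2 / (4 * s)) * (2 * y / (4 * s))).
    exact: is_derive1_comp.
  have := is_deriveM d2 (dF y) => d5; apply: is_derive_eq; rewrite /GRing.scale/=.
  by field; rewrite gt_eqF.
have := is_derive_0_is_cst x 0 dH.
rewrite /H expr0n mul0r expR0 mul1r => e.
rewrite -/(F x) expRN.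
apply: (mulfI (lt0r_neq0 (expR_gt0 (x ^+ 2 / (4 * s))))).
rewrite e [RHS]mulrCA divff ?gt_eqF ?expR_gt0// mulr1.
rewrite /F; under eq_Rintegral do rewrite mul0r add0r mulrC.
rewrite RintegralZl//; last exact: integrable_gauss.
congr (_ * _); rewrite /Rintegral; by rewrite integral_gauss.
Qed.

End gaussian_line.

(** * Integration over tuples *)

Section tuple_integral.
Context {R : realType}.
Notation mu := (@lebesgue_measure R).
Notation lt n := (@lebesgue_tuple R n).
Notation tup n := (n.-tuple (measurableTypeR R)).

Lemma measurable_cons_comp n (f : tup n.+1 -> \bar R) : measurable_fun setT f ->
  measurable_fun setT (fun z : measurableTypeR R * tup n => f (tuple_cons z)).
Proof. by move=> mf; apply: measurableT_comp => //; exact: measurable_tuple_cons. Qed.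

Lemma ge0_integral_cons n (f : tup n.+1 -> \bar R) :
  measurable_fun setT f -> (forall t, 0 <= f t)%E ->
  (\int[lt n.+1]_t f t = \int[mu]_x \int[lt n]_t f (tuple_cons (x, t)))%E.
Proof.
move=> mf f0; rewrite [LHS](@ge0_integral_pushforward _ _ _ _ _ _ (@measurable_tuple_cons R n) (mu \x lt n)%E)//.
rewrite preimage_setT fubini_tonelli1//=; exact: measurable_cons_comp.
Qed.

Lemma integrable_cons n (f : tup n.+1 -> \bar R) :
  (lt n.+1).-integrable setT f ->
  (mu \x lt n)%E.-integrable setT (fun z => f (tuple_cons z)).
Proof.
move=> /integrableP[mf foo]; apply/integrableP; split; first exact: measurable_cons_comp.
move: foo; rewrite [X in (X < _)%E -> _](@ge0_integral_pushforward _ _ _ _ _ _ (@measurable_tuple_cons R n) (mu \x lt n)%E)//.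
exact: measurableT_comp.
Qed.

Lemma integral_cons n (f : tup n.+1 -> \bar R) :
  (lt n.+1).-integrable setT f ->
  (\int[lt n.+1]_t f t = \int[mu]_x \int[lt n]_t f (tuple_cons (x, t)))%E.
Proof.
move=> fi; have fi' := integrable_cons fi.
rewrite [LHS](@integral_pushforward _ _ _ _ _ _ (@measurable_tuple_cons R n) (mu \x lt n)%E)//.
  by rewrite preimage_setT -integral12_prod_meas1.
exact: measurable_int fi.
Qed.

Lemma integral_cons_swap n (f : tup n.+1 -> \bar R) :
  (lt n.+1).-integrable setT f ->
  (\int[lt n.+1]_t f t = \int[lt n]_t \int[mu]_x f (tuple_cons (x, t)))%E.
Proof.
move=> fi; have fi' := integrable_cons fi.
rewrite integral_cons//; exact: (@Fubini _ _ _ _ _ mu (lt n) (fun z => f (tuple_cons z)) fi').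
Qed.

Definition sqn n (t : tup n) : R := \sum_i tnth t i ^+ 2.

Definition lin n (x : 'I_n -> R) (t : tup n) : R := \sum_i tnth t i * x i.

Lemma sqn_ge0 n (t : tup n) : 0 <= sqn t.
Proof. by apply: sumr_ge0 => i _; exact: sqr_ge0. Qed.

Lemma tnth_cons0 n (x : R) (t : tup n) : tnth (tuple_cons (x, t)) ord0 = x.
Proof. by []. Qed.

Lemma tnth_consS n (x : R) (t : tup n) i : tnth (tuple_cons (x, t)) (lift ord0 i) = tnth t i.
Proof. by rewrite /tuple_cons/= tnthS. Qed.

Lemma sqn_cons n (x : R) (t : tup n) : sqn (tuple_cons (x, t)) = x ^+ 2 + sqn t.
Proof.
rewrite /sqn big_ord_recl tnth_cons0; congr (_ + _).
by apply: eq_bigr => i _; rewrite tnth_consS.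
Qed.

Lemma lin_cons n (v : 'I_n.+1 -> R) (x : R) (t : tup n) :
  lin v (tuple_cons (x, t)) = v ord0 * x + lin (fun i => v (lift ord0 i)) t.
Proof.
rewrite /lin big_ord_recl tnth_cons0 mulrC; congr (_ + _).
by apply: eq_bigr => i _; rewrite tnth_consS.
Qed.

Lemma measurable_sqn n : measurable_fun setT (@sqn n).
Proof.
apply: measurable_sum => i; apply: measurable_funX; exact: measurable_tnth.
Qed.

Lemma measurable_lin n (v : 'I_n -> R) : measurable_fun setT (lin v).
Proof.
apply: measurable_sum => i; apply: measurable_funM => //; exact: measurable_tnth.
Qed.

Lemma measurable_gauss_sqn n (s : R) : measurable_fun setT (fun t : tup n => expR (- (s * sqn t))).
Proof.
apply: measurableT_comp => //; apply: measurableT_comp => //.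
by apply: measurable_funM => //; exact: measurable_sqn.
Qed.

Lemma integral_gauss_sqn n (s : R) : 0 < s ->
  (\int[lt n]_t (expR (- (s * sqn t)))%:E = (Num.sqrt (pi / s) ^+ n)%:E)%E.
Proof.
move=> s0; elim: n => [|n IH].
  rewrite [LHS]integral_dirac//; last by apply/measurable_EFinP; exact: measurable_gauss_sqn.
  rewrite diracT mul1e.
  by rewrite /sqn big_ord0 mulr0 oppr0 expR0 expr0.
rewrite ge0_integral_cons//; last by apply/measurable_EFinP; exact: measurable_gauss_sqn.
under eq_integral => x _.
  under eq_integral => t _.
    rewrite sqn_cons mulrDr opprD expRD EFinM; over.
  rewrite ge0_integralZl//=; last by apply/measurable_EFinP; exact: measurable_gauss_sqn.
  rewrite IH; over.
rewrite ge0_integralZr//; last first.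
  apply/measurable_EFinP; apply: continuous_measurable.
  exact: expR_sqr_cont.
by rewrite integral_gauss// -EFinM exprS.
Qed.

Lemma integrable_gauss_sqn n (s : R) : 0 < s ->
  (lt n).-integrable setT (EFin \o (fun t : tup n => expR (- (s * sqn t)))).
Proof.
move=> s0; apply/integrableP; split.
  by apply/measurable_EFinP; exact: measurable_gauss_sqn.
under eq_integral do rewrite gee0_abs ?lee_fin ?expR_ge0//.
by rewrite integral_gauss_sqn// ltry.
Qed.

Lemma measurable_wave n (v : 'I_n -> R) (th : R) :
  measurable_fun setT (fun t : tup n => cos (lin v t + th)).
Proof.
apply: measurableT_comp; first exact: (continuous_measurable (@continuous_cos R)).
by apply: measurable_funD => //; exact: measurable_lin.
Qed.

Lemma integrable_gauss_wave n (s : R) (v : 'I_n -> R) (th : R) : 0 < s ->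
  (lt n).-integrable setT (EFin \o (fun t : tup n => expR (- (s * sqn t)) * cos (lin v t + th))).
Proof.
move=> s0; apply: integrable_le_norm (integrable_gauss_sqn n s0) => //.
  by apply: measurable_funM; [exact: measurable_gauss_sqn|exact: measurable_wave].
move=> t _; rewrite normrM (ger0_norm (expR_ge0 _)) ler_piMr ?expR_ge0//.
by rewrite ler_norml cos_geN1 cos_le1.
Qed.

(** The phase [th] makes the induction work: for the inner integral [v ord0 * x + th] is again a
    phase, and it comes out as a cosine factor for the outer one. Later the phase -pi/2 gives the
    sine integrals. *)
Lemma integral_gauss_wave n (s : R) (v : 'I_n -> R) (th : R) : 0 < s ->
  (\int[lt n]_t (expR (- (s * sqn t)) * cos (lin v t + th))%:E =
  (cos th * Num.sqrt (pi / s) ^+ n * expR (- ((\sum_i v i ^+ 2) / (4 * s))))%:E)%E.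
Proof.
move=> s0; elim: n v th => [|n IH] v th.
  rewrite [LHS]integral_dirac//.
    rewrite diracT mul1e /sqn /lin !big_ord0 mulr0 mul0r oppr0 expR0 expr0 add0r.
    by congr (_%:E); ring.
  apply/measurable_EFinP; apply: measurable_funM; [exact: measurable_gauss_sqn|exact: measurable_wave].
rewrite integral_cons; last exact: integrable_gauss_wave.
set w := fun i => v (lift ord0 i).
transitivity (\int[mu]_x ((Num.sqrt (pi / s) ^+ n * expR (- ((\sum_i w i ^+ 2) / (4 * s)))) *
   (expR (- (s * x ^+ 2)) * cos (v ord0 * x + th)))%:E)%E.
  apply: eq_integral => x _.
  under eq_integral => t _.
    rewrite sqn_cons lin_cons mulrDr opprD expRD -mulrA -/w (addrC _ (lin w t)) -addrA EFinM; over.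
  rewrite integralZl//; last exact: integrable_gauss_wave.
  rewrite IH -EFinM; congr (_%:E); ring.
under eq_integral do rewrite EFinM.
rewrite integralZl//; last exact: integrable_gauss_cos.
have := congr1 EFin (Rintegral_gauss_fourier (v ord0) th s0).
rewrite fineK; last first.
  by apply: integrable_fin_num => //; exact: integrable_gauss_cos.
move=> ->; rewrite -EFinM; congr (_%:E).
have -> : \sum_i v i ^+ 2 = v ord0 ^+ 2 + \sum_i w i ^+ 2 by rewrite big_ord_recl.
rewrite (mulrDl (v ord0 ^+ 2)) opprD expRD (exprS _ n); ring.
Qed.

End tuple_integral.

(** * Radial Fourier integrals *)

Section bernstein.
Context {R : realType}.

Definition bern (n k : nat) (x : R) : R := 'C(n, k)%:R * x ^+ k * (1 - x) ^+ (n - k).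

Lemma bern_ge0 n k x : 0 <= x <= 1 -> 0 <= bern n k x.
Proof.
by move=> /andP[x0 x1]; rewrite /bern !mulr_ge0 ?exprn_ge0 ?ler0n// subr_ge0.
Qed.

Lemma sum_bern n x : \sum_(k < n.+1) bern n k x = 1.
Proof.
have := exprDn (1 - x) x n; rewrite subrK expr1n => ->.
by apply: eq_bigr => k _; rewrite /bern -mulr_natl; ring.
Qed.

(** From k C(n+1, k) = (n+1) C(n, k-1): a factor k lowers the degree by one. Applied once and twice
    it gives the first two moments of the binomial law. *)
Lemma sum_bernS (f : nat -> R) n x :
  \sum_(k < n.+2) f k * (k%:R * bern n.+1 k x) =
  n.+1%:R * x * \sum_(k < n.+1) f k.+1 * bern n k x.
Proof.
rewrite big_ord_recl mul0r mulr0 add0r mulr_sumr; apply: eq_bigr => k _.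
rewrite (_ : (lift ord0 k : nat) = k.+1)// /bern subSS.
have := mul_bin_diag n.+1 k => /(congr1 (fun m => m%:R : R)); rewrite !natrM => e.
rewrite exprS.
transitivity (f k.+1 * (k.+1%:R * 'C(n.+1, k.+1)%:R) * x * x ^+ k * (1 - x) ^+ (n - k)); first ring.
by rewrite -e; ring.
Qed.

Lemma sum_bern1 n x : \sum_(k < n.+1) k%:R * bern n k x = n%:R * x.
Proof.
case: n => [|n]; first by rewrite big_ord1 mul0r mul0r.
have := sum_bernS (fun=> 1) n x; under eq_bigr do rewrite mul1r.
by move=> ->; under eq_bigr do rewrite mul1r; rewrite sum_bern mulr1.
Qed.

Lemma sum_bern2 n x :
  \sum_(k < n.+1) k%:R ^+ 2 * bern n k x = n%:R * x * (n%:R * x + 1 - x).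
Proof.
case: n => [|n]; first by rewrite big_ord1 expr0n mul0r mul0r mul0r.
transitivity (\sum_(k < n.+2) k%:R * (k%:R * bern n.+1 k x)).
  by apply: eq_bigr => k _; rewrite expr2 mulrA.
rewrite (sum_bernS (fun k => k%:R)); congr (_ * _).
under eq_bigr do rewrite -natr1 mulrDl mul1r.
by rewrite big_split/= sum_bern1 sum_bern -natr1; ring.
Qed.

Lemma bern_variance n x :
  \sum_(k < n.+1) (k%:R - n%:R * x) ^+ 2 * bern n k x = n%:R * x * (1 - x).
Proof.
transitivity (\sum_(k < n.+1) (k%:R ^+ 2 * bern n k x - 2 * n%:R * x * (k%:R * bern n k x) +
   (n%:R * x) ^+ 2 * bern n k x)); first by apply: eq_bigr => k _; ring.
rewrite big_split/= sumrB -!mulr_sumr sum_bern sum_bern1 sum_bern2; ring.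
Qed.

Definition bernstein (f : R -> R) n (x : R) := \sum_(k < n.+1) f (k%:R / n%:R) * bern n k x.

(* Chebyshev: the Bernstein weights are those of a binomial law. *)
Lemma bernstein_near (f : R -> R) (M e d x : R) n : 0 < e -> 0 < d -> 0 <= x <= 1 ->
  (forall y : R, 0 <= y <= 1 -> `|x - y| < d -> `|f x - f y| <= e) ->
  (forall y : R, 0 <= y <= 1 -> `|f y| <= M) ->
  2 * M <= e * (d ^+ 2 * n.+1%:R) ->
  `|f x - bernstein f n.+1 x| <= 2 * e.
Proof.
move=> e0 d0 x01 fu fM nM; set m := n.+1.
have m0 : 0 < m%:R :> R by rewrite ltr0n.
have -> : f x - bernstein f m x = \sum_(k < m.+1) (f x - f (k%:R / m%:R)) * bern m k x.
  have e1 : f x = \sum_(k < m.+1) f x * bern m k x by rewrite -mulr_sumr sum_bern mulr1.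
  rewrite {1}e1 -sumrB.
  by apply: eq_bigr => k _; ring.
have M0 : 0 <= M by apply: le_trans (fM _ x01).
(* Chosen so that c (k - m x)^2 >= 2 M as soon as |x - k / m| >= d. *)
pose c := 2 * M / (d ^+ 2 * m%:R ^+ 2).
have c0 : 0 <= c by rewrite divr_ge0 ?mulr_ge0 ?exprn_ge0 ?(ltW d0)// ?ler0n.
have key (k : 'I_m.+1) : `|(f x - f (k%:R / m%:R)) * bern m k x| <=
   e * bern m k x + c * ((k%:R - m%:R * x) ^+ 2 * bern m k x).
  rewrite normrM (ger0_norm (bern_ge0 _ _ x01)) [c * _]mulrA -[leRHS]mulrDl ler_wpM2r ?bern_ge0//.
  have km : 0 <= (k%:R / m%:R : R) <= 1.
    by rewrite divr_ge0 ?ler0n//= ler_pdivrMr// mul1r ler_nat -ltnS.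
  have [xd|xd] := ltrP `|x - k%:R / m%:R| d.
    by rewrite (le_trans (fu _ km xd))// lerDl mulr_ge0// sqr_ge0.
  rewrite (@le_trans _ _ (2 * M))//.
    rewrite (le_trans (ler_normB _ _))// (mulr_natl M 2) mulr2n.
    by apply: lerD; apply: fM.
  apply: ler_wpDl; first exact: ltW.
  have -> : (k%:R - m%:R * x) ^+ 2 = m%:R ^+ 2 * (x - k%:R / m%:R) ^+ 2.
    by field; rewrite gt_eqF.
  have -> : c * (m%:R ^+ 2 * (x - k%:R / m%:R) ^+ 2) = 2 * M * ((x - k%:R / m%:R) ^+ 2 / d ^+ 2).
    by rewrite /c; field; rewrite !gt_eqF.
  rewrite ler_peMr ?mulr_ge0// ler_pdivlMr ?exprn_gt0// mul1r.
  rewrite -[leRHS]real_normK ?num_real//; rewrite lerXn2r ?nnegrE ?(ltW d0)//.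
rewrite (le_trans (ler_norm_sum _ _ _))//.
rewrite (le_trans (ler_sum _ (fun k _ => key k)))// big_split/= -!mulr_sumr.
rewrite sum_bern bern_variance mulr1 (mulr_natl e 2) mulr2n lerD2l.
have x1 : x * (1 - x) <= 1.
  by move/andP: x01 => [x0 x1]; nra.
rewrite (@le_trans _ _ (c * m%:R))//.
  by rewrite ler_wpM2l// -mulrA ler_piMr// ltW.
have -> : c * m%:R = 2 * M / (d ^+ 2 * m%:R).
  by rewrite /c; field; rewrite !gt_eqF.
by rewrite ler_pdivrMr ?mulr_gt0 ?exprn_gt0// mulrA.
Qed.

Lemma bernstein_bound (f : R -> R) (M x : R) n : 0 <= x <= 1 ->
  (forall y : R, 0 <= y <= 1 -> `|f y| <= M) -> `|bernstein f n.+1 x| <= M.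
Proof.
move=> x01 fM; rewrite (le_trans (ler_norm_sum _ _ _))//.
have Me : M = \sum_(k < n.+2) M * bern n.+1 k x by rewrite -mulr_sumr sum_bern mulr1.
rewrite [leRHS]Me; apply: ler_sum => k _.
rewrite normrM (ger0_norm (bern_ge0 _ _ x01)) ler_wpM2r ?bern_ge0//.
by apply: fM; rewrite divr_ge0 ?ler0n//= ler_pdivrMr ?ltr0n// mul1r ler_nat -ltnS.
Qed.

Lemma bernstein_cvg (f : R -> R) (M x : R) : 0 <= x <= 1 ->
  (forall y : R, 0 <= y <= 1 -> `|f y| <= M) -> {for x, continuous f} ->
  bernstein f n.+1 x @[n --> \oo] --> f x.
Proof.
move=> x01 fM cf; apply/cvgrPdist_le => e e0.
have e20 : 0 < e / 2 by rewrite divr_gt0.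
move/cvgrPdist_le : cf => /(_ _ e20) [d /= d0 fd].
have fu (y : R) : 0 <= y <= 1 -> `|x - y| < d -> `|f x - f y| <= e / 2.
  by move=> _ xy; apply: fd.
near=> n.
have -> : e = 2 * (e / 2) by field.
apply: (bernstein_near e20 d0 x01 fu fM).
rewrite mulrA -ler_pdivrMl ?mulr_gt0 ?exprn_gt0//.
rewrite (@le_trans _ _ n%:R) ?ler_nat//.
by near: n; exact: nbhs_infty_ger.
Unshelve. all: by end_near. Qed.

Definition bernstein_poly (f : R -> R) n : {poly R} :=
  \sum_(k < n.+1) (f (k%:R / n%:R) * 'C(n, k)%:R)%:P * 'X^k * (1 - 'X) ^+ (n - k).

Lemma horner_bernstein f n x : (bernstein_poly f n).[x] = bernstein f n x.
Proof.
rewrite /bernstein_poly horner_sum; apply: eq_bigr => k _.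
by rewrite !hornerM hornerC hornerXn horner_exp hornerD hornerN hornerX hornerC /bern !mulrA.
Qed.

End bernstein.

(** * Radial integrals under rotations and dilations *)

Section radial.
Context {R : realType}.
Notation mu := (@lebesgue_measure R).
Notation lt n := (@lebesgue_tuple R n).
Notation tup n := (n.-tuple (measurableTypeR R)).

(** The Gaussian is kept apart from [phi] because the symbols are merely bounded. The phase allows
    cosine and sine transforms to be treated together. *)
Definition radial n (phi : R -> R) (t : R) (v : 'I_n -> R) (th : R) : R :=
  \int[lt n]_z (phi (sqn z) * (expR (- (t * sqn z)) * cos (lin v z + th))).

Lemma measurable_radial n (phi : R -> R) (t : R) (v : 'I_n -> R) (th : R) :
  measurable_fun setT phi ->
  measurable_fun setT (fun z : tup n => phi (sqn z) * (expR (- (t * sqn z)) * cos (lin v z + th))).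
Proof.
move=> mphi; apply: measurable_funM.
  by apply: measurableT_comp => //; exact: measurable_sqn.
by apply: measurable_funM; [exact: measurable_gauss_sqn|exact: measurable_wave].
Qed.

Lemma norm_radial n (phi : R -> R) (t : R) (v : 'I_n -> R) (th : R) (z : tup n) :
  `|phi (sqn z) * (expR (- (t * sqn z)) * cos (lin v z + th))| <=
  `|phi (sqn z)| * expR (- (t * sqn z)).
Proof.
rewrite !normrM (ger0_norm (expR_ge0 _)) ler_wpM2l// ler_piMr ?expR_ge0//.
by rewrite ler_norml cos_geN1 cos_le1.
Qed.

Lemma integrable_gauss_sqnZ n (M t : R) : 0 < t ->
  (lt n).-integrable setT (EFin \o (fun z : tup n => M * expR (- (t * sqn z)))).
Proof. by move=> t0; apply: (integrableZl measurableT M (integrable_gauss_sqn n t0)). Qed.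

Lemma integrable_radial n (phi : R -> R) (M t : R) (v : 'I_n -> R) (th : R) : 0 < t ->
  measurable_fun setT phi -> (forall p, 0 <= p -> `|phi p| <= M) ->
  (lt n).-integrable setT (EFin \o (fun z : tup n =>
    phi (sqn z) * (expR (- (t * sqn z)) * cos (lin v z + th)))).
Proof.
move=> t0 mphi phiM; apply: integrable_le_norm (integrable_gauss_sqnZ n M t0) => //.
  exact: measurable_radial.
move=> z _; rewrite (le_trans (norm_radial _ _ _ _ _))// ler_wpM2r ?expR_ge0//.
exact/phiM/sqn_ge0.
Qed.

Lemma measurable_horner_exp (P : {poly R}) (c : R) :
  measurable_fun setT (fun p : R => P.[expR (- (c * p))]).
Proof.
apply: continuous_measurable => p.
apply: (@continuous_comp _ _ _ (fun p => expR (- (c * p))) (horner P)); last exact: continuous_horner.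
apply: continuous_comp; last exact: continuous_expR.
by apply: cvgN; apply: cvgMr; exact: cvg_id.
Qed.

Lemma horner_exp_bound (P : {poly R}) :
  exists M : R, forall p : R, 0 <= p -> `|P.[expR (- p)]| <= M.
Proof.
exists (\sum_(i < size P) `|P`_i|) => p p0.
rewrite horner_coef (le_trans (ler_norm_sum _ _ _))//; apply: ler_sum => i _.
rewrite normrM ler_piMr// ger0_norm ?exprn_ge0 ?expR_ge0// exprn_ile1 ?expR_ge0//.
by rewrite -expR0 ler_expR oppr_le0.
Qed.

(** A factor ['X] multiplies the integrand by one more exp(-c p), that is, replaces [t] by [t + 1];
    hence the induction runs over all [t]. The constant term is a Gaussian integral, which sees [v]
    only through its length. *)
Lemma radial_poly n (P : {poly R}) (c t : R) (v w : 'I_n -> R) (th : R) : 0 < c -> 0 < t ->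
  \sum_i v i ^+ 2 = c * \sum_i w i ^+ 2 ->
  radial (fun p => P.[expR (- (c * p))]) (c * t) v th =
  cos th * (Num.sqrt c) ^- n * radial (fun p => P.[expR (- p)]) t w 0.
Proof.
move=> c0 + vw; elim/poly_ind: P t => [|P a IH] t t0.
  rewrite /radial; under eq_Rintegral do rewrite horner0 mul0r.
  by under [in RHS]eq_Rintegral do rewrite horner0 mul0r; rewrite Rintegral_cst// mul0r mulr0.
have [M PM] := horner_exp_bound P.
have ct0 s : 0 < s -> 0 < c * s by move=> s0; rewrite mulr_gt0.
have t10 : 0 < t + 1 by rewrite addr_gt0.
have step (k s : R) (u : 'I_n -> R) (h : R) : 0 < k -> 0 < s ->
    radial (fun p => (P * 'X + a%:P).[expR (- (k * p))]) (k * s) u h =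
    radial (fun p => P.[expR (- (k * p))]) (k * (s + 1)) u h +
    a * \int[lt n]_z (expR (- (k * s * sqn z)) * cos (lin u z + h)).
  move=> k0 s0; rewrite -RintegralZl//; last first.
    by apply: integrable_gauss_wave; rewrite mulr_gt0.
  rewrite -RintegralD//; last 2 first.
  - apply: (@integrable_radial n (fun p => P.[expR (- (k * p))]) M); first by rewrite mulr_gt0// addr_gt0.
      exact: measurable_horner_exp.
    by move=> p p0; apply: PM; rewrite mulr_ge0// ltW.
  - apply: integrable_scale => //.
    by apply: integrable_gauss_wave; rewrite mulr_gt0.
  apply: eq_Rintegral => z _; 
  have -> : expR (- (k * (s + 1) * sqn z)) = expR (- (k * s * sqn z)) * expR (- (k * sqn z)).
    by rewrite -expRD; congr expR; ring.
  by rewrite hornerMXaddC; ring.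
have E1 (Q : {poly R}) : (fun p : R => Q.[expR (- (1 * p))]) = (fun p => Q.[expR (- p)]).
  by apply/funext => p; rewrite mul1r.
have step1 := step 1 t w 0 ltr01 t0; rewrite !E1 !mul1r in step1.
rewrite step1 (step c t v th c0 t0).
have G s (u : 'I_n -> R) (h : R) : 0 < s -> \int[lt n]_z (expR (- (s * sqn z)) * cos (lin u z + h)) =
    cos h * Num.sqrt (pi / s) ^+ n * expR (- ((\sum_i u i ^+ 2) / (4 * s))).
  by move=> s0; rewrite /Rintegral integral_gauss_wave.
rewrite (IH _ t10) (G _ v th (ct0 _ t0)) (G _ w 0 t0) [RHS]mulrDr; congr (_ + _).
rewrite cos0 mul1r.
have -> : (\sum_i v i ^+ 2) / (4 * (c * t)) = (\sum_i w i ^+ 2) / (4 * t).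
  by rewrite vw; field; rewrite !gt_eqF.
have -> : Num.sqrt (pi / (c * t)) = Num.sqrt (pi / t) / Num.sqrt c.
  rewrite -sqrtrV ?(ltW c0)// -sqrtrM ?divr_ge0 ?pi_ge0 ?(ltW t0)//; congr Num.sqrt.
  by field; rewrite !gt_eqF.
by rewrite exprMn exprVn; ring.
Qed.

(** The substitution u = exp(-c p) turns [phi] into [f u = phi |ln u|] on ]0, 1]. Since exp(-c p) is
    never 0, pointwise convergence for u > 0 together with the uniform bound [M] is enough for
    dominated convergence. *)
Lemma radial_bernstein_cvg n (phi : R -> R) (M c t : R) (v : 'I_n -> R) (th : R) :
  0 < c -> 0 < t -> continuous (fun p : R => phi `|p|) -> (forall p, 0 <= p -> `|phi p| <= M) ->
  radial (fun p => (bernstein_poly (fun u => phi `|ln u|) k.+1).[expR (- (c * p))]) (c * t) v th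
    @[k --> \oo] --> radial (fun p => phi (c * p)) (c * t) v th.
Proof.
move=> c0 t0 cphi phiM.
have ct0 : 0 < c * t by rewrite mulr_gt0.
have M0 : 0 <= M by apply: le_trans (phiM 0 _).
pose f (u : R) := phi `|ln u|.
have fM (y : R) : 0 <= y <= 1 -> `|f y| <= M by move=> _; apply: phiM.
pose W (z : tup n) := expR (- (c * t * sqn z)) * cos (lin v z + th).
have mW : measurable_fun setT W.
  by apply: measurable_funM; [exact: measurable_gauss_sqn|exact: measurable_wave].
have ep (z : tup n) : 0 <= expR (- (c * sqn z)) <= 1.
  rewrite expR_ge0/= -expR0 ler_expR oppr_le0 mulr_ge0 ?sqn_ge0// ltW//.
apply: fine_cvg; rewrite fineK; last first.
  apply: integrable_fin_num => //.
  apply: (@integrable_le_norm _ _ _ _ _ _ (fun z => M * expR (- (c * t * sqn z)))) => //.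
  - have mc : measurable_fun setT (fun p : R => phi `|p|) by exact: continuous_measurable.
    have mz : measurable_fun setT (fun z : tup n => phi `|c * sqn z|).
      apply: (measurableT_comp mc); apply: measurable_funM => //; exact: measurable_sqn.
    have := measurable_funM mz mW; apply: eq_measurable_fun => z _.
    by rewrite /= ger0_norm// mulr_ge0 ?sqn_ge0// ltW.
  - move=> z _; rewrite normrM ler_pM//; first by apply: phiM; rewrite mulr_ge0 ?sqn_ge0// ltW.
    rewrite normrM (ger0_norm (expR_ge0 _)) ler_piMr ?expR_ge0//.
    by rewrite ler_norml cos_geN1 cos_le1.
  - exact: integrable_gauss_sqnZ.
apply: (@dominated_cvg _ _ _ (lt n) setT measurableT
   (fun k z => ((bernstein_poly f k.+1).[expR (- (c * sqn z))] * W z)%:E) _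
   (fun z => (M * expR (- (c * t * sqn z)))%:E)) => //.
- move=> k; apply/measurable_EFinP; apply: measurable_funM => //.
  by apply: (measurableT_comp (measurable_horner_exp _ c)); exact: measurable_sqn.
- move=> z _; apply: cvg_EFin; first exact: nearW.
  apply: cvgMl; under eq_fun do rewrite horner_bernstein.
  have -> : phi (c * sqn z) = f (expR (- (c * sqn z))).
    by rewrite /f expRK normrN ger0_norm// mulr_ge0 ?sqn_ge0// ltW.
  apply: (bernstein_cvg (ep z) fM).
  apply: (@continuous_comp _ _ _ (fun u => ln u) (fun p => phi `|p|)).
    by apply: continuous_ln; exact: expR_gt0.
  exact: cphi.
- exact: integrable_gauss_sqnZ.
- move=> k z _; rewrite lee_fin normrM ler_pM//.
    by rewrite horner_bernstein; exact: bernstein_bound.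
  rewrite normrM (ger0_norm (expR_ge0 _)) ler_piMr ?expR_ge0//.
  by rewrite ler_norml cos_geN1 cos_le1.
Qed.

(* Polynomials in [exp (- p)] are dense among bounded continuous [phi], and for them both
   sides are explicit Gaussian integrals. *)
Lemma radial_transform n (phi : R -> R) (M c t : R) (v w : 'I_n -> R) (th : R) :
  0 < c -> 0 < t -> continuous (fun p : R => phi `|p|) -> (forall p, 0 <= p -> `|phi p| <= M) ->
  \sum_i v i ^+ 2 = c * \sum_i w i ^+ 2 ->
  radial (fun p => phi (c * p)) (c * t) v th =
  cos th * (Num.sqrt c) ^- n * radial phi t w 0.
Proof.
move=> c0 t0 cphi phiM vw.
have h1 := @radial_bernstein_cvg n phi M c t v th c0 t0 cphi phiM.
have := @radial_bernstein_cvg n phi M 1 t w 0 ltr01 t0 cphi phiM => h2.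
have h3 : radial (fun p => (bernstein_poly (fun u => phi `|ln u|) k.+1).[expR (- (c * p))]) (c * t) v th
    @[k --> \oo] --> cos th * (Num.sqrt c) ^- n * radial phi t w 0.
  rewrite (_ : (fun k => _) = (fun k => cos th * (Num.sqrt c) ^- n *
    radial (fun p => (bernstein_poly (fun u => phi `|ln u|) k.+1).[expR (- p)]) t w 0)); last first.
    by apply/funext => k; rewrite (radial_poly _ _ c0 t0 vw).
  apply: cvgMr; move: h2; rewrite mul1r.
  rewrite (_ : (fun p => phi (1 * p)) = phi); last by apply/funext => p; rewrite mul1r.
  apply: cvg_trans; apply: near_eq_cvg; apply: nearW => k.
  by apply: (congr1 (fun h => radial h t w 0)); apply/funext => p; rewrite mul1r.
exact: (cvg_unique _ h1 h3).
Qed.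

End radial.

(** * Powers as Laplace transforms *)

Section scaling_line.
Context {R : realType}.
Notation mu := (@lebesgue_measure R).

(** Lebesgue measure equals [c] times its own image under multiplication by [c]: the two agree on
    intervals. *)
Lemma ge0_integral_scale (c : R) (f : R -> \bar R) : 0 < c ->
  measurable_fun setT f -> (forall x, 0 <= f x)%E ->
  (\int[mu]_x f x = c%:E * \int[mu]_x f (c * x)%R)%E.
Proof.
move=> c0 mf f0.
pose phi := (fun x : measurableTypeR R => c * x : measurableTypeR R).
have mphi : measurable_fun setT phi by exact: measurable_funM.
pose pf := measure_function_pushforward__canonical__measure_function_Measure mu mphi.
pose nu := mscale (NngNum (ltW c0)) pf.
transitivity (\int[nu]_x f x)%E.
  apply: eq_measure_integral => A mA _.
  apply: (@lebesgue_measure_unique R nu) => // _ [[a b]] _ <-.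
  transitivity (c%:E * mu (phi @^-1` `]a, b]))%E; last by [].
  have -> : phi @^-1` `]a, b] = `]c^-1 * a, c^-1 * b]%classic.
    apply/seteqP; split => x; rewrite /phi /= !in_itv/=;
    by rewrite ltr_pdivrMl// ler_pdivlMl.
  rewrite !lebesgue_measure_itv/= !lte_fin ltr_pM2l ?invr_gt0//.
  case: ifP => _; last by rewrite mule0.
  by rewrite -!EFinB -EFinM -mulrBr mulrA divff ?mul1r// gt_eqF.
rewrite ge0_integral_mscale//; congr (_ * _)%E.
by rewrite ge0_integral_pushforward// preimage_setT.
Qed.

Lemma ge0_integral_exhaustion_le (D : set (measurableTypeR R)) (A : nat -> set (measurableTypeR R)) (f : R -> R) (C : R) :
  nondecreasing_seq A -> (forall k, measurable (A k)) -> \bigcup_k A k = D ->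
  measurable_fun setT f -> (forall x, D x -> 0 <= f x) ->
  (forall k, \int[mu]_(x in A k) (f x)%:E <= C%:E)%E ->
  (\int[mu]_(x in D) (f x)%:E <= C%:E)%E.
Proof.
move=> ndA mA AD mf f0 fC.
have := @ge0_nondecreasing_set_cvg_integral _ (measurableTypeR R) R A (EFin \o f) mu ndA mA.
rewrite AD => H.
have {}H := H _ _.
apply: (@cvge_to_le _ _ _ _ _ _ _ (H _ _)).
- by move=> i; apply/measurable_EFinP; exact: measurable_funS mf.
- by move=> i x Ax; rewrite lee_fin f0// -AD; exists i.
- exact: nearW.
Qed.

Lemma is_derive_powR (a x : R) : 0 < x -> is_derive x 1 (@powR R ^~ a) (a * x `^ (a - 1)).
Proof.
move=> x0; apply: DeriveDef; first by apply: derivable_powR; rewrite in_itv/= x0.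
by rewrite -derive1E powR_derive1// in_itv/= x0.
Qed.

Lemma powR_cont (a x : R) : 0 < x -> {for x, continuous (@powR R ^~ a)}.
Proof.
move=> x0; apply/differentiable_continuous/derivable1_diffP.
by have := is_derive_powR a x0; case.
Qed.

Lemma integral_powR_itv (a u v : R) : a != 0 -> 0 < u -> u < v ->
  (\int[mu]_(x in `[u, v]) (x `^ (a - 1))%:E = (a^-1 * (v `^ a - u `^ a))%:E)%E.
Proof.
move=> a0 u0 uv.
have pos x : x \in `[u, v] -> 0 < x.
  by rewrite in_itv/= => /andP[ux _]; exact: lt_le_trans ux.
have d (x : R) : 0 < x -> is_derive x 1 (fun x => a^-1 * x `^ a) (x `^ (a - 1)).
  move=> x0; have := is_deriveZ a^-1 (is_derive_powR a x0) => h.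
  by apply: is_derive_eq; rewrite /GRing.scale/= mulrA mulVf// mul1r.
have c (x : R) : 0 < x -> {for x, continuous (fun x => a^-1 * x `^ a)}.
  by move=> x0; apply: cvgMr; exact: powR_cont.
rewrite (@continuous_FTC2 _ _ (fun x => a^-1 * x `^ a))//.
- by rewrite -EFinB mulrBr.
- apply/continuous_within_itvP => //; split.
  + by move=> x xuv; apply: powR_cont; apply: pos; exact: subset_itv_oo_cc xuv.
  + exact/cvg_at_right_filter/powR_cont.
  + by apply/cvg_at_left_filter/powR_cont; exact: lt_trans uv.
- split.
  + move=> x xuv; have x0 := pos _ (subset_itv_oo_cc xuv).
    by have := d x x0; case.
  + exact/cvg_at_right_filter/c.
  + by apply/cvg_at_left_filter/c; exact: lt_trans uv.
- move=> x xuv; have x0 := pos _ (subset_itv_oo_cc xuv).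
  by rewrite derive1E; have := d x x0; case.
Qed.

Lemma integral_powR_01 (a : R) : 0 < a ->
  (\int[mu]_(x in `]0%R, 1%R]) (x `^ (a - 1))%:E <= (a^-1)%:E)%E.
Proof.
move=> a0; apply: (@ge0_integral_exhaustion_le _ (fun k => `[k.+2%:R^-1, 1]%classic)) => //.
- move=> i j ij; apply/subsetPset => x /=; rewrite !in_itv/= => /andP[ix ->].
  rewrite andbT (le_trans _ ix)// lef_pV2 ?posrE ?ltr0n// ler_nat//.
- apply/seteqP; split => [x [k _]|x]/=; rewrite !in_itv/=.
    by move=> /andP[kx ->]; rewrite andbT (lt_le_trans _ kx)// invr_gt0 ltr0n.
  move=> /andP[x0 x1].
  exists (Num.truncn x^-1) => //=; rewrite in_itv/= x1 andbT.
  rewrite invf_ple ?posrE ?ltr0n// ltW// (lt_trans (truncnS_gt _))// ltr_nat//.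
- by move=> x _; exact: powR_ge0.
- move=> k; rewrite integral_powR_itv ?gt_eqF ?invr_gt0 ?ltr0n//.
    by rewrite lee_fin powR1 ler_piMr ?invr_ge0 ?(ltW a0)// gerBl powR_ge0.
  by rewrite invf_plt ?posrE ?ltr0n// invr1 ltr1n.
Qed.

Lemma integral_powR_1y (a : R) : 0 < a ->
  (\int[mu]_(x in `[1%R, +oo[) (x `^ (- a - 1))%:E <= (a^-1)%:E)%E.
Proof.
move=> a0; apply: (@ge0_integral_exhaustion_le _ (fun k => `[1, k.+2%:R]%classic)) => //.
- move=> i j ij; apply/subsetPset => x /=; rewrite !in_itv/= => /andP[-> xi].
  by rewrite (le_trans xi)// ler_nat.
- apply/seteqP; split => [x [k _]|x]/=; rewrite !in_itv/=.
    by move=> /andP[-> _].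
  move=> /andP[x1 _].
  exists (Num.truncn x) => //=; rewrite in_itv/= x1/=.
  by rewrite ltW// (lt_trans (truncnS_gt _))// ltr_nat//.
- by move=> x _; exact: powR_ge0.
- move=> k; rewrite integral_powR_itv ?oppr_eq0 ?gt_eqF ?ltr1n//.
  rewrite lee_fin powR1 invrN mulNr -mulrN opprB.
  by rewrite ler_piMr ?invr_ge0 ?(ltW a0)// gerBl powR_ge0.
Qed.

(** The density whose Laplace transform is Gamma(b) p^(-b). It vanishes for s <= 0, so that all
    integrals in [s] can run over the whole line. *)
Definition power_kernel (b : R) : R -> R := (@powR R ^~ (b - 1)) \_ `]0, +oo[.

Lemma power_kernelE (b s : R) : 0 < s -> power_kernel b s = s `^ (b - 1).
Proof. by move=> s0; rewrite /power_kernel patchE mem_set//= in_itv/= s0. Qed.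

Lemma power_kernel0 (b s : R) : s <= 0 -> power_kernel b s = 0.
Proof.
move=> s0; rewrite /power_kernel patchE memNset//= in_itv/= andbT.
by apply/negP; rewrite -leNgt.
Qed.

Lemma power_kernel_ge0 (b s : R) : 0 <= power_kernel b s.
Proof. by rewrite /power_kernel patchE; case: ifP => // _; exact: powR_ge0. Qed.

Lemma measurable_power_kernel (b : R) : measurable_fun setT (power_kernel b).
Proof.
apply/(measurable_restrictT (@powR R ^~ (b - 1)) (measurable_itv `]0, +oo[)).
by apply: measurable_funS (@measurable_powR R (b - 1)).
Qed.

Definition small_part (f : R -> R) : R -> R := f \_ `]0, 1].
Definition large_part (f : R -> R) : R -> R := f \_ `[1, +oo[.

Lemma small_partE (f : R -> R) (s : R) : 0 < s -> s <= 1 -> small_part f s = f s.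
Proof. by move=> s0 s1; rewrite /small_part patchE mem_set//= in_itv/= s0. Qed.

Lemma large_partE (f : R -> R) (s : R) : 1 <= s -> large_part f s = f s.
Proof. by move=> s1; rewrite /large_part patchE mem_set//= in_itv/= s1. Qed.

Lemma small_part0 (f : R -> R) (s : R) : s <= 0 -> small_part f s = 0.
Proof.
move=> s0; rewrite /small_part patchE memNset//= in_itv/= => /andP[].
by rewrite ltNge s0.
Qed.

Lemma integrable_restrict_powR (D : set (measurableTypeR R)) (b C : R) : measurable D ->
  (\int[mu]_(x in D) (x `^ b)%:E <= C%:E)%E ->
  mu.-integrable setT (EFin \o ((@powR R ^~ b) \_ D)).
Proof.
move=> mD DC; have -> : EFin \o ((@powR R ^~ b) \_ D) = (EFin \o (@powR R ^~ b)) \_ D.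
  by apply/funext => x; rewrite /= !patchE; case: ifP.
apply/(integrable_mkcond _ mD); apply/integrableP; split.
  by apply/measurable_EFinP; apply: measurable_funS (@measurable_powR R b).
under eq_integral do rewrite gee0_abs ?lee_fin ?powR_ge0//.
by rewrite (le_lt_trans DC)// ltry.
Qed.

Lemma integrable_small_power (a : R) : 0 < a ->
  mu.-integrable setT (EFin \o small_part (@powR R ^~ (a - 1))).
Proof.
by move=> a0; apply: integrable_restrict_powR (integral_powR_01 a0).
Qed.

Lemma integrable_large_power (a : R) : 0 < a ->
  mu.-integrable setT (EFin \o large_part (@powR R ^~ (- a - 1))).
Proof.
by move=> a0; apply: integrable_restrict_powR (integral_powR_1y a0).
Qed.

(* [(x / b) `^ b <= exp x] since [x / b <= exp (x / b)]. *)
Lemma powR_le_expR (b x : R) : 0 < b -> 0 <= x -> x `^ b <= b `^ b * expR x.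
Proof.
move=> b0 x0; have xb : x = b * (x / b) by field; rewrite gt_eqF.
have x0b : 0 <= x / b by rewrite divr_ge0// ltW.
rewrite {1}xb powRM ?(ltW b0)// ler_wpM2l ?powR_ge0//.
have -> : expR x = expR (x / b) `^ b by rewrite -expRM divfK ?gt_eqF.
apply: ge0_ler_powR; rewrite ?nnegrE ?expR_ge0 ?(ltW b0)//.
by rewrite (le_trans _ (expR_ge1Dx _))// lerDr.
Qed.

Lemma powR_expRN_le (b c x : R) : 0 < b -> 0 < c -> 0 < x ->
  x `^ b * expR (- (c * x)) <= (b / c) `^ b.
Proof.
move=> b0 c0 x0; have cx : 0 <= c * x by rewrite mulr_ge0 ?ltW.
have := powR_le_expR b0 cx; rewrite powRM ?(ltW c0) ?(ltW x0)// => h.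
rewrite expRN ler_pdivrMr ?expR_gt0// powRM ?(ltW b0) ?invr_ge0 ?(ltW c0)//.
rewrite -powR_inv1 ?(ltW c0)// -powRrM mulN1r powRN -mulrA mulrCA ler_pdivlMl ?powR_gt0//.
Qed.

Lemma integrable_power_exp (a c : R) : 0 < a -> 0 < c ->
  mu.-integrable setT (EFin \o (fun s => power_kernel a s * expR (- (c * s)))).
Proof.
move=> a0 c0.
(* A bound for x^(2 a) exp(-c x); beyond 1 the integrand is therefore at most C x^(-a - 1). *)
pose C := (2 * a / c) `^ (2 * a).
have iC := integrable_scale (C : R) measurableT (integrable_large_power a0).
have := integrableD measurableT (integrable_small_power a0) iC.
apply: (@integrable_le_norm _ _ _ mu setT _ (fun s => small_part (@powR R ^~ (a - 1)) s + C * large_part (@powR R ^~ (- a - 1)) s)) => //.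
  apply: measurable_funM; first exact: measurable_power_kernel.
  apply: continuous_measurable => x; apply: continuous_comp; last exact: continuous_expR.
  by apply: cvgN; apply: cvgMr; exact: cvg_id.
have sp0 x : 0 <= small_part (@powR R ^~ (a - 1)) x.
  by rewrite /small_part patchE; case: ifP => // _; exact: powR_ge0.
have lp0 x : 0 <= large_part (@powR R ^~ (- a - 1)) x.
  by rewrite /large_part patchE; case: ifP => // _; exact: powR_ge0.
have C0 : 0 <= C by exact: powR_ge0.
move=> x _; rewrite ger0_norm ?mulr_ge0 ?power_kernel_ge0 ?expR_ge0//.
have [x0|x0] := leP x 0.
  by rewrite power_kernel0// mul0r addr_ge0// mulr_ge0.
rewrite power_kernelE//; have [x1|x1] := leP x 1.
  rewrite small_partE// (@le_trans _ _ (x `^ (a - 1)))//.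
    by rewrite ler_piMr ?powR_ge0// -expR0 ler_expR oppr_le0 mulr_ge0 ?ltW.
  by rewrite lerDl mulr_ge0.
rewrite (large_partE _ (ltW x1)) (@le_trans _ _ (C * x `^ (- a - 1)))//; last first.
  by rewrite lerDr.
have -> : x `^ (a - 1) = x `^ (2 * a) * x `^ (- a - 1).
  rewrite [a - 1](_ : _ = 2 * a + (- a - 1)); last by ring.
  by rewrite powRD// (gt_eqF x0) implybT.
by rewrite mulrAC ler_wpM2r ?powR_ge0// powR_expRN_le// mulr_gt0.
Qed.

Definition gammaR (a : R) : R := \int[mu]_s (power_kernel a s * expR (- s)).

Lemma power_kernel_scale (a p s : R) : 0 < p ->
  power_kernel a (p * s) = p `^ (a - 1) * power_kernel a s.
Proof.
move=> p0; have [s0|s0] := leP s 0.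
  by rewrite !power_kernel0 ?mulr0// pmulr_rle0.
by rewrite !power_kernelE ?mulr_gt0// powRM ?ltW.
Qed.

Lemma measurable_power_exp (a c : R) :
  measurable_fun setT (fun s => power_kernel a s * expR (- (c * s))).
Proof.
apply: measurable_funM; first exact: measurable_power_kernel.
apply: continuous_measurable => x; apply: continuous_comp; last exact: continuous_expR.
by apply: cvgN; apply: cvgMr; exact: cvg_id.
Qed.

Lemma power_exp_ge0 (a c s : R) : 0 <= power_kernel a s * expR (- (c * s)).
Proof. by rewrite mulr_ge0 ?power_kernel_ge0 ?expR_ge0. Qed.

Lemma Rintegral_power_exp (a p : R) : 0 < a -> 0 < p ->
  \int[mu]_s (power_kernel a s * expR (- (p * s))) = gammaR a * p `^ (- a).
Proof.
move=> a0 p0; rewrite /gammaR /Rintegral.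
have fin1 := integrable_fin_num measurableT (integrable_power_exp a0 p0).
rewrite [in RHS](_ : (\int[mu]_s _)%E = (\int[mu]_s (power_kernel a s * expR (- (1 * s)))%:E)%E); last first.
  by apply: eq_integral => s _; rewrite mul1r.
rewrite (ge0_integral_scale p0); last 2 first.
- by apply/measurable_EFinP; exact: measurable_power_exp.
- by move=> x; rewrite lee_fin power_exp_ge0.
under [in RHS]eq_integral => s _.
  rewrite power_kernel_scale// mul1r -mulrA EFinM; over.
rewrite ge0_integralZl//; last 3 first.
- by apply/measurable_EFinP; exact: measurable_power_exp.
- by move=> s _; rewrite lee_fin power_exp_ge0.
- by rewrite lee_fin powR_ge0.
rewrite muleA -EFinM fineM//= -[LHS]mul1r.
rewrite mulrAC; congr (_ * _).
have -> : p * p `^ (a - 1) = p `^ a by rewrite mulr_powRB1 ?ltW.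
by rewrite -powRD ?addrN ?powRr0// (gt_eqF p0) implybT.
Qed.

Lemma gammaR_gt0 (a : R) : 0 < a -> 0 < gammaR a.
Proof.
(* A lower bound for the integrand on [1, 2], where s^(a - 1) >= s^(-1) >= 1/2. *)
move=> a0; pose m : R := expR (- 2) / 2.
have m0 : 0 < m by rewrite divr_gt0 ?expR_gt0.
rewrite /gammaR /Rintegral -lte_fin fineK; last first.
  have := integrable_fin_num measurableT (integrable_power_exp a0 ltr01).
  congr (_ \is a fin_num); apply: eq_integral => s _; by rewrite /= mul1r.
apply: (@lt_le_trans _ _ (\int[mu]_(s in `[1%R, 2%R]) (m%:E))%E).
  rewrite integral_cst//= lebesgue_measure_itv/= lte_fin ltr1n -EFinB -EFinM lte_fin.
  by rewrite mulr_gt0// subr_gt0 ltr1n.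
have mf : measurable_fun setT (fun s => (power_kernel a s * expR (- s))%:E).
  apply/measurable_EFinP; have := @measurable_power_exp a 1.
  by under eq_fun do rewrite mul1r.
apply: (@le_trans _ _ (\int[mu]_(s in `[1%R, 2%R]) (power_kernel a s * expR (- s))%:E)%E).
  apply: ge0_le_integral => //.
  - by move=> s _; rewrite lee_fin ltW.
  - by apply: measurable_funS mf.
  move=> s /=; rewrite in_itv/= => /andP[s1 s2]; rewrite lee_fin.
  have s0 : 0 < s by rewrite (lt_le_trans _ s1).
  rewrite power_kernelE// /m mulrC ler_pM ?invr_ge0 ?expR_ge0 ?ler_expR ?lerN2//.
  rewrite (@le_trans _ _ (s `^ (-1)))//; first by rewrite powR_inv1 ?(ltW s0)// lef_pV2 ?posrE.
  by rewrite ler_powR// lerBrDr addNr ltW.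
apply: ge0_subset_integral => //.
by move=> s _; rewrite lee_fin mulr_ge0 ?power_kernel_ge0 ?expR_ge0.
Qed.

End scaling_line.

(** * Subordination: Laplace transforms as superpositions of Gaussians *)

Section subordination.
Context {R : realType}.
Notation mu := (@lebesgue_measure R).
Notation lt n := (@lebesgue_tuple R n).
Notation tup n := (n.-tuple (measurableTypeR R)).

(** For s > 0 this is (pi / s)^(n/2) exp(-q / (4 s)), the Fourier transform of exp(-s |xi|^2) at a
    point of squared length [q]. Writing it with [powR] makes it visibly measurable in [s] on the
    whole line. *)
Definition gauss_kernel (n : nat) (q s : R) : R :=
  pi `^ (n%:R / 2) * s `^ (- (n%:R / 2)) * expR (- (q / 4 * s `^ (-1))).

Lemma gauss_kernelE n (q s : R) : 0 < s ->
  gauss_kernel n q s = Num.sqrt (pi / s) ^+ n * expR (- (q / (4 * s))).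
Proof.
move=> s0; rewrite /gauss_kernel powR_inv1 ?ltW//; congr (_ * expR (- _)); last first.
  by field; rewrite gt_eqF.
have ps : 0 <= pi / s by rewrite divr_ge0 ?pi_ge0 ?ltW.
rewrite -powR12_sqrt// -powR_mulrn ?powR_ge0// -powRrM mulrC.
have -> : s^-1 = s `^ (-1) by rewrite powR_inv1 ?ltW.
rewrite powRM ?pi_ge0 ?powR_ge0// -powRrM mulrC.
by congr (_ `^ _ * _ `^ _); field.
Qed.

Lemma gauss_kernel_ge0 n (q s : R) : 0 <= gauss_kernel n q s.
Proof. by rewrite !mulr_ge0 ?powR_ge0 ?expR_ge0. Qed.

Lemma gauss_kernel_le n (q s : R) : 0 <= q -> gauss_kernel n q s <= gauss_kernel n 0 s.
Proof.
move=> q0; rewrite /gauss_kernel ler_wpM2l ?mulr_ge0 ?powR_ge0// ler_expR.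
by rewrite !mul0r oppr0 oppr_le0 mulr_ge0 ?powR_ge0// divr_ge0.
Qed.

Lemma measurable_gauss_kernel n (q t : R) : measurable_fun setT (fun s : R => gauss_kernel n q (s + t)).
Proof.
have mt : measurable_fun setT (fun s : R => s + t) by exact: measurable_funD.
apply: measurable_funM.
  by apply: measurable_funM => //; exact: (measurableT_comp (measurable_powR _)).
apply: measurableT_comp => //; apply: measurableT_comp => //; apply: measurable_funM => //.
exact: (measurableT_comp (measurable_powR _)).
Qed.

Definition laplace (k : R -> R) (p : R) : R := \int[mu]_s (k s * expR (- (s * p))).

Variables (k : R -> R).
Hypothesis mk : measurable_fun setT k.
Hypothesis k_ge0 : forall s, 0 <= k s.
Hypothesis k0 : forall s, s <= 0 -> k s = 0.

Lemma measurable_laplace : measurable_fun setT (laplace k).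
Proof.
pose f (z : measurableTypeR R * measurableTypeR R) := (k z.2 * expR (- (z.2 * z.1)))%:E.
have mf : measurable_fun setT f.
  apply/measurable_EFinP; apply: measurable_funM; first exact: (measurableT_comp mk).
  apply: measurableT_comp => //; apply: measurableT_comp => //.
  exact: measurable_funM.
have := @measurable_fun_fubini_tonelli_F _ _ _ _ R mu f mf _.
move=> H; apply: (@measurableT_comp _ _ _ _ _ _ fine) => //; apply: H.
by move=> z; rewrite /f lee_fin mulr_ge0// expR_ge0.
Qed.

Section at_time.
Variables (n : nat) (t : R).
Hypothesis t_ge0 : 0 <= t.
Hypothesis ik : mu.-integrable setT (EFin \o (fun s => k s * gauss_kernel n 0 (s + t))).

Let F (z : tup n * measurableTypeR R) : R := k z.2 * expR (- ((z.2 + t) * sqn z.1)).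

Let F_ge0 z : 0 <= F z. Proof. by rewrite mulr_ge0// expR_ge0. Qed.

Let mF : measurable_fun setT F.
Proof.
apply: measurable_funM; first exact: (measurableT_comp mk).
apply: measurableT_comp => //; apply: measurableT_comp => //.
apply: measurable_funM; first exact: measurable_funD.
by apply: (measurableT_comp (@measurable_sqn R n)).
Qed.

(** Integrating the frequency out first turns this into the hypothesis on
    [gauss_kernel n 0 (s + t)]; the value t = 0 is therefore allowed when the density decays well
    enough. *)
Let iF : (lt n \x mu)%E.-integrable setT (EFin \o F).
Proof.
apply/integrable21ltyP; first exact/measurable_EFinP.
move/integrableP : ik => [_]; apply: le_lt_trans.
rewrite le_eqVlt; apply/orP; left; apply/eqP; apply: eq_integral => s _ /=.
have [s0|s0] := leP s 0.
  rewrite k0// mul0r normr0; under eq_integral do rewrite /F/= k0// mul0r normr0.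
  by rewrite integral0.
have st0 : 0 < s + t by rewrite ltr_wpDr.
under eq_integral do rewrite /F/= normrM (ger0_norm (k_ge0 _)) (ger0_norm (expR_ge0 _)) EFinM.
rewrite ge0_integralZl//; last 2 first.
- by apply/measurable_EFinP; exact: measurable_gauss_sqn.
- by rewrite lee_fin.
rewrite integral_gauss_sqn// gauss_kernelE// mul0r oppr0 expR0 mulr1 -EFinM.
by rewrite ger0_norm// mulr_ge0// exprn_ge0// sqrtr_ge0.
Qed.

Variables (v : 'I_n -> R) (th : R).
Let Fw (z : tup n * measurableTypeR R) : R :=
  k z.2 * (expR (- ((z.2 + t) * sqn z.1)) * cos (lin v z.1 + th)).

Let iFw : (lt n \x mu)%E.-integrable setT (EFin \o Fw).
Proof.
apply: integrable_le_norm iF => //.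
  have := measurable_funM mF (measurableT_comp (@measurable_wave R n v th) (@measurable_fst _ _ (tup n) (measurableTypeR R))).
  by apply: eq_measurable_fun => z _; rewrite /F /Fw/= mulrA.
move=> z _; have -> : Fw z = F z * cos (lin v z.1 + th) by rewrite /Fw mulrA.
by rewrite normrM (ger0_norm (F_ge0 z)) ler_piMr// ler_norml cos_geN1 cos_le1.
Qed.

Let W (z : tup n) := expR (- (t * sqn z)) * cos (lin v z + th).

(** Only almost everywhere, because Fubini makes the section in [s] integrable for almost every
    [z]. *)
Let FwE : {ae lt n, forall z, (\int[mu]_s (Fw (z, s))%:E)%E = (laplace k (sqn z) * W z)%:E}.
Proof.
have := ae_integrable1 iF; apply: filterS => z /= iz.
have iz' : mu.-integrable setT (EFin \o (fun s => k s * expR (- (s * sqn z)))).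
  have := integrable_scale (expR (t * sqn z)) measurableT iz.
  apply: eq_integrable => // s _ /=; congr (_%:E).
  rewrite /F/= mulrCA; congr (_ * _); rewrite -expRD; congr expR; ring.
rewrite /laplace /Rintegral EFinM fineK; last exact: (integrable_fin_num measurableT iz').
rewrite -(integralZr measurableT iz'); apply: eq_integral => s _.
rewrite -EFinM /Fw /W /=; congr (_%:E).
rewrite mulrDl opprD expRD; ring.
Qed.

Let mlap : measurable_fun setT (fun z : tup n => laplace k (sqn z) * W z).
Proof.
apply: measurable_funM; first exact: (measurableT_comp measurable_laplace (@measurable_sqn R n)).
by apply: measurable_funM; [exact: measurable_gauss_sqn|exact: measurable_wave].
Qed.

Lemma integrable_radial_laplace :
  (lt n).-integrable setT (EFin \o (fun z : tup n => laplace k (sqn z) *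
    (expR (- (t * sqn z)) * cos (lin v z + th)))).
Proof.
have := integrable_fubini_F iFw => /integrableP[m1 l1].
apply/integrableP; split; first exact/measurable_EFinP.
move: l1; congr (_ < _)%E; apply: ae_eq_integral => //.
- exact: measurableT_comp.
- by apply: measurableT_comp => //; exact/measurable_EFinP.
have := FwE; apply: filterS => z /= E _.
by rewrite /fubini_F/= E.
Qed.

(** Each exp(-s p) in the Laplace integral has an explicit transform, and the factor exp(-t p)
    merely shifts [s] by [t]. *)
Lemma radial_laplace :
  radial (laplace k) t v th =
  cos th * \int[mu]_s (k s * gauss_kernel n (\sum_i v i ^+ 2) (s + t)).
Proof.
have -> : radial (laplace k) t v th = fine (\int[lt n]_z \int[mu]_s (Fw (z, s))%:E).
  congr fine; apply: ae_eq_integral => //.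
  - exact/measurable_EFinP.
  - by have /integrableP[] := integrable_fubini_F iFw.
  - by have := FwE; apply: filterS => z /= E _; rewrite E.
rewrite (@Fubini _ _ _ _ _ (lt n) mu (EFin \o Fw) iFw)/=.
rewrite -RintegralZl//; last first.
  apply: integrable_le_norm ik => //.
    by apply: measurable_funM => //; exact: measurable_gauss_kernel.
  move=> s _ /=.
  have kg : 0 <= k s * gauss_kernel n (\sum_i v i ^+ 2) (s + t) by rewrite mulr_ge0// gauss_kernel_ge0.
  rewrite (ger0_norm kg); apply: ler_wpM2l => //.
  by apply: gauss_kernel_le; rewrite sumr_ge0// => i _; exact: sqr_ge0.
congr fine; apply: eq_integral => s _ /=.
have [s0|s0] := leP s 0.
  rewrite k0// mul0r mulr0; under eq_integral do rewrite /Fw/= k0// mul0r.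
  by rewrite integral0.
have st0 : 0 < s + t by rewrite ltr_wpDr.
under eq_integral do rewrite /Fw/= EFinM.
rewrite integralZl//; last exact: integrable_gauss_wave.
rewrite integral_gauss_wave// gauss_kernelE// -EFinM; congr (_%:E); ring.
Qed.

End at_time.
End subordination.

(** * Transforms of powers *)

Section kernel_bounds.
Context {R : realType}.
Notation mu := (@lebesgue_measure R).

Lemma gauss_kernel0 n (s : R) : gauss_kernel n 0 s = pi `^ (n%:R / 2) * s `^ (- (n%:R / 2)).
Proof. by rewrite /gauss_kernel !mul0r oppr0 expR0 mulr1. Qed.

Lemma powRN_le (a x y : R) : 0 <= a -> 0 < x -> x <= y -> y `^ (- a) <= x `^ (- a).
Proof.
move=> a0 x0 xy; have y0 := lt_le_trans x0 xy.
rewrite !powRN lef_pV2 ?posrE ?powR_gt0//.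
by apply: ge0_ler_powR; rewrite ?nnegrE ?(ltW x0) ?(ltW y0).
Qed.

Lemma gauss_kernel_le_time n (q s t : R) : 0 <= q -> 0 < s -> 0 <= t ->
  gauss_kernel n q (s + t) <= pi `^ (n%:R / 2) * s `^ (- (n%:R / 2)).
Proof.
move=> q0 s0 t0; rewrite (le_trans (gauss_kernel_le _ _ q0))// gauss_kernel0.
by rewrite ler_wpM2l ?powR_ge0// powRN_le// lerDl.
Qed.

(** For q > 0 the exponential exp(-q / (4 u)) beats u^(-n/2) as u -> 0, hence a bound uniform in
    [u]. The summand 1 takes care of n = 0. *)
Lemma gauss_kernel_bounded n (q u : R) : 0 < q -> 0 < u ->
  gauss_kernel n q u <= pi `^ (n%:R / 2) * (1 + (n%:R / 2 / (q / 4)) `^ (n%:R / 2)).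
Proof.
move=> q0 u0; rewrite /gauss_kernel -mulrA ler_wpM2l ?powR_ge0//.
case: n => [|n].
  rewrite mul0r oppr0 powRr0 mul1r powRr0 (@le_trans _ _ 1)// ?lerDl//.
  by rewrite -expR0 ler_expR oppr_le0 mulr_ge0 ?powR_ge0// divr_ge0// ltW.
have h0 : 0 < n.+1%:R / 2 :> R by rewrite divr_gt0.
rewrite -[- (_ / 2)]mulN1r powRrM.
by rewrite (le_trans (powR_expRN_le h0 _ _))// ?divr_gt0 ?powR_gt0// lerDr.
Qed.

Section dominated_kernel.
Variables (n : nat) (a : R) (k : R -> R).
Hypothesis a0 : 0 < a.
Hypothesis an : a < n%:R / 2.
Hypothesis mk : measurable_fun setT k.
Hypothesis k_ge0 : forall s, 0 <= k s.
Hypothesis k_le : forall s, k s <= power_kernel a s.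

Let k0 s : s <= 0 -> k s = 0.
Proof. by move=> s0; apply/eqP; rewrite eq_le k_ge0 andbT -(power_kernel0 a s0). Qed.

(** Near 0 the Gaussian kernel is bounded by [C] and a > 0 gives integrability; beyond 1 it decays
    like s^(-n/2) and a < n/2 gives it. *)
Let dom (C : R) (s : R) : R := C * small_part (@powR R ^~ (a - 1)) s +
  pi `^ (n%:R / 2) * large_part (@powR R ^~ (- (n%:R / 2 - a) - 1)) s.

Let idom C : mu.-integrable setT (EFin \o dom C).
Proof.
have := integrableD measurableT
  (integrable_scale C measurableT (integrable_small_power a0))
  (integrable_scale (pi `^ (n%:R / 2)) measurableT (integrable_large_power (_ : 0 < n%:R / 2 - a))).
by apply; rewrite subr_gt0.
Qed.

Let le_dom C q t s : 0 <= q -> 0 <= t -> 0 <= C ->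
  (0 < s -> gauss_kernel n q (s + t) <= C) ->
  `|k s * gauss_kernel n q (s + t)| <= dom C s.
Proof.
move=> q0 t0 C0 gC; have kg := mulr_ge0 (k_ge0 s) (gauss_kernel_ge0 n q (s + t)).
rewrite (ger0_norm kg).
have sp0 x : 0 <= small_part (@powR R ^~ (a - 1)) x.
  by rewrite /small_part patchE; case: ifP => // _; exact: powR_ge0.
have lp0 x : 0 <= large_part (@powR R ^~ (- (n%:R / 2 - a) - 1)) x.
  by rewrite /large_part patchE; case: ifP => // _; exact: powR_ge0.
have [s0|s0] := leP s 0.
  by rewrite k0// mul0r addr_ge0// mulr_ge0// powR_ge0.
rewrite (@le_trans _ _ (s `^ (a - 1) * gauss_kernel n q (s + t)))//.
  by rewrite ler_wpM2r ?gauss_kernel_ge0// -power_kernelE.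
have [s1|s1] := leP s 1.
  rewrite /dom small_partE// (@le_trans _ _ (C * s `^ (a - 1)))//.
    by rewrite mulrC ler_wpM2r ?powR_ge0// gC.
  by rewrite lerDl mulr_ge0// powR_ge0.
rewrite /dom (large_partE _ (ltW s1)) ler_wpDl ?mulr_ge0//.
have -> : - (n%:R / 2 - a) - 1 = (a - 1) + - (n%:R / 2) by ring.
rewrite (@powRD _ s (a - 1) (- (n%:R / 2))) ?(gt_eqF s0) ?implybT// [leRHS]mulrCA ler_wpM2l ?powR_ge0//.
exact: gauss_kernel_le_time.
Qed.

Lemma integrable_kernel_gauss_t (q t : R) : 0 <= q -> 0 < t ->
  mu.-integrable setT (EFin \o (fun s => k s * gauss_kernel n q (s + t))).
Proof.
move=> q0 t0; apply: integrable_le_norm (idom (pi `^ (n%:R / 2) * t `^ (- (n%:R / 2)))) => //.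
  by apply: measurable_funM => //; exact: measurable_gauss_kernel.
move=> s _; apply: le_dom => //; [exact: ltW|by rewrite mulr_ge0// powR_ge0|].
by move=> s0; rewrite addrC gauss_kernel_le_time// ltW.
Qed.

Lemma integrable_kernel_gauss (q : R) : 0 < q ->
  mu.-integrable setT (EFin \o (fun s => k s * gauss_kernel n q s)).
Proof.
move=> q0; apply: integrable_le_norm (idom (pi `^ (n%:R / 2) * (1 + (n%:R / 2 / (q / 4)) `^ (n%:R / 2)))) => //.
  apply: measurable_funM => //; have := @measurable_gauss_kernel R n q 0.
  by under eq_fun do rewrite addr0.
move=> s _; rewrite -[X in gauss_kernel n q X]addr0; apply: le_dom => //; first exact: ltW.
  by rewrite mulr_ge0 ?addr_ge0 ?powR_ge0.
by move=> s0; rewrite addr0 gauss_kernel_bounded.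
Qed.

Lemma kernel_gauss_cvg (u : nat -> R) (q : R) : (forall i, 0 < u i) -> u i @[i --> \oo] --> (0 : R) -> 0 < q ->
  \int[mu]_s (k s * gauss_kernel n q (s + u i)) @[i --> \oo] -->
  \int[mu]_s (k s * gauss_kernel n q s).
Proof.
move=> u0 ucvg q0; set C := pi `^ (n%:R / 2) * (1 + (n%:R / 2 / (q / 4)) `^ (n%:R / 2)).
apply: fine_cvg; rewrite fineK; last exact: (integrable_fin_num measurableT (integrable_kernel_gauss q0)).
apply: (@dominated_cvg _ _ _ mu setT measurableT
   (fun i s => (k s * gauss_kernel n q (s + u i))%:E) _ (EFin \o dom C)) => //.
- move=> i; apply/measurable_EFinP; apply: measurable_funM => //; exact: measurable_gauss_kernel.
- move=> s _; apply: cvg_EFin; first exact: nearW.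
  have [s0|s0] := leP s 0.
    by rewrite k0// mul0r; under eq_fun do rewrite mul0r; exact: cvg_cst.
  apply: cvgMr.
  have h : s + u i @[i --> \oo] --> s.
    by rewrite -[X in _ --> X]addr0; apply: cvgD; [exact: cvg_cst|exact: ucvg].
  apply: cvgM.
    by apply: cvgMr; apply: (cvg_comp (fun i => s + u i) (@powR R ^~ _) h); exact: powR_cont.
  apply: (cvg_comp _ expR); last exact: continuous_expR.
  by apply: cvgN; apply: cvgMr; apply: (cvg_comp (fun i => s + u i) (@powR R ^~ _) h); exact: powR_cont.
- move=> i s _; rewrite lee_fin; apply: le_dom => //; first exact: ltW.
  - exact: ltW (u0 i).
  - by rewrite mulr_ge0 ?addr_ge0 ?powR_ge0.
  - by move=> s0; rewrite gauss_kernel_bounded// addr_gt0.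
Qed.

End dominated_kernel.

Lemma gauss_kernel_scale n (q s : R) : 0 < q -> 0 < s ->
  gauss_kernel n q (q * s) = q `^ (- (n%:R / 2)) * gauss_kernel n 1 s.
Proof.
move=> q0 s0; rewrite /gauss_kernel powRM ?ltW// powRM ?ltW//.
rewrite (_ : q / 4 * (q `^ (-1) * s `^ (-1)) = 1 / 4 * s `^ (-1)); first ring.
by rewrite powR_inv1 ?ltW//; field; rewrite gt_eqF.
Qed.

(** The substitution s -> q s. With q = r^2 it is the homogeneity r^(2 a - n) of the Riesz
    kernel. *)
Lemma power_kernel_gauss_scale n (a q : R) : 0 < q ->
  \int[mu]_s (power_kernel a s * gauss_kernel n q s) =
  q `^ (a - n%:R / 2) * \int[mu]_s (power_kernel a s * gauss_kernel n 1 s).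
Proof.
move=> q0; rewrite /Rintegral.
have mg r : measurable_fun setT (fun s => (power_kernel a s * gauss_kernel n r s)%:E).
  apply/measurable_EFinP; apply: measurable_funM; first exact: measurable_power_kernel.
  by have := @measurable_gauss_kernel R n r 0; under eq_fun do rewrite addr0.
have g0 r s : (0 <= (power_kernel a s * gauss_kernel n r s)%:E)%E.
  by rewrite lee_fin mulr_ge0 ?power_kernel_ge0 ?gauss_kernel_ge0.
rewrite (ge0_integral_scale q0)//.
have -> : (\int[mu]_s (power_kernel a (q * s)%R * gauss_kernel n q (q * s)%R)%:E =
    \int[mu]_s ((q `^ (a - 1) * q `^ (- (n%:R / 2)))%:E *
    (power_kernel a s * gauss_kernel n 1 s)%:E))%E.
  apply: eq_integral => s _; rewrite -EFinM; congr (_%:E).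
  have [s0|s0] := leP s 0.
    by rewrite !power_kernel0 ?mul0r ?mulr0// pmulr_rle0.
  by rewrite power_kernel_scale// gauss_kernel_scale//; ring.
rewrite ge0_integralZl ?lee_fin ?mulr_ge0 ?powR_ge0//; last exact: mg.
rewrite muleA -EFinM mulrA.
have -> : q * q `^ (a - 1) * q `^ (- (n%:R / 2)) = q `^ (a - n%:R / 2).
  rewrite -{1}[q]powRr1 ?ltW// -!powRD ?(gt_eqF q0) ?implybT//; congr (_ `^ _); ring.
have qp : 0 < q `^ (a - n%:R / 2) by rewrite powR_gt0.
(* If the integral is infinite, both sides are 0 by the convention of [fine]. *)
case: (\int[mu]_s _)%E => [x||] //=; rewrite ?mulr0.
  by rewrite mulry gtr0_sg// mul1e.
by rewrite mulrNy gtr0_sg// mul1e.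
Qed.

(** The claimed sizes for lam = 1; scaling restores the factor lam^(n - 2 a) and puts lam r in place
    of [r]. The summand 1 absorbs all bounded remainders. *)
Definition error_bound (n : nat) (a r : R) : R :=
  if 4 * a > n%:R then 1 else
  if 4 * a == n%:R then 1 + log_minus r else 1 + r `^ (4 * a - n%:R).

Lemma error_bound_ge1 n a r : 1 <= error_bound n a r.
Proof.
rewrite /error_bound; case: ifP => // _; case: ifP => _; rewrite lerDl ?powR_ge0//.
by rewrite /log_minus; case: ifP => // /andP[r0 r1]; rewrite oppr_ge0 ln_le0// ltW.
Qed.

(** Keeping only s <= 1 in the Laplace integral for p^(-b) removes the singularity at p = 0 and
    costs an exponentially small term as p grows. *)
Definition small_power (b : R) : R -> R := small_part (@powR R ^~ (b - 1)).

Lemma small_power_ge0 b s : 0 <= small_power b s.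
Proof. by rewrite /small_power/small_part patchE; case: ifP => // _; exact: powR_ge0. Qed.

Lemma small_power_gt1 b s : 1 < s -> small_power b s = 0.
Proof.
move=> s1; rewrite /small_power /small_part patchE memNset//= in_itv/= => /andP[_].
by rewrite leNgt s1.
Qed.

Lemma measurable_small_power b : measurable_fun setT (small_power b).
Proof.
apply/(measurable_restrictT (@powR R ^~ (b - 1)) (measurable_itv `]0, 1])).
by apply: measurable_funS (@measurable_powR R (b - 1)).
Qed.

Lemma small_power_le a b s : a <= b -> small_power b s <= small_power a s.
Proof.
move=> ab; have [s0|s0] := leP s 0; first by rewrite /small_power !small_part0.
have [s1|s1] := leP s 1; last by rewrite !small_power_gt1.
rewrite /small_power !small_partE//; apply: ger_powR; first by rewrite s0.
by rewrite lerB.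
Qed.

Lemma small_power_le_power a s : small_power a s <= power_kernel a s.
Proof.
have [s0|s0] := leP s 0; first by rewrite /small_power small_part0// power_kernel0.
have [s1|s1] := leP s 1; last by rewrite small_power_gt1// power_kernel_ge0.
by rewrite /small_power small_partE// power_kernelE.
Qed.

Definition high_part (n : nat) (a q : R) : R := \int[mu]_s (small_power (2 * a) s * gauss_kernel n q s).

Lemma Rintegral_le_ereal (f : R -> R) (C : R) : 0 <= C -> (\int[mu]_s (f s)%:E <= C%:E)%E ->
  \int[mu]_s f s <= C.
Proof.
by move=> C0; rewrite /Rintegral; case: (integral _ _ _) => [x||] //=; rewrite ?lee_fin.
Qed.

(** Dropping the exponential leaves s^(2 a - n/2 - 1) on ]0, 1], which is integrable exactly in this
    range. *)
Lemma high_part_case1 n a : 0 < a -> n%:R < 4 * a ->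
  exists M, forall q, 0 < q -> high_part n a q <= M.
Proof.
move=> a0 na.
have b0 : 0 < 2 * a - n%:R / 2 by lra.
have ib := integrable_scale (pi `^ (n%:R / 2)) measurableT (integrable_small_power b0).
exists (\int[mu]_s (pi `^ (n%:R / 2) * small_part (@powR R ^~ (2 * a - n%:R / 2 - 1)) s)) => q q0.
have bd s : small_power (2 * a) s * gauss_kernel n q s <=
    pi `^ (n%:R / 2) * small_part (@powR R ^~ (2 * a - n%:R / 2 - 1)) s.
  have [s0|s0] := leP s 0; first by rewrite /small_power !small_part0// mul0r mulr0.
  have [s1|s1] := leP s 1; last first.
    by rewrite small_power_gt1// mul0r mulr_ge0 ?powR_ge0//; exact: (small_power_ge0 (2 * a - n%:R / 2)).
  rewrite /small_power !small_partE//.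
  rewrite (_ : 2 * a - n%:R / 2 - 1 = (2 * a - 1) + - (n%:R / 2)); last by ring.
  rewrite (@powRD _ s (2 * a - 1)) ?(gt_eqF s0) ?implybT// [leRHS]mulrCA ler_wpM2l ?powR_ge0//.
  by rewrite (le_trans (gauss_kernel_le _ _ (ltW q0)))// gauss_kernel0.
apply: le_Rintegral => //.
apply: integrable_le_norm ib => //.
  apply: measurable_funM; first exact: measurable_small_power.
  by have := @measurable_gauss_kernel R n q 0; under eq_fun do rewrite addr0.
by move=> s _; rewrite (ger0_norm (mulr_ge0 (small_power_ge0 _ _) (gauss_kernel_ge0 _ _ _))).
Qed.

(** Dropping the cut-off s <= 1 instead gives the Riesz integral of order 2 a, finite because 2 a <
    n/2, and homogeneous in [r]. *)
Lemma high_part_case3 n a : 0 < a -> 4 * a < n%:R ->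
  exists M, forall r, 0 < r -> high_part n a (r ^+ 2) <= M * r `^ (4 * a - n%:R).
Proof.
move=> a0 an; have a20 : 0 < 2 * a by rewrite mulr_gt0.
have a2n : 2 * a < n%:R / 2 by lra.
exists (\int[mu]_s (power_kernel (2 * a) s * gauss_kernel n 1 s)) => r r0.
have r20 : 0 < r ^+ 2 by rewrite exprn_gt0.
have -> : r `^ (4 * a - n%:R) = (r ^+ 2) `^ (2 * a - n%:R / 2).
  by rewrite -powR_mulrn ?ltW// -powRrM; congr (_ `^ _); field.
rewrite mulrC -power_kernel_gauss_scale//; apply: le_Rintegral => //.
- apply: (@integrable_kernel_gauss n (2 * a)) => //.
  + exact: measurable_small_power.
  + exact: small_power_ge0.
  + exact: small_power_le_power.
- apply: (@integrable_kernel_gauss n (2 * a)) => //.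
  + exact: measurable_power_kernel.
  + exact: power_kernel_ge0.
by move=> s _; rewrite ler_wpM2r ?gauss_kernel_ge0 ?small_power_le_power.
Qed.

(** The integrand is s^(-1) exp(-q / (4 s)) up to a constant. Below s = q it is at most 4 / q, which
    contributes a constant; from q to 1 the integral of 1 / s is - ln q = 2 [log_minus r]. *)
Lemma high_part_case2 n a : 0 < a -> 4 * a = n%:R ->
  exists M, forall r, 0 < r -> high_part n a (r ^+ 2) <= M * (1 + log_minus r).
Proof.
move=> a0 an; pose P : R := pi `^ (n%:R / 2).
have P0 : 0 <= P by exact: powR_ge0.
exists (P * 4) => r r0; set q := r ^+ 2.
have q0 : 0 < q by rewrite exprn_gt0.
have lm0 : 0 <= log_minus r.
  by rewrite /log_minus; case: ifP => // /andP[_ r1]; rewrite oppr_ge0 ln_le0// ltW.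
have gE s : 0 < s -> s <= 1 -> small_power (2 * a) s * gauss_kernel n q s = P * (s^-1 * expR (- (q / (4 * s)))).
  move=> s0 s1; rewrite /small_power small_partE// /gauss_kernel -/P.
  have e : s `^ (2 * a - 1) * s `^ (- (n%:R / 2)) = s^-1.
    rewrite -(powR_inv1 (ltW s0)) -powRD ?(gt_eqF s0) ?implybT//.
    by congr (_ `^ _); lra.
  have -> : q / 4 * s `^ (-1) = q / (4 * s).
    by rewrite (powR_inv1 (ltW s0)); field; rewrite gt_eqF.
  by rewrite -e; ring.
have le1 s : 0 < s -> s^-1 * expR (- (q / (4 * s))) <= 4 / q.
  move=> s0; rewrite expRN ler_pdivrMr ?expR_gt0//.
  rewrite (@le_trans _ _ (4 / q * (q / (4 * s))))//.
    by rewrite le_eqVlt; apply/orP; left; apply/eqP; field; rewrite !gt_eqF.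
  rewrite ler_wpM2l ?divr_ge0 ?(ltW q0)//.
  by rewrite (le_trans _ (expR_ge1Dx _))// lerDr.
have mf : measurable_fun setT (fun s => (small_power (2 * a) s * gauss_kernel n q s)%:E).
  apply/measurable_EFinP; apply: measurable_funM; first exact: measurable_small_power.
  by have := @measurable_gauss_kernel R n q 0; under eq_fun do rewrite addr0.
have f0 s : (0 <= (small_power (2 * a) s * gauss_kernel n q s)%:E)%E.
  by rewrite lee_fin mulr_ge0 ?small_power_ge0 ?gauss_kernel_ge0.
have fD : (\int[mu]_s (small_power (2 * a) s * gauss_kernel n q s)%:E =
   \int[mu]_(s in `]0%R, 1%R]) (small_power (2 * a) s * gauss_kernel n q s)%:E)%E.
  rewrite [RHS]integral_mkcond; apply: eq_integral => s _; rewrite patchE.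
  case: ifPn => //; rewrite notin_setE/= in_itv/= => /negP; rewrite negb_and -leNgt -ltNge.
  by move=> /orP[s0|s1]; rewrite ?(small_power_gt1 _ s1) /small_power ?(small_part0 _ s0) mul0r.
apply: Rintegral_le_ereal; first by rewrite !mulr_ge0// addr_ge0.
rewrite fD.
have bd (D : set (measurableTypeR R)) : measurable D -> (forall s : R, D s -> 0 < s <= 1) ->
    (\int[mu]_(s in D) (small_power (2 * a) s * gauss_kernel n q s)%:E <=
    (P * (4 / q))%:E * mu D)%E.
  move=> mD Ds; rewrite -integral_cst//; apply: ge0_le_integral => //.
  - exact: measurable_funS mf.
  move=> s /Ds /andP[s0 s1]; rewrite lee_fin gE// ler_wpM2l// le1//.
have [r1|r1] := leP 1 r.
  have q1 : 1 <= q by rewrite /q exprn_ege1.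
  rewrite (le_trans (bd _ _ _))//.
  rewrite lebesgue_measure_itv/= lte_fin ltr01 sube0 mule1 lee_fin -mulrA ler_wpM2l//.
  by rewrite ler_wpM2l// (@le_trans _ _ 1) ?lerDl// invf_le1.
have q1 : q < 1 by rewrite /q exprn_ilt1// ltW.
have -> : `]0, 1]%classic = `]0, q] `|` `]q, 1].
  apply/seteqP; split => s /=; rewrite !in_itv/=.
    by move=> /andP[s0 s1]; case: (leP s q) => sq; [left|right]; rewrite ?s0.
  by move=> [/andP[s0 sq]|/andP[sq ->]]; rewrite ?s0 ?(lt_trans q0 sq)// (le_trans sq (ltW q1)).
rewrite ge0_integral_setU//=; last 2 first.
- exact: measurable_funS mf.
- rewrite disj_set2E; apply/eqP/seteqP; split => // s /= []; rewrite !in_itv/= => /andP[_ sq] /andP[qs _].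
  by move: (lt_le_trans qs sq); rewrite ltxx.
apply: (@le_trans _ _ ((P * 4)%:E + (P * (2 * log_minus r))%:E)%E); last first.
  by rewrite -EFinD lee_fin -mulrDr -[leRHS]mulrA ler_wpM2l//; lra.
apply: leeD.
  have bq (s : R) : `]0, q]%classic s -> 0 < s <= 1.
    by rewrite /= in_itv/= => /andP[-> sq]; rewrite (le_trans sq (ltW q1)).
  rewrite (le_trans (bd _ _ bq))//.
  rewrite lebesgue_measure_itv/= lte_fin q0 sube0 -EFinM lee_fin.
  by rewrite -mulrA divfK ?gt_eqF.
apply: (@le_trans _ _ (\int[mu]_(s in `[q, 1%R]) (P * s `^ (-1))%:E)%E).
  apply: (@le_trans _ _ (\int[mu]_(s in `[q, 1%R]) (small_power (2 * a) s * gauss_kernel n q s)%:E)%E).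
    apply: ge0_subset_integral => //; first exact: measurable_funS mf.
    by move=> s /=; rewrite !in_itv/= => /andP[/ltW -> ->].
  apply: ge0_le_integral => //.
  - exact: measurable_funS mf.
  - apply/measurable_EFinP; apply: measurable_funM => //.
    by apply: measurable_funS (@measurable_powR R (-1)).
  move=> s /=; rewrite in_itv/= => /andP[qs s1].
  have s0 := lt_le_trans q0 qs.
  rewrite lee_fin gE// (powR_inv1 (ltW s0)) ler_wpM2l// ler_piMr ?invr_ge0 ?(ltW s0)//.
  by rewrite -expR0 ler_expR oppr_le0 divr_ge0 ?(ltW q0)// mulr_ge0// ltW.
have -> : (\int[mu]_(s in `[q, 1%R]) (P * s `^ (-1))%:E = \int[mu]_(s in `[q, 1%R]) (P * s^-1)%:E)%E.
  apply: eq_integral => s; rewrite inE/= in_itv/= => /andP[qs _].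
  by rewrite powR_inv1// (le_trans (ltW q0)).
have d (s : R) : 0 < s -> is_derive s 1 (fun x => P * ln x) (P * s^-1).
  by move=> s0; have := is_deriveZ P (is_derive1_ln s0).
have c (s : R) : 0 < s -> {for s, continuous (fun x => P * ln x)}.
  by move=> s0; apply: cvgMr; exact: continuous_ln.
have ci (s : R) : 0 < s -> {for s, continuous (fun x : R => P * x^-1)}.
  by move=> s0; apply: cvgMr; apply: inv_continuous; rewrite gt_eqF.
have pos x : x \in `]q, 1[ -> 0 < x by rewrite in_itv/= => /andP[/(lt_trans q0)].
rewrite (@continuous_FTC2 _ _ (fun x => P * ln x))//.
- rewrite ln1 mulr0 sub0e -EFinN lee_fin /q lnXn// /log_minus r0 r1/= -mulrN ler_wpM2l//.
  by rewrite mulrN mulr_natl.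
- apply/continuous_within_itvP => //; split.
  + by move=> x /pos; exact: ci.
  + exact/cvg_at_right_filter/ci.
  + exact/cvg_at_left_filter/ci.
- split.
  + by move=> x /pos x0; have := d x x0; case.
  + exact/cvg_at_right_filter/c.
  + exact/cvg_at_left_filter/c.
- by move=> x /pos x0; rewrite derive1E; have := d x x0; case.
Qed.

(* The size in [r] of the [|xi|^(-4 a)] term of the high-frequency expansion. *)
Lemma high_part_bound n a : 0 < a ->
  exists2 M, 0 <= M & forall r, 0 < r -> high_part n a (r ^+ 2) <= M * error_bound n a r.
Proof.
move=> a0.
suff [M MP] : exists M, forall r, 0 < r -> high_part n a (r ^+ 2) <= M * error_bound n a r.
  exists `|M| => // r r0; rewrite (le_trans (MP _ r0))// ler_wpM2r ?ler_norm//.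
  by rewrite (le_trans ler01)// error_bound_ge1.
rewrite /error_bound; have [an|na|an] := ltgtP (4 * a) n%:R.
- have [M MP] := high_part_case3 a0 an; exists `|M| => r r0.
  rewrite (le_trans (MP _ r0))// (@le_trans _ _ (`|M| * r `^ (4 * a - n%:R)))//.
    by rewrite ler_wpM2r ?powR_ge0// ler_norm.
  by rewrite ler_wpM2l// lerDr.
- have [M MP] := high_part_case1 a0 na; exists M => r r0; rewrite mulr1.
  by apply: MP; rewrite exprn_gt0.
- exact: high_part_case2.
Qed.

End kernel_bounds.

(** * The one-dimensional resolvent *)

Section oscillation.
Context {R : realType}.
Notation mu := (@lebesgue_measure R).

Lemma continuous_expRMl (b : R) : continuous (fun y : R => expR (- (b * y))).
Proof.
move=> y; apply: continuous_comp; last exact: continuous_expR.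
by apply: cvgN; apply: cvgMr; exact: cvg_id.
Qed.

Lemma continuous_cos_affine (w th : R) : continuous (fun y : R => cos (w * y + th)).
Proof.
move=> y; apply: continuous_comp; last exact: continuous_cos.
by apply: cvgD; [apply: cvgMr; exact: cvg_id|exact: cvg_cst].
Qed.

Lemma integrable_exp_half_line (b : R) : 0 < b ->
  mu.-integrable `[0, +oo[ (fun y : R => (expR (- (b * y)))%:E).
Proof.
move=> b0.
have H := integrable_power_exp (ltr01 : 0 < 1 :> R) b0.
have me : measurable_fun setT (fun y : R => (expR (- (b * y)))%:E).
  by apply/measurable_EFinP; apply: continuous_measurable; exact: continuous_expRMl.
apply/integrableP; split; first exact: measurable_funTS.
rewrite -integral_itv_obnd_cbnd; last by apply: measurableT_comp => //; exact: measurable_funTS.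
have /integrableP[_] := integrableS measurableT (measurable_itv `]0%R, +oo[ : measurable (`]0%R, +oo[%classic : set (measurableTypeR R))) (@subsetT _ _) H.
apply: le_lt_trans; rewrite le_eqVlt; apply/orP; left; apply/eqP.
apply: eq_integral => y; rewrite inE/= in_itv/= andbT => y0.
by rewrite power_kernelE// subrr powRr0 mul1r.
Qed.

Lemma integral_exp_cos (b w th : R) : 0 < b ->
  (\int[mu]_(y in `[0%R, +oo[) (expR (- (b * y)) * cos (w * y + th))%:E =
  ((b * cos th - w * sin th) / (b ^+ 2 + w ^+ 2))%:E)%E.
Proof.
move=> b0; have D0 : b ^+ 2 + w ^+ 2 != 0 by rewrite gt_eqF// ltr_pwDl ?exprn_gt0 ?sqr_ge0.
pose G (y : R) := (b ^+ 2 + w ^+ 2)^-1 * (expR (- (b * y)) * (w * sin (w * y + th) - b * cos (w * y + th))).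
have dG (y : R) : is_derive y 1 G (expR (- (b * y)) * cos (w * y + th)).
  have d1 : is_derive y 1 (expR \o (fun y : R => - (b * y))) (expR (- (b * y)) * (- b)).
    apply: is_derive1_comp; apply: is_derive_eq; rewrite /GRing.scale/=; ring.
  have d0 : is_derive y 1 (fun y : R => w * y + th) w.
    by apply: is_derive_eq; rewrite /GRing.scale/=; ring.
  have d2 : is_derive y 1 (sin \o (fun y : R => w * y + th)) (cos (w * y + th) * w).
    exact: is_derive1_comp.
  have d3 : is_derive y 1 (cos \o (fun y : R => w * y + th)) (- sin (w * y + th) * w).
    exact: is_derive1_comp.
  have d5 : is_derive y 1 (fun y : R => w * sin (w * y + th) - b * cos (w * y + th))
      (w * (cos (w * y + th) * w) - b * (- sin (w * y + th) * w)).
    exact: (is_deriveB (is_deriveZ w d2) (is_deriveZ b d3)).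
  have d6 := is_deriveZ ((b ^+ 2 + w ^+ 2)^-1) (is_deriveM d1 d5).
  apply: (is_derive_eq d6); rewrite /GRing.scale/=; field; exact: D0.
have G0 : G 0 = - ((b * cos th - w * sin th) / (b ^+ 2 + w ^+ 2)).
  by rewrite /G !mulr0 oppr0 expR0 add0r; field.
have cg : continuous (fun y : R => expR (- (b * y)) * cos (w * y + th)).
  by move=> y; apply: cvgM; [exact: continuous_expRMl|exact: continuous_cos_affine].
rewrite (integral_y_derive cg dG (l := 0)).
- by rewrite G0 sub0r opprK.
- apply: integrable_le_norm (integrable_exp_half_line b0) => //.
    by apply: measurable_funTS; exact: continuous_measurable.
  move=> y _; rewrite normrM (ger0_norm (expR_ge0 _)) ler_piMr ?expR_ge0//.
  by rewrite ler_norml cos_geN1 cos_le1.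
- pose C := (b ^+ 2 + w ^+ 2)^-1 * (`|w| + b) / b.
  have hC : C * k.+1%:R^-1 @[k --> \oo] --> (0 : R).
    by rewrite -(mulr0 C); apply: cvgMr; exact: cvg_harmonic.
  have bd k : `|G (0 + k.+1%:R)| <= C * k.+1%:R^-1.
    rewrite add0r /G normrM ger0_norm ?invr_ge0 ?addr_ge0 ?sqr_ge0//.
    rewrite /C -!mulrA ler_wpM2l ?invr_ge0 ?addr_ge0 ?sqr_ge0//.
    rewrite normrM (ger0_norm (expR_ge0 _)) mulrC ler_pM ?expR_ge0//.
      rewrite (le_trans (ler_normB _ _))// lerD// normrM ?(gtr0_norm b0) ler_piMr ?(ltW b0)//.
        by rewrite ler_norml sin_geN1 sin_le1.
      by rewrite ler_norml cos_geN1 cos_le1.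
    rewrite expRN -invfM lef_pV2 ?posrE ?expR_gt0 ?mulr_gt0 ?ltr0n//.
    by rewrite (le_trans _ (expR_ge1Dx _))// lerDr.
  apply: (@squeeze_cvgr _ _ _ _ (fun k => - (C * k.+1%:R^-1)) (fun k => C * k.+1%:R^-1)) => //.
  + by apply: nearW => k; rewrite -ler_norml.
  + by rewrite -oppr0; exact: cvgN.
Qed.

(* The kernel of the one-dimensional resolvent at [kappa = a + i b], in real form. *)
Definition line_kernel (a b X Y y : R) : R := expR (- (b * y)) * (X * cos (a * y) - Y * sin (a * y)).

Lemma integral_line_kernel (a b X Y s : R) : 0 < b ->
  (\int[mu]_(y in `[0%R, +oo[) (cos (s * y) * line_kernel a b X Y y)%:E =
   (2^-1 * ((X * b - Y * (a + s)) / (b ^+ 2 + (a + s) ^+ 2) +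
            (X * b - Y * (a - s)) / (b ^+ 2 + (a - s) ^+ 2)))%:E)%E.
Proof.
move=> b0.
have ie w th C : mu.-integrable `[0, +oo[ (EFin \o (fun y : R => C * (expR (- (b * y)) * cos (w * y + th)))).
  apply: integrable_scale => //; apply: integrable_le_norm (integrable_exp_half_line b0) => //.
    apply: measurable_funTS; apply: continuous_measurable => y.
    by apply: cvgM; [exact: continuous_expRMl|exact: continuous_cos_affine].
  move=> y _; rewrite normrM (ger0_norm (expR_ge0 _)) ler_piMr ?expR_ge0//.
  by rewrite ler_norml cos_geN1 cos_le1.
have iE w th C : (\int[mu]_(y in `[0%R, +oo[) (C * (expR (- (b * y)) * cos (w * y + th)))%:E =
    (C * ((b * cos th - w * sin th) / (b ^+ 2 + w ^+ 2)))%:E)%E.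
  under eq_integral do rewrite EFinM.
  rewrite integralZl//; first by rewrite integral_exp_cos.
  by have := ie w th 1; apply: eq_integrable => // y _ /=; rewrite mul1r.
(* Product-to-sum formulas: the phases 0 and pi / 2 give cosines and negated sines, so that
   [integral_exp_cos] covers all four terms. *)
transitivity (\int[mu]_(y in `[0%R, +oo[)
   (((X / 2 * (expR (- (b * y)) * cos ((a + s) * y + 0)))%:E + (X / 2 * (expR (- (b * y)) * cos ((a - s) * y + 0)))%:E) +
   ((Y / 2 * (expR (- (b * y)) * cos ((a + s) * y + pi / 2)))%:E + (Y / 2 * (expR (- (b * y)) * cos ((a - s) * y + pi / 2)))%:E)))%E.
  apply: eq_integral => y _; rewrite -!EFinD; congr (_%:E).
  have e1 : cos ((a + s) * y + 0) = cos (a * y) * cos (s * y) - sin (a * y) * sin (s * y).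
    by rewrite addr0 mulrDl cosD.
  have e2 : cos ((a - s) * y + 0) = cos (a * y) * cos (s * y) + sin (a * y) * sin (s * y).
    by rewrite addr0 mulrBl cosB.
  have e3 : cos ((a + s) * y + pi / 2) = - (sin (a * y) * cos (s * y) + cos (a * y) * sin (s * y)).
    by rewrite cosDpihalf mulrDl sinD.
  have e4 : cos ((a - s) * y + pi / 2) = - (sin (a * y) * cos (s * y) - cos (a * y) * sin (s * y)).
    by rewrite cosDpihalf mulrBl sinB.
  by rewrite e1 e2 e3 e4 /line_kernel; field.
rewrite integralD//; last 2 first.
- by apply: integrableD => //; exact: ie.
- by apply: integrableD => //; exact: ie.
rewrite !integralD//; try exact: ie.
rewrite !iE cos0 sin0 cos_pihalf sin_pihalf -!EFinD; congr (_%:E).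
have D1 : b ^+ 2 + (a + s) ^+ 2 != 0 by rewrite gt_eqF// ltr_pwDl ?exprn_gt0 ?sqr_ge0.
have D2 : b ^+ 2 + (a - s) ^+ 2 != 0 by rewrite gt_eqF// ltr_pwDl ?exprn_gt0 ?sqr_ge0.
by field; rewrite D1 D2.
Qed.

Section line_resolvent.
Variables (a b : R).
Hypotheses (a0 : 0 < a) (b0 : 0 < b).

Let denom (s : R) : (b ^+ 2 + (a + s) ^+ 2) * (b ^+ 2 + (a - s) ^+ 2) =
  (s ^+ 2 - (a ^+ 2 - b ^+ 2)) ^+ 2 + (2 * a * b) ^+ 2.
Proof. ring. Qed.

Let D1 s : b ^+ 2 + (a + s) ^+ 2 != 0.
Proof. by rewrite gt_eqF// ltr_pwDl ?exprn_gt0 ?sqr_ge0. Qed.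
Let D2 s : b ^+ 2 + (a - s) ^+ 2 != 0.
Proof. by rewrite gt_eqF// ltr_pwDl ?exprn_gt0 ?sqr_ge0. Qed.
Let N0 : a ^+ 2 + b ^+ 2 != 0.
Proof. by rewrite gt_eqF// addr_gt0 ?exprn_gt0. Qed.

(** With kappa = a + i b the left side is the real part of 1 / (s^2 - kappa^2). The right side is
    its partial fraction expansion at s = kappa and s = -kappa, in the shape of
    [integral_line_kernel] with X = b and Y = a; for the imaginary part X = a and Y = -b. *)
Lemma line_resolvent_re (s : R) :
  (s ^+ 2 - (a ^+ 2 - b ^+ 2)) / ((s ^+ 2 - (a ^+ 2 - b ^+ 2)) ^+ 2 + (2 * a * b) ^+ 2) =
  (a ^+ 2 + b ^+ 2)^-1 * (2^-1 * ((b * b - a * (a + s)) / (b ^+ 2 + (a + s) ^+ 2) +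
            (b * b - a * (a - s)) / (b ^+ 2 + (a - s) ^+ 2))).
Proof. by rewrite -denom; field; rewrite !(D1, N0). Qed.

Lemma line_resolvent_im (s : R) :
  (2 * a * b) / ((s ^+ 2 - (a ^+ 2 - b ^+ 2)) ^+ 2 + (2 * a * b) ^+ 2) =
  (a ^+ 2 + b ^+ 2)^-1 * (2^-1 * ((a * b - (- b) * (a + s)) / (b ^+ 2 + (a + s) ^+ 2) +
            (a * b - (- b) * (a - s)) / (b ^+ 2 + (a - s) ^+ 2))).
Proof. by rewrite -denom; field; rewrite !(D1, N0). Qed.

End line_resolvent.

Lemma norm_line_kernel (a b X Y y : R) : 
  `|line_kernel a b X Y y| <= Num.sqrt (X ^+ 2 + Y ^+ 2) * expR (- (b * y)).
Proof.
rewrite /line_kernel normrM (ger0_norm (expR_ge0 _)) mulrC ler_wpM2r ?expR_ge0//.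
rewrite -sqrtr_sqr ler_wsqrtr//.
rewrite -[leRHS]mulr1 -(cos2Dsin2 (a * y)).
(* Lagrange's identity: this square is the defect in the Cauchy-Schwarz inequality. *)
have := sqr_ge0 (X * sin (a * y) + Y * cos (a * y)); nra.
Qed.

Lemma integral_gauss_coscos (tau r y : R) : 0 < tau ->
  \int[mu]_s (expR (- (tau * s ^+ 2)) * (cos (r * s) * cos (s * y))) =
  2^-1 * Num.sqrt (pi / tau) * (expR (- ((r + y) ^+ 2 / (4 * tau))) + expR (- ((r - y) ^+ 2 / (4 * tau)))).
Proof.
move=> t0.
transitivity (\int[mu]_s (2^-1 * (expR (- (tau * s ^+ 2)) * cos ((r + y) * s + 0)) +
   2^-1 * (expR (- (tau * s ^+ 2)) * cos ((r - y) * s + 0)))).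
  apply: eq_Rintegral => s _; rewrite !addr0 mulrDl mulrBl cosD cosB (mulrC s y); by field.
rewrite RintegralD//; try by apply: integrable_scale => //; exact: integrable_gauss_cos.
rewrite !RintegralZl//; try exact: integrable_gauss_cos.
by rewrite !Rintegral_gauss_fourier// cos0; ring.
Qed.

(* Fubini: the oscillating factor is averaged against a nonnegative Gaussian. *)
Lemma gauss_line_kernel_bound (tau r a b X Y : R) (Q : R -> R) : 0 < tau -> 0 < b ->
  (forall s, (\int[mu]_(y in `[0%R, +oo[) (cos (s * y) * line_kernel a b X Y y)%:E = (Q s)%:E)%E) ->
  `|\int[mu]_s (expR (- (tau * s ^+ 2)) * (cos (r * s) * Q s))| <= 2 * pi * Num.sqrt (X ^+ 2 + Y ^+ 2).
Proof.
move=> t0 b0 QE; set M := Num.sqrt (X ^+ 2 + Y ^+ 2).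
have M0 : 0 <= M by exact: sqrtr_ge0.
pose ky := (fun y : R => line_kernel a b X Y y) \_ `[0, +oo[.
pose ey := (fun y : R => expR (- (b * y))) \_ `[0, +oo[.
have mlk : measurable_fun setT (fun y : R => line_kernel a b X Y y).
  apply: continuous_measurable => y; apply: cvgM; first exact: continuous_expRMl.
  apply: cvgB; apply: cvgMr.
    by apply: continuous_comp; [apply: cvgMr; exact: cvg_id|exact: continuous_cos].
  by apply: continuous_comp; [apply: cvgMr; exact: cvg_id|exact: continuous_sin].
have mky : measurable_fun setT ky.
  apply/(measurable_restrictT (fun y : R => line_kernel a b X Y y) (measurable_itv `[0, +oo[)).
  exact: measurable_funTS.
have mey : measurable_fun setT ey.
  apply/(measurable_restrictT (fun y : R => expR (- (b * y))) (measurable_itv `[0, +oo[)).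
  by apply: measurable_funTS; apply: continuous_measurable; exact: continuous_expRMl.
have ey0 y : 0 <= ey y by rewrite /ey patchE; case: ifP => // _; exact: expR_ge0.
have kyey y : `|ky y| <= M * ey y.
  rewrite /ky /ey !patchE; case: ifP => _; first exact: norm_line_kernel.
  by rewrite normr0 mulr0.
have iey : mu.-integrable setT (EFin \o ey).
  have -> : EFin \o ey = (fun y : R => (expR (- (b * y)))%:E) \_ `[0, +oo[.
    by apply/funext => y; rewrite /ey /= !patchE; case: ifP.
  have mI : measurable (`[0%R, +oo[%classic : set (measurableTypeR R)) by exact: measurable_itv.
  by apply/(integrable_mkcond _ mI); exact: integrable_exp_half_line.
pose F (z : measurableTypeR R * measurableTypeR R) : R :=
  expR (- (tau * z.1 ^+ 2)) * (cos (r * z.1) * (cos (z.1 * z.2) * ky z.2)).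
pose D (z : measurableTypeR R * measurableTypeR R) : R :=
  expR (- (tau * z.1 ^+ 2)) * (M * ey z.2).
have mgs : measurable_fun setT (fun s : R => expR (- (tau * s ^+ 2))).
  by apply: continuous_measurable; exact: expR_sqr_cont.
have mD : measurable_fun setT D.
  apply: measurable_funM; first exact: (measurableT_comp mgs).
  by apply: measurable_funM => //; exact: (measurableT_comp mey).
have mcos : measurable_fun setT (@cos R) by apply: continuous_measurable; exact: continuous_cos.
have mF : measurable_fun setT F.
  apply: measurable_funM; first exact: (measurableT_comp mgs).
  apply: measurable_funM; first by apply: (measurableT_comp mcos); exact: measurable_funM.
  apply: measurable_funM; last exact: (measurableT_comp mky).
  by apply: (measurableT_comp mcos); exact: measurable_funM.
have iD : (mu \x mu)%E.-integrable setT (EFin \o D).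
  apply/integrable12ltyP; first exact/measurable_EFinP.
  have E (s : R) : (\int[mu]_y `|(EFin \o D) (s, y)| = (expR (- (tau * s ^+ 2)) * (M * \int[mu]_y ey y))%:E)%E.
    transitivity (\int[mu]_y ((expR (- (tau * s ^+ 2)) * M)%:E * (ey y)%:E))%E.
      apply: eq_integral => y _ /=; rewrite /D/= ger0_norm ?mulr_ge0 ?expR_ge0//.
      by rewrite -EFinM mulrA.
    rewrite (integralZl measurableT iey) [in RHS]mulrA [in RHS]EFinM /Rintegral fineK//.
    exact: (integrable_fin_num measurableT iey).
  under eq_integral do rewrite E.
  under eq_integral do rewrite mulrC EFinM.
  rewrite ge0_integralZl//; last 2 first.
  - by apply/measurable_EFinP.
  - by rewrite lee_fin mulr_ge0// Rintegral_ge0.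
  by rewrite integral_gauss// -EFinM ltry.
have DF z : `|F z| <= D z.
  rewrite /F /D !normrM (ger0_norm (expR_ge0 _)) ler_wpM2l ?expR_ge0//.
  rewrite mulrA (le_trans _ (kyey _))// ler_piMl//.
  by rewrite -normrM normrM mulr_ile1// ler_norml cos_geN1 cos_le1.
have iF : (mu \x mu)%E.-integrable setT (EFin \o F).
  by apply: integrable_le_norm iD.
have E1 : \int[mu]_s (expR (- (tau * s ^+ 2)) * (cos (r * s) * Q s)) =
    fine (\int[mu]_s \int[mu]_y (F (s, y))%:E).
  congr fine; apply: eq_integral => s _; rewrite 2!EFinM -QE integral_mkcond.
  have ik : mu.-integrable setT (EFin \o (fun y : R => cos (s * y) * ky y)).
    apply: integrable_le_norm (integrable_scale M measurableT iey) => //.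
      apply: measurable_funM => //; apply: (measurableT_comp mcos); exact: measurable_funM.
    move=> y _; rewrite normrM (le_trans _ (kyey _))// ler_piMl//.
    by rewrite ler_norml cos_geN1 cos_le1.
  rewrite [X in (_ * (_ * X))%E](_ : _ = \int[mu]_y (cos (s * y) * ky y)%:E)%E; last first.
    by apply: eq_integral => y _; rewrite /ky !patchE; case: ifP => // _; rewrite mulr0.
  rewrite -integralZl//.
  rewrite -integralZl//; last by apply: integrable_scale.
rewrite E1 (@Fubini _ _ _ _ _ mu mu (EFin \o F) iF)/=.
(* The result of the integration in [s]: two positive Gaussians centred at r and -r, each of mass pi
   whatever [tau] and [r] are. Only the supremum of the line kernel is then needed. *)
pose g (y : R) := 2^-1 * Num.sqrt (pi / tau) * (expR (- ((r + y) ^+ 2 / (4 * tau))) + expR (- ((r - y) ^+ 2 / (4 * tau)))).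
have igc (y : R) : mu.-integrable setT (EFin \o (fun s : R => expR (- (tau * s ^+ 2)) * (cos (r * s) * cos (s * y)))).
  apply: integrable_le_norm (integrable_gauss t0) => //.
    apply: measurable_funM => //; apply: measurable_funM.
      by apply: (measurableT_comp mcos); exact: measurable_funM.
    by apply: (measurableT_comp mcos); exact: measurable_funM.
  move=> s _; rewrite normrM (ger0_norm (expR_ge0 _)) ler_piMr ?expR_ge0//.
  by rewrite normrM mulr_ile1// ler_norml cos_geN1 cos_le1.
have E2 (y : R) : (\int[mu]_s (F (s, y))%:E = (ky y * g y)%:E)%E.
  rewrite EFinM /g -integral_gauss_coscos// fineK; last exact: (integrable_fin_num measurableT (igc y)).
  rewrite -(integralZl measurableT (igc y)).
  by apply: eq_integral => s _; rewrite /F/= -EFinM; congr (_%:E); ring.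
under eq_integral do rewrite E2.
have t4 : 0 < (4 * tau)^-1 by rewrite invr_gt0 mulr_gt0.
have gE (y : R) : g y = 2^-1 * Num.sqrt (pi / tau) * expR (- ((4 * tau)^-1 * (y - (- r)) ^+ 2)) +
    2^-1 * Num.sqrt (pi / tau) * expR (- ((4 * tau)^-1 * (y - r) ^+ 2)).
  rewrite /g mulrDr; congr (_ * expR (- _) + _ * expR (- _)); field; rewrite gt_eqF//.
have sp0 : 0 <= 2^-1 * Num.sqrt (pi / tau) by rewrite mulr_ge0 ?invr_ge0 ?sqrtr_ge0.
have igg m : mu.-integrable setT (fun y : R => (2^-1 * Num.sqrt (pi / tau) * expR (- ((4 * tau)^-1 * (y - m) ^+ 2)))%:E).
  apply: (@integrable_scale _ _ _ mu setT (2^-1 * Num.sqrt (pi / tau)) (fun y : R => expR (- ((4 * tau)^-1 * (y - m) ^+ 2)))) => //.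
  apply/integrableP; split.
    by apply/measurable_EFinP; apply: continuous_measurable; exact: expR_quad_cont.
  under eq_integral do rewrite gee0_abs ?lee_fin ?expR_ge0//.
  by rewrite integral_gauss_center// ltry.
have Igg m : (\int[mu]_y (2^-1 * Num.sqrt (pi / tau) * expR (- ((4 * tau)^-1 * (y - m) ^+ 2)))%:E = pi%:E)%E.
  under eq_integral do rewrite EFinM.
  rewrite ge0_integralZl//; last by apply/measurable_EFinP; apply: continuous_measurable; exact: expR_quad_cont.
  rewrite integral_gauss_center// -EFinM; congr (_%:E).
  rewrite -mulrA -sqrtrM ?divr_ge0 ?pi_ge0 ?(ltW t0)//.
  have -> : pi / tau * (pi / (4 * tau)^-1) = (2 * pi) ^+ 2.
    by field; rewrite gt_eqF.
  by rewrite sqrtr_sqr ger0_norm ?mulr_ge0 ?pi_ge0//; field.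
have g0 (y : R) : 0 <= g y by rewrite /g mulr_ge0// addr_ge0 ?expR_ge0.
have iM : mu.-integrable setT (EFin \o (fun y => M * g y)).
  apply: integrable_scale => //.
  have := integrableD measurableT (igg (- r)) (igg r).
  by apply: eq_integrable => // y _; rewrite /= gE EFinD.
have mkg : measurable_fun setT (fun y : R => ky y * g y).
  apply: measurable_funM => //.
  have := measurable_int _ (integrableD measurableT (igg (- r)) (igg r)) => /measurable_EFinP.
  by apply: eq_measurable_fun => y _; rewrite /= gE.
have kgM (y : R) : `|ky y * g y| <= M * g y.
  rewrite normrM (ger0_norm (g0 y)) ler_wpM2r// (le_trans (kyey _))// ler_piMr//.
  rewrite /ey patchE; case: ifPn => //; rewrite inE/= in_itv/= andbT => y0.
  by rewrite -expR0 ler_expR oppr_le0 mulr_ge0// ltW.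
have ik : mu.-integrable setT (EFin \o (fun y => ky y * g y)) by apply: integrable_le_norm iM.
rewrite (le_trans (le_normr_Rintegral measurableT ik))//.
apply: (@le_trans _ _ (\int[mu]_y (M * g y))).
  apply: le_Rintegral => //.
  apply: integrable_le_norm iM => //; first exact: measurableT_comp.
  by move=> y _; rewrite normr_id.
rewrite RintegralZl//; last first.
  have := integrableD measurableT (igg (- r)) (igg r).
  by apply: eq_integrable => // y _; rewrite /= gE EFinD.
rewrite mulrC ler_wpM2r// /Rintegral.
under eq_integral do rewrite gE EFinD.
by rewrite integralD// !Igg -EFinD/=; lra.
Qed.

End oscillation.

(** * The singular part at the unit sphere *)

Section slices.
Context {R : realType}.
Notation mu := (@lebesgue_measure R).
Notation lt n := (@lebesgue_tuple R n).
Notation tup n := (n.-tuple (measurableTypeR R)).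

(** Comparable with |c + i d|^(-1/2), the amplitude of the one-dimensional resolvent kernel; the sum
    |c| + d is easier to integrate than the modulus. *)
Definition shell_weight (d c : R) : R := (`|c| + d) `^ (- (1 / 2)).

Lemma shell_weight_ge0 d c : 0 <= shell_weight d c.
Proof. exact: powR_ge0. Qed.

Section square_root.
Variables (c d : R).
Hypothesis d0 : 0 < d.
Let k := Num.sqrt (c ^+ 2 + d ^+ 2).
Let k2 : k ^+ 2 = c ^+ 2 + d ^+ 2.
Proof. by rewrite sqr_sqrtr// addr_ge0 ?sqr_ge0. Qed.
Let kc : `|c| < k.
Proof.
rewrite -(@ltr_pXn2r _ 2) ?nnegrE ?normr_ge0 ?sqrtr_ge0// k2 real_normK ?num_real//.
by rewrite ltrDl exprn_gt0.
Qed.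
Let kpc : 0 < (k + c) / 2.
Proof. by have := kc; rewrite ltr_norml => /andP[? ?]; rewrite divr_gt0//; lra. Qed.
Let kmc : 0 < (k - c) / 2.
Proof. by have := kc; rewrite ltr_norml => /andP[? ?]; rewrite divr_gt0//; lra. Qed.
Let a := Num.sqrt ((k + c) / 2).
Let b := Num.sqrt ((k - c) / 2).

(** The root kappa of c + i d in the open first quadrant, used to write (s^2 - c)^2 + d^2 as |s^2 -
    kappa^2|^2. Its positive imaginary part makes the line kernel decay. *)
Lemma complex_sqrt : exists p : R * R, [/\ 0 < p.1, 0 < p.2, p.1 ^+ 2 - p.2 ^+ 2 = c, 2 * p.1 * p.2 = d &
  p.1 ^+ 2 + p.2 ^+ 2 = Num.sqrt (c ^+ 2 + d ^+ 2)].
Proof.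
exists (a, b); rewrite /= !sqrtr_gt0 !sqr_sqrtr ?(ltW kpc) ?(ltW kmc)//; split => //.
- by field.
- rewrite -mulrA -sqrtrM ?(ltW kpc)//.
  have -> : (k + c) / 2 * ((k - c) / 2) = (d / 2) ^+ 2.
    have -> : (d / 2) ^+ 2 = (k ^+ 2 - c ^+ 2) / 4 by rewrite k2; field.
    by field.
  by rewrite sqrtr_sqr ger0_norm ?divr_ge0 ?(ltW d0)//; field.
- by rewrite -/k; field.
Qed.

End square_root.

Lemma inv_sqrt_modulus_le (c d : R) : 0 < d ->
  (Num.sqrt (Num.sqrt (c ^+ 2 + d ^+ 2)))^-1 <= 2 * shell_weight d c.
Proof.
move=> d0; set k := Num.sqrt (c ^+ 2 + d ^+ 2).
have cd0 : 0 < `|c| + d by rewrite ltr_wpDl.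
have cdk : (`|c| + d) / 4 <= k.
  rewrite -(@ler_pXn2r _ 2) ?nnegrE ?sqrtr_ge0 ?divr_ge0 ?(ltW cd0)//.
  rewrite sqr_sqrtr ?addr_ge0 ?sqr_ge0// -(real_normK (num_real c)).
  have := sqr_ge0 (`|c| - d); have := sqr_ge0 `|c|; have := sqr_ge0 d.
  rewrite exprMn; lra.
rewrite /shell_weight powRN -[1 / 2](_ : 2^-1 = _) ?mul1r// powR12_sqrt ?(ltW cd0)//.
have s0 : 0 < Num.sqrt (`|c| + d) by rewrite sqrtr_gt0.
rewrite -[leRHS]invrK lef_pV2 ?posrE ?sqrtr_gt0 ?invr_gt0 ?mulr_gt0 ?invr_gt0 ?(lt_le_trans _ cdk) ?divr_gt0//.
  rewrite invfM invrK.
  have -> : 2^-1 * Num.sqrt (`|c| + d) = Num.sqrt ((`|c| + d) / 4).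
    rewrite sqrtrM ?(ltW cd0)// mulrC; congr (_ * _).
    have -> : (4 : R)^-1 = (2^-1) ^+ 2 by field.
    by rewrite sqrtr_sqr ger0_norm.
  by rewrite ler_wsqrtr.
by rewrite ltr_wpDl ?sqr_ge0 ?exprn_gt0.
Qed.

(** Real and imaginary part of 1 / (p - i d). *)
Definition shell_re (d p : R) : R := p / (p ^+ 2 + d ^+ 2).
Definition shell_im (d p : R) : R := d / (p ^+ 2 + d ^+ 2).

(** Real and imaginary part are treated at once: each comes from a pair (X, Y) of modulus |kappa|,
    and division by |kappa|^2 leaves the amplitude |kappa|^(-1) = |c + i d|^(-1/2). *)
Lemma slice_bound_gen (tau r c d : R) (f : R -> R) (X Y : R -> R -> R) : 0 < tau -> 0 < d ->
  (forall a b, X a b ^+ 2 + Y a b ^+ 2 = a ^+ 2 + b ^+ 2) ->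
  (forall a b s, 0 < a -> 0 < b -> a ^+ 2 - b ^+ 2 = c -> 2 * a * b = d ->
    f s = (a ^+ 2 + b ^+ 2)^-1 * (2^-1 * ((X a b * b - Y a b * (a + s)) / (b ^+ 2 + (a + s) ^+ 2) +
            (X a b * b - Y a b * (a - s)) / (b ^+ 2 + (a - s) ^+ 2)))) ->
  `|\int[mu]_s (expR (- (tau * s ^+ 2)) * (cos (r * s) * f s))| <= 4 * pi * shell_weight d c.
Proof.
move=> t0 d0 XY fE; have [[a b] /= [a0 b0 abc abd abk]] := complex_sqrt c d0.
have k0 : 0 < a ^+ 2 + b ^+ 2 by rewrite addr_gt0 ?exprn_gt0.
set k := a ^+ 2 + b ^+ 2.
have Db w : b ^+ 2 + w ^+ 2 != 0 by rewrite gt_eqF// ltr_pwDl ?exprn_gt0 ?sqr_ge0.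
have QE s : (\int[mu]_(y in `[0%R, +oo[) (cos (s * y) * line_kernel a b (X a b / k) (Y a b / k) y)%:E = (f s)%:E)%E.
  rewrite integral_line_kernel//; congr (_%:E); rewrite (fE a b s a0 b0 abc abd) -/k.
  by field; rewrite !Db gt_eqF.
rewrite (le_trans (gauss_line_kernel_bound r t0 b0 QE))//.
have -> : (X a b / k) ^+ 2 + (Y a b / k) ^+ 2 = k^-1.
  have -> : (X a b / k) ^+ 2 + (Y a b / k) ^+ 2 = (X a b ^+ 2 + Y a b ^+ 2) / k ^+ 2.
    by field; rewrite gt_eqF.
  by rewrite XY -/k; field; rewrite gt_eqF.
rewrite sqrtrV ?(ltW k0)//.
have := inv_sqrt_modulus_le c d0; rewrite -abk -/k => h.
have -> : 4 * pi * shell_weight d c = 2 * pi * (2 * shell_weight d c) by ring.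
by rewrite ler_wpM2l ?mulr_ge0 ?pi_ge0.
Qed.

Lemma slice_re (tau r c d : R) : 0 < tau -> 0 < d ->
  `|\int[mu]_s (expR (- (tau * s ^+ 2)) * (cos (r * s) * shell_re d (s ^+ 2 - c)))| <=
  4 * pi * shell_weight d c.
Proof.
move=> t0 d0; apply: (@slice_bound_gen _ _ _ _ _ (fun a b => b) (fun a b => a)) => //.
- by move=> a b; rewrite addrC.
- by move=> a b s a0 b0 abc abd; rewrite /shell_re -abc -abd line_resolvent_re.
Qed.

Lemma slice_im (tau r c d : R) : 0 < tau -> 0 < d ->
  `|\int[mu]_s (expR (- (tau * s ^+ 2)) * (cos (r * s) * shell_im d (s ^+ 2 - c)))| <=
  4 * pi * shell_weight d c.
Proof.
move=> t0 d0; apply: (@slice_bound_gen _ _ _ _ _ (fun a b => a) (fun a b => - b)) => //.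
- by move=> a b; rewrite sqrrN.
- by move=> a b s a0 b0 abc abd; rewrite /shell_im -abc -abd line_resolvent_im.
Qed.

Lemma shell_weight_anti (d x y : R) : 0 < d -> `|x| <= `|y| -> shell_weight d y <= shell_weight d x.
Proof. by move=> d0 xy; rewrite powRN_le// ?lerD2r// ltr_wpDl. Qed.

Lemma measurable_shell_weight (d : R) : measurable_fun setT (shell_weight d).
Proof.
by apply: (measurableT_comp (measurable_powR _)); exact: measurable_funD.
Qed.

Lemma integral_itv_derive_on (g G : R -> R) (u v : R) : u < v ->
  (forall x : R, u <= x <= v -> is_derive x 1 G (g x)) ->
  (forall x : R, u <= x <= v -> {for x, continuous g}) ->
  (\int[mu]_(x in `[u, v]) (g x)%:E = (G v - G u)%:E)%E.
Proof.
move=> uv dG cg.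
have cG x : u <= x <= v -> {for x, continuous G}.
  move=> uxv; apply/differentiable_continuous/derivable1_diffP.
  by have := dG x uxv; case.
have uu : u <= u <= v by rewrite lexx ltW.
have vv : u <= v <= v by rewrite lexx ltW.
have oc x : x \in `]u, v[ -> u <= x <= v by rewrite in_itv/= => /andP[/ltW -> /ltW ->].
rewrite (@continuous_FTC2 _ g G)//.
- apply/continuous_within_itvP => //; split.
  + by move=> x /oc; exact: cg.
  + exact/cvg_at_right_filter/cg.
  + exact/cvg_at_left_filter/cg.
- split.
  + by move=> x /oc xuv; have := dG x xuv; case.
  + exact/cvg_at_right_filter/cG.
  + exact/cvg_at_left_filter/cG.
- by move=> x /oc xuv; rewrite derive1E; have := dG x xuv; case.
Qed.

(* [(u + d) ^ (- 1/2)] has the primitive [2 (u + d) ^ (1/2)]. *)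
Lemma integral_shell_weight (d m : R) : 0 < d ->
  (\int[mu]_(s in `[(m - 1)%R, (m + 1)%R]) (shell_weight d (s - m))%:E <= 4%:E)%E.
Proof.
move=> d0.
have mw : measurable_fun setT (fun s : R => (shell_weight d (s - m))%:E).
  apply/measurable_EFinP; apply: (measurableT_comp (measurable_shell_weight d)).
  exact: measurable_funB.
have w0 s : (0 <= (shell_weight d (s - m))%:E)%E by rewrite lee_fin shell_weight_ge0.
have half : (1 + d) `^ (1 / 2) - d `^ (1 / 2) <= 1.
  have -> : (1 / 2 : R) = 2^-1 by rewrite mul1r.
  rewrite !powR12_sqrt ?addr_ge0 ?(ltW d0)// lerBlDr.
  rewrite -(@ler_pXn2r _ 2) ?nnegrE ?sqrtr_ge0 ?addr_ge0 ?sqrtr_ge0//.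
  rewrite sqr_sqrtr ?addr_ge0 ?(ltW d0)// sqrrD expr1n mul1r sqr_sqrtr ?(ltW d0)//.
  by rewrite addrAC lerDl mulrn_wge0// sqrtr_ge0.
have -> : `[m - 1, m + 1]%classic = `[m - 1, m] `|` `]m, m + 1].
  apply/seteqP; split => s /=; rewrite !in_itv/=.
    by move=> /andP[s0 s1]; case: (leP s m) => sq; [left|right]; rewrite ?s0.
  by move=> [/andP[-> sq]|/andP[sq ->]]; rewrite ?andbT; lra.
rewrite ge0_integral_setU//=; last 2 first.
- exact: measurable_funTS.
- rewrite disj_set2E; apply/eqP/seteqP; split => // s /= []; rewrite !in_itv/= => /andP[_ sq] /andP[qs _].
  by move: (lt_le_trans qs sq); rewrite ltxx.
have -> : (4 : R)%:E = ((2 : R)%:E + (2 : R)%:E)%E by rewrite -EFinD; congr (_%:E); ring.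
have powE (g : R -> R) (e x : R) : e * e = 1 -> 0 < g x -> is_derive x 1 g e ->
    is_derive x 1 (fun s => 2 * e * (g s) `^ (1 / 2)) ((g x) `^ (- (1 / 2))).
  move=> ee gx dg; have := is_deriveZ (2 * e) (is_derive1_comp (is_derive_powR (1 / 2) gx) dg) => h.
  apply: (is_derive_eq h); rewrite /GRing.scale/=.
  have -> : - (1 / 2) = 1 / 2 - 1 :> R by field.
  set z := g x `^ _; have -> : 2 * e * (1 / 2 * z * e) = e * e * z by field.
  by rewrite ee mul1r.
have contE (g : R -> R) (x : R) : 0 < g x -> continuous g -> {for x, continuous (fun s => (g s) `^ (- (1 / 2)))}.
  by move=> gx cg; apply: (cvg_comp g (@powR R ^~ _) (cg x)); exact: powR_cont.
apply: leeD.
  rewrite (@eq_integral _ _ _ mu _ (fun s : R => ((m - s + d) `^ (- (1 / 2)))%:E)); last first.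
    by move=> s; rewrite inE/= in_itv/= => /andP[_ sm]; rewrite /shell_weight ler0_norm ?subr_le0// opprB.
  rewrite [X in (X <= _)%E](_ : _ = (2 * (- 1) * (m - m + d) `^ (1 / 2) - 2 * (- 1) * (m - (m - 1) + d) `^ (1 / 2))%:E).
    rewrite subrr add0r (_ : m - (m - 1) = 1) ?lee_fin; [lra|ring].
  apply: (@integral_itv_derive_on (fun s => (m - s + d) `^ (- (1 / 2))) (fun s => 2 * (- 1) * (m - s + d) `^ (1 / 2))).
  - by rewrite gtrDl oppr_lt0.
  - move=> s /andP[_ sm]; have g0 : 0 < m - s + d by rewrite ltr_wpDl ?subr_ge0.
    have dg : is_derive s 1 (fun s : R => m - s + d) (- 1).
      by apply: is_derive_eq; rewrite /GRing.scale/=; ring.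
    by apply: (@powE (fun s => m - s + d) (- 1) s _ g0 dg); ring.
  - move=> s /andP[_ sm]; apply: (contE (fun s => m - s + d)); first by rewrite ltr_wpDl ?subr_ge0.
    by move=> x; apply: cvgD; [apply: cvgB; [exact: cvg_cst|exact: cvg_id]|exact: cvg_cst].
apply: (@le_trans _ _ (\int[mu]_(s in `[m, (m + 1)%R]) (shell_weight d (s - m))%:E)%E).
  apply: ge0_subset_integral => //; first exact: measurable_funTS.
  by move=> s /=; rewrite !in_itv/= => /andP[/ltW -> ->].
rewrite (@eq_integral _ _ _ mu _ (fun s : R => ((s - m + d) `^ (- (1 / 2)))%:E)); last first.
  by move=> s; rewrite inE/= in_itv/= => /andP[sm _]; rewrite /shell_weight ger0_norm ?subr_ge0.
rewrite [X in (X <= _)%E](_ : _ = (2 * 1 * (m + 1 - m + d) `^ (1 / 2) - 2 * 1 * (m - m + d) `^ (1 / 2))%:E).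
  have -> : m + 1 - m + d = 1 + d by ring.
  by rewrite subrr add0r lee_fin; lra.
apply: (@integral_itv_derive_on (fun s => (s - m + d) `^ (- (1 / 2))) (fun s => 2 * 1 * (s - m + d) `^ (1 / 2))).
- by rewrite ltrDl.
- move=> s /andP[sm _]; have g0 : 0 < s - m + d by rewrite ltr_wpDl ?subr_ge0.
  have dg : is_derive s 1 (fun s : R => s - m + d) 1.
    by apply: is_derive_eq; rewrite /GRing.scale/=; ring.
  by apply: (@powE (fun s => s - m + d) 1 s _ g0 dg); ring.
- move=> s /andP[sm _]; apply: (contE (fun s => s - m + d)); first by rewrite ltr_wpDl ?subr_ge0.
  by move=> x; apply: cvgD; [apply: cvgB; [exact: cvg_id|exact: cvg_cst]|exact: cvg_cst].
Qed.

(** Within distance 1 of [m] the Gaussian is dropped and the weight has integral at most 4; farther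
    away the weight is at most 1 and the Gaussian has mass sqrt(pi). *)
Lemma integral_gauss_shell_weight (d m : R) : 0 < d ->
  (\int[mu]_s (expR (- (s ^+ 2)) * shell_weight d (s - m))%:E <= (4 + Num.sqrt pi)%:E)%E.
Proof.
move=> d0.
have mw : measurable_fun setT (fun s : R => (shell_weight d (s - m))%:E).
  apply/measurable_EFinP; apply: (measurableT_comp (measurable_shell_weight d)).
  exact: measurable_funB.
have mI : measurable (`[m - 1, m + 1]%classic : set (measurableTypeR R)) by exact: measurable_itv.
have mW : measurable_fun setT ((fun s : R => (shell_weight d (s - m))%:E) \_ `[m - 1, m + 1]).
  by apply/(measurable_restrictT (fun s : R => (shell_weight d (s - m))%:E) mI); exact: measurable_funTS.
have mg : measurable_fun setT (fun s : R => (expR (- (s ^+ 2)))%:E).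
  apply/measurable_EFinP; apply: continuous_measurable.
  by have := @expR_sqr_cont R 1; under eq_fun do rewrite mul1r.
have W0 s : (0 <= ((fun s : R => (shell_weight d (s - m))%:E) \_ `[(m - 1)%R, (m + 1)%R]) s)%E.
  by rewrite patchE; case: ifP => // _; rewrite lee_fin shell_weight_ge0.
apply: (@le_trans _ _ (\int[mu]_s (((fun s : R => (shell_weight d (s - m))%:E) \_ `[(m - 1)%R, (m + 1)%R]) s +
   (expR (- (s ^+ 2)))%:E))%E).
  apply: ge0_le_integral => //.
  - by move=> s _; rewrite lee_fin mulr_ge0 ?expR_ge0 ?shell_weight_ge0.
  - by apply/measurable_EFinP; apply: measurable_funM; exact/measurable_EFinP.
  - exact: emeasurable_funD.
  move=> s _; rewrite patchE; case: ifPn => sm.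
    rewrite -EFinD lee_fin ler_wpDr ?expR_ge0// ler_piMl ?shell_weight_ge0//.
    by rewrite -expR0 ler_expR oppr_le0 sqr_ge0.
  rewrite add0e lee_fin ler_piMr ?expR_ge0//.
  have s1 : 1 <= `|s - m|.
    rewrite leNgt; apply/negP => h; move/negP: sm; apply; rewrite inE/= in_itv/=.
    by move: h; rewrite ltr_norml => /andP[h1 h2]; apply/andP; split; lra.
  rewrite (le_trans (shell_weight_anti d0 (_ : `|1| <= _)))// ?normr1//.
  rewrite /shell_weight normr1 powRN invf_le1 ?powR_gt0 ?addr_gt0//.
  by rewrite -[leLHS](powRr0 (1 + d)) ler_powR// lerDl ltW.
rewrite ge0_integralD//.
rewrite -integral_mkcond EFinD; apply: leeD; first exact: integral_shell_weight.
have := @integral_gauss R 1 ltr01; rewrite divr1 => <-.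
by rewrite le_eqVlt; apply/orP; left; apply/eqP; apply: eq_integral => s _; rewrite mul1r.
Qed.

(** For c >= 0, |c - s^2| = |s - m| |s + m|, so the weight behaves like two line weights at the
    roots m and -m, of rescaled width d / sqrt(D). Raising the inequality [main] to the power -1/2
    produces D^(-1/4) and the constant 3^(1/2). *)
Lemma shell_weight_split (d c s D m : R) : 0 < d ->
  D = `|c| + d -> m = Num.sqrt `|c| ->
  shell_weight d (c - s ^+ 2) <= 3 `^ (1 / 2) * D `^ (- (1 / 4)) *
   (shell_weight (d / Num.sqrt D) (s - m) + shell_weight (d / Num.sqrt D) (s - - m)).
Proof.
move=> d0 DE mE; have D0 : 0 < D by rewrite DE ltr_wpDl.
have sD0 : 0 < Num.sqrt D by rewrite sqrtr_gt0.
set e := d / Num.sqrt D; have e0 : 0 < e by rewrite divr_gt0.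
pose u := `| `|s| - m|.
have m0 : 0 <= m by rewrite mE sqrtr_ge0.
have m2 : m ^+ 2 = `|c| by rewrite mE sqr_sqrtr.
have u0 : 0 <= u by exact: normr_ge0.
have sq : Num.sqrt D <= m + Num.sqrt d.
  rewrite -(@ler_pXn2r _ 2) ?nnegrE ?sqrtr_ge0 ?addr_ge0 ?sqrtr_ge0//.
  rewrite sqr_sqrtr ?(ltW D0)// DE sqrrD m2 sqr_sqrtr ?(ltW d0)// addrAC lerDl mulrn_wge0// mulr_ge0 ?sqrtr_ge0//.
have mu_le : m * u <= `|c - s ^+ 2| /\ u ^+ 2 <= `|c - s ^+ 2|.
  rewrite -(real_normK (num_real s)) /u; have S0 := normr_ge0 s.
  set S := `|s| in S0 *; have [c0|c0] := leP 0 c.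
    rewrite -(ger0_norm c0) -m2 (_ : m ^+ 2 - S ^+ 2 = (m - S) * (m + S)); last by ring.
    rewrite normrM distrC (ger0_norm (addr_ge0 m0 S0)); split.
      by rewrite mulrC ler_wpM2l// lerDl.
    by rewrite expr2 ler_wpM2l// (le_trans (ler_normB _ _))// !ger0_norm.
  (* For c < 0 there is no real root, but m^2 + S^2 dominates m u and u^2 all the same. *)
  have -> : c - S ^+ 2 = - (m ^+ 2 + S ^+ 2) by rewrite m2 ltr0_norm//; ring.
  rewrite normrN (ger0_norm (addr_ge0 (sqr_ge0 _) (sqr_ge0 _))); split.
    have [mS|mS] := leP m S; first by rewrite ger0_norm ?subr_ge0//; nra.
    by rewrite ltr0_norm ?subr_lt0//; nra.
  by rewrite real_normK ?num_real//; nra.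
have main : Num.sqrt D * (u + e) <= 3 * (`|c - s ^+ 2| + d).
  have du : Num.sqrt d * u <= d + u ^+ 2.
    have := sqr_ge0 (Num.sqrt d - u); rewrite sqrrB sqr_sqrtr ?(ltW d0)//.
    have : 0 <= Num.sqrt d * u by rewrite mulr_ge0// sqrtr_ge0.
    rewrite -mulr_natr; lra.
  have eD : Num.sqrt D * e = d by rewrite /e; field; rewrite gt_eqF.
  rewrite mulrDr eD; case: mu_le => h1 h2.
  have u20 := sqr_ge0 u.
  have : Num.sqrt D * u <= (m + Num.sqrt d) * u by rewrite ler_wpM2r.
  rewrite mulrDl; lra.
have wu : shell_weight e u <= shell_weight e (s - m) + shell_weight e (s - - m).
  rewrite opprK /u; have [s0|s0] := leP 0 s.
    rewrite (ger0_norm s0) (_ : shell_weight e `|s - m| = shell_weight e (s - m)) ?lerDl ?shell_weight_ge0//.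
    by rewrite /shell_weight normr_id.
  rewrite (ltr0_norm s0) (_ : shell_weight e `|- s - m| = shell_weight e (s + m)) ?lerDr ?shell_weight_ge0//.
  by rewrite /shell_weight normr_id -opprD normrN.
rewrite (@le_trans _ _ (3 `^ (1 / 2) * D `^ (- (1 / 4)) * shell_weight e u))//; last first.
  by rewrite ler_wpM2l// mulr_ge0 ?powR_ge0.
have ue0 : 0 < u + e by rewrite ltr_wpDl.
have -> : 3 `^ (1 / 2) * D `^ (- (1 / 4)) * shell_weight e u = (Num.sqrt D * (u + e) / 3) `^ (- (1 / 2)).
  rewrite /shell_weight (ger0_norm u0) powRM ?mulr_ge0 ?(ltW sD0) ?(ltW ue0)// ?invr_ge0// powRM ?(ltW sD0) ?(ltW ue0)//.
  rewrite -powR12_sqrt ?(ltW D0)// -powRrM -[3^-1](powR_inv1 (ler0n _ 3)) -powRrM.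
  have -> : 2^-1 * - (1 / 2) = - (1 / 4) :> R by field.
  by rewrite mulN1r opprK; ring.
rewrite /shell_weight powRN_le ?divr_gt0 ?mulr_gt0//.
by rewrite ler_pdivrMr// [leRHS]mulrC.
Qed.

Lemma gauss_shell_slice (d c : R) : 0 < d ->
  (\int[mu]_s (expR (- (s ^+ 2)) * shell_weight d (c - s ^+ 2))%:E <=
   (3 `^ (1 / 2) * (8 + 2 * Num.sqrt pi) * (1 + shell_weight d c))%:E)%E.
Proof.
move=> d0; set D := `|c| + d; set m := Num.sqrt `|c|.
have D0 : 0 < D by rewrite ltr_wpDl.
set e := d / Num.sqrt D; have e0 : 0 < e by rewrite divr_gt0// sqrtr_gt0.
have mg : measurable_fun setT (fun s : R => expR (- (s ^+ 2))).
  apply: continuous_measurable.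
  by have := @expR_sqr_cont R 1; under eq_fun do rewrite mul1r.
have mgw x y : measurable_fun setT (fun s : R => (expR (- (s ^+ 2)) * shell_weight x (s - y))%:E).
  apply/measurable_EFinP; apply: measurable_funM => //.
  apply: (measurableT_comp (measurable_shell_weight x)); exact: measurable_funB.
set K := 3 `^ (1 / 2) * D `^ (- (1 / 4)).
have K0 : 0 <= K by rewrite mulr_ge0 ?powR_ge0.
have gw0 x y s : (0 <= (expR (- (s ^+ 2)) * shell_weight x (s - y))%:E)%E.
  by rewrite lee_fin mulr_ge0 ?expR_ge0 ?shell_weight_ge0.
apply: (@le_trans _ _ (\int[mu]_s (K%:E * ((expR (- (s ^+ 2)) * shell_weight e (s - m))%:E +
   (expR (- (s ^+ 2)) * shell_weight e (s - - m))%:E)))%E).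
  apply: ge0_le_integral => //.
  - by move=> s _; rewrite lee_fin mulr_ge0 ?expR_ge0 ?shell_weight_ge0.
  - apply/measurable_EFinP; apply: measurable_funM => //.
    apply: (measurableT_comp (measurable_shell_weight d)); exact: measurable_funB.
  - by apply: measurable_funeM; apply: emeasurable_funD; exact: mgw.
  move=> s _; rewrite -EFinD -EFinM lee_fin -mulrDr mulrCA ler_wpM2l ?expR_ge0//.
  exact: shell_weight_split.
rewrite ge0_integralZl//; last 2 first.
- by apply: emeasurable_funD; exact: mgw.
- by move=> s _; rewrite adde_ge0.
rewrite ge0_integralD//; last 2 first.
- exact: mgw.
- exact: mgw.
apply: (@le_trans _ _ (K%:E * ((4 + Num.sqrt pi)%:E + (4 + Num.sqrt pi)%:E))%E).
  by apply: lee_wpmul2l; rewrite ?lee_fin//; apply: leeD; exact: integral_gauss_shell_weight.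
rewrite -EFinD -EFinM lee_fin /K -!mulrA ler_wpM2l ?powR_ge0//.
rewrite mulrC (_ : 4 + Num.sqrt pi + (4 + Num.sqrt pi) = 8 + 2 * Num.sqrt pi); last by ring.
rewrite ler_wpM2l ?addr_ge0 ?mulr_ge0 ?sqrtr_ge0//.
(* D^(-1/4) is at most 1 for D >= 1 and at most D^(-1/2) otherwise. This loss gives the bound a form
   that reproduces itself when further variables are integrated. *)
rewrite /shell_weight -/D; have [D1|D1] := leP 1 D.
  rewrite (@le_trans _ _ 1) ?lerDl ?powR_ge0//.
  by rewrite -[leRHS](powRr0 D) ler_powR//; lra.
rewrite (@le_trans _ _ (D `^ (- (1 / 2)))) ?lerDr//.
by apply: ger_powR; [rewrite D0 ltW|lra].
Qed.

(** One variable at a time: the other variables see c - x^2 in place of [c], and by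
    [gauss_shell_slice] the bound C (1 + [shell_weight d c]) keeps its form, with a constant
    independent of [d] and [c]. *)
Lemma shell_integral (n : nat) : exists2 C : R, 0 <= C & forall d c, 0 < d ->
  (\int[lt n]_z (expR (- sqn z) * shell_weight d (c - sqn z))%:E <= (C * (1 + shell_weight d c))%:E)%E.
Proof.
have mgw m d c : measurable_fun setT (fun z : tup m => (expR (- sqn z) * shell_weight d (c - sqn z))%:E).
  apply/measurable_EFinP; apply: measurable_funM.
    by have := @measurable_gauss_sqn R m 1; under eq_fun do rewrite mul1r.
  apply: (measurableT_comp (measurable_shell_weight d)); apply: measurable_funB => //.
  exact: measurable_sqn.
have w0 m d c (z : tup m) : (0 <= (expR (- sqn z) * shell_weight d (c - sqn z))%:E)%E.
  by rewrite lee_fin mulr_ge0 ?expR_ge0 ?shell_weight_ge0.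
elim: n => [|n [C C0 IH]].
  exists 1 => // d c d0; rewrite integral_dirac//; last exact: mgw.
  rewrite diracT mul1e /sqn big_ord0 oppr0 expR0 addr0 !mul1r lee_fin.
  by rewrite lerDr.
set K := 3 `^ (1 / 2) * (8 + 2 * Num.sqrt pi) : R.
have K0 : 0 <= K by rewrite mulr_ge0 ?powR_ge0// addr_ge0// mulr_ge0// sqrtr_ge0.
exists (C * (Num.sqrt pi + K)); first by rewrite mulr_ge0// addr_ge0// sqrtr_ge0.
move=> d c d0; rewrite ge0_integral_cons//.
have mg : measurable_fun setT (fun s : R => (expR (- (s ^+ 2)))%:E).
  apply/measurable_EFinP; apply: continuous_measurable.
  by have := @expR_sqr_cont R 1; under eq_fun do rewrite mul1r.
have msw : measurable_fun setT (fun s : R => (expR (- (s ^+ 2)) * shell_weight d (c - s ^+ 2))%:E).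
  apply/measurable_EFinP; apply: measurable_funM; first exact/measurable_EFinP.
  apply: (measurableT_comp (measurable_shell_weight d)); exact: measurable_funB.
apply: (@le_trans _ _ (\int[mu]_x (C%:E * ((expR (- (x ^+ 2)))%:E + (expR (- (x ^+ 2)) * shell_weight d (c - x ^+ 2))%:E)))%E).
  apply: ge0_le_integral => //.
  - by move=> x _; apply: integral_ge0 => z _.
  - apply: (@measurable_fun_fubini_tonelli_F _ _ _ _ R (lt n)
      (fun z => (expR (- sqn (tuple_cons z)) * shell_weight d (c - sqn (tuple_cons z)))%:E)) => //.
    exact: (@measurable_cons_comp _ _ (fun z => (expR (- sqn z) * shell_weight d (c - sqn z))%:E)).
  - by apply: measurable_funeM; exact: emeasurable_funD.
  move=> x _.
  rewrite (eq_integral (fun z => ((expR (- (x ^+ 2)))%:E * (expR (- sqn z) * shell_weight d (c - x ^+ 2 - sqn z))%:E)%E)); last first.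
    move=> z _; rewrite -EFinM sqn_cons; congr (_%:E).
    have -> : - (x ^+ 2 + sqn z) = - (x ^+ 2) + - sqn z by ring.
    by rewrite expRD -mulrA addrA.
  rewrite ge0_integralZl//; last exact: mgw.
  have -> : (C%:E * ((expR (- (x ^+ 2)))%:E + (expR (- (x ^+ 2)) * shell_weight d (c - x ^+ 2))%:E) =
      (expR (- (x ^+ 2)))%:E * (C * (1 + shell_weight d (c - x ^+ 2)))%:E)%E.
    by rewrite -EFinD -!EFinM; congr (_%:E); ring.
  by apply: lee_wpmul2l; rewrite ?lee_fin ?expR_ge0// ?mul1r IH.
rewrite ge0_integralZl//; last 2 first.
- exact: emeasurable_funD.
- by move=> s _; rewrite adde_ge0// lee_fin ?mulr_ge0 ?expR_ge0 ?shell_weight_ge0.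
rewrite -mulrA EFinM; apply: lee_wpmul2l; first by rewrite lee_fin.
rewrite ge0_integralD//; last first.
  by move=> s _; rewrite lee_fin mulr_ge0 ?expR_ge0 ?shell_weight_ge0.
apply: (@le_trans _ _ ((Num.sqrt pi)%:E + (K * (1 + shell_weight d c))%:E)%E).
  apply: leeD; last exact: gauss_shell_slice.
  have := @integral_gauss R 1 ltr01; rewrite divr1 => <-.
  by rewrite le_eqVlt; apply/orP; left; apply/eqP; apply: eq_integral => s _; rewrite mul1r.
rewrite -EFinD lee_fin [leRHS]mulrDl lerD2r ler_peMr ?sqrtr_ge0// lerDl.
exact: shell_weight_ge0.
Qed.

Definition axis n (r : R) (i : 'I_n) : R := if val i == 0%N then r else 0.

Lemma lin_axis n (r x : R) (t : tup n) : lin (@axis n.+1 r) (tuple_cons (x, t)) = r * x.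
Proof.
rewrite lin_cons /axis/= /lin big1 ?addr0// => i _.
by rewrite mulr0.
Qed.

Lemma sum_axis n (r : R) : \sum_(i < n.+1) @axis n.+1 r i ^+ 2 = r ^+ 2.
Proof. by rewrite big_ord_recl/= /axis/= big1 ?addr0// => i _; rewrite expr0n. Qed.

(* Integrating along the axis first reduces the shell singularity to the line. *)
Lemma radial_slices n (f : R -> R) (M t r d C : R) :
  0 < t -> 0 < d -> 0 <= C -> measurable_fun setT f -> (forall p, `|f p| <= M) ->
  (forall c, `|\int[mu]_s (expR (- ((t + 1) * s ^+ 2)) * (cos (r * s) * f (s ^+ 2 - c)))| <= C * shell_weight d c) ->
  (\int[lt n]_z (expR (- sqn z) * shell_weight d (1 - sqn z))%:E < +oo)%E ->
  `|radial (fun p => expR (- p) * f (p - 1)) t (@axis n.+1 r) 0| <=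
  C * fine (\int[lt n]_z (expR (- sqn z) * shell_weight d (1 - sqn z))%:E)%E.
Proof.
move=> t0 d0 C0 mf fM fC fin.
have mphi : measurable_fun setT (fun p : R => expR (- p) * f (p - 1)).
  apply: measurable_funM; first by apply: measurableT_comp.
  by apply: (measurableT_comp mf); exact: measurable_funB.
have phiM p : 0 <= p -> `|expR (- p) * f (p - 1)| <= M.
  move=> p0; rewrite normrM (ger0_norm (expR_ge0 _)) (le_trans _ (fM (p - 1)))// ler_piMl//.
  by rewrite -expR0 ler_expR oppr_le0.
have iphi := integrable_radial (@axis n.+1 r) 0 t0 mphi phiM.
rewrite /radial /Rintegral (integral_cons_swap iphi).
have imw : (lt n).-integrable setT (EFin \o (fun z : tup n => expR (- sqn z) * shell_weight d (1 - sqn z))).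
  apply/integrableP; split.
    apply/measurable_EFinP; apply: measurable_funM.
      by have := @measurable_gauss_sqn R n 1; under eq_fun do rewrite mul1r.
    apply: (measurableT_comp (measurable_shell_weight d)); apply: measurable_funB => //.
    exact: measurable_sqn.
  under eq_integral do rewrite /= ger0_norm ?mulr_ge0 ?expR_ge0 ?shell_weight_ge0//.
  exact: fin.
have iCw := integrable_scale C measurableT imw.
(* The factor exp(-p) of the symbol and exp(-t p) combine to exp(-(t + 1) p), which splits between
   the axis and the remaining variables; on each slice c = 1 - |z|^2. *)
pose I (z : tup n) := \int[mu]_s (expR (- ((t + 1) * s ^+ 2)) * (cos (r * s) * f (s ^+ 2 - (1 - sqn z)))).
have inner (z : tup n) : (\int[mu]_x (expR (- sqn (tuple_cons (x, z))) * f (sqn (tuple_cons (x, z)) - 1) *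
    (expR (- (t * sqn (tuple_cons (x, z)))) * cos (lin (@axis n.+1 r) (tuple_cons (x, z)) + 0)))%:E =
   (expR (- ((t + 1) * sqn z)) * I z)%:E)%E.
  have ix : mu.-integrable setT (EFin \o (fun s : R =>
      expR (- ((t + 1) * s ^+ 2)) * (cos (r * s) * f (s ^+ 2 - (1 - sqn z))))).
    have t1 : 0 < t + 1 by rewrite addr_gt0.
    have ms : measurable_fun setT (fun s : R => s ^+ 2) by exact: measurable_funX.
    have ig : mu.-integrable setT (EFin \o (fun s : R => M * expR (- ((t + 1) * s ^+ 2)))) :=
      integrable_scale M measurableT (integrable_gauss t1).
    apply: integrable_le_norm ig => //.
    - apply: measurable_funM.
        by apply: measurableT_comp => //; apply: measurableT_comp => //; exact: measurable_funM.
      apply: measurable_funM.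
        have cc : continuous (fun s : R => cos (r * s)).
          by move=> s; apply: continuous_comp; [apply: cvgMr; exact: cvg_id|exact: continuous_cos].
        by apply: continuous_measurable; exact: cc.
      by apply: (measurableT_comp mf); exact: measurable_funB.
    - move=> s _; rewrite normrM (ger0_norm (expR_ge0 _)) mulrC ler_wpM2r ?expR_ge0// normrM.
      rewrite (le_trans _ (fM (s ^+ 2 - (1 - sqn z))))// ler_piMl// ler_norml.
      by rewrite cos_geN1 cos_le1.
  rewrite -(RintegralZl _ measurableT ix) /Rintegral fineK; last first.
    by apply: (integrable_fin_num measurableT); exact: integrable_scale.
  apply: eq_integral => x _; congr (_%:E).
  rewrite sqn_cons lin_axis addr0 opprB !mulrDl !mul1r.
  have -> : x ^+ 2 + sqn z - 1 = x ^+ 2 + (sqn z - 1) by rewrite addrA.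
  by rewrite mulrDr !opprD !expRD; ring.
have mG : measurable_fun setT (fun z => expR (- ((t + 1) * sqn z)) * I z).
  apply/measurable_EFinP.
  have := measurable_fubini_G (integrable_cons iphi).
  by apply: eq_measurable_fun => z _; rewrite /= -inner.
have Ib z : `|expR (- ((t + 1) * sqn z)) * I z| <= C * (expR (- sqn z) * shell_weight d (1 - sqn z)).
  rewrite normrM (ger0_norm (expR_ge0 _)) mulrCA ler_pM ?expR_ge0//; last exact: fC.
  rewrite ler_expR lerN2 mulrDl mul1r lerDr mulr_ge0 ?(ltW t0)//; exact: sqn_ge0.
have iG := integrable_le_norm measurableT mG (fun z _ => Ib z) iCw.
rewrite (eq_integral (fun z => (expR (- ((t + 1) * sqn z)) * I z)%:E)); last by move=> z _; exact: inner.
rewrite (le_trans (le_normr_Rintegral measurableT iG))//.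
rewrite (le_trans (le_Rintegral measurableT _ iCw (fun z _ => Ib z)))//; first exact: integrable_norm.
by rewrite RintegralZl.
Qed.

Lemma norm_shell_re_le (d p : R) : 0 < d -> `|shell_re d p| <= d^-1.
Proof.
move=> d0; rewrite /shell_re normrM normfV (gtr0_norm (ltr_wpDl (sqr_ge0 p) (exprn_gt0 2 d0))).
rewrite ler_pdivrMr ?ltr_wpDl ?sqr_ge0 ?exprn_gt0// -(real_normK (num_real p)).
rewrite -(@ler_pM2l _ d)// mulrA divff ?gt_eqF// mul1r.
have := sqr_ge0 (`|p| - d); have := sqr_ge0 `|p|; have := sqr_ge0 d; nra.
Qed.

Lemma norm_shell_im_le (d p : R) : 0 < d -> `|shell_im d p| <= d^-1.
Proof.
move=> d0; rewrite /shell_im normrM normfV (gtr0_norm (ltr_wpDl (sqr_ge0 p) (exprn_gt0 2 d0))) gtr0_norm//.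
rewrite ler_pdivrMr ?ltr_wpDl ?sqr_ge0 ?exprn_gt0// -(@ler_pM2l _ d)// mulrA divff ?gt_eqF// mul1r.
by rewrite -expr2 lerDr sqr_ge0.
Qed.

Lemma shell_den_cont d : continuous (fun p : R => p ^+ 2 + d ^+ 2).
Proof. by move=> x; apply: cvgD; [exact: exprn_continuous|exact: cvg_cst]. Qed.

Lemma shell_re_cont d : 0 < d -> continuous (shell_re d).
Proof.
move=> d0 x; apply: cvgM; first exact: cvg_id.
by apply: cvgV; [rewrite gt_eqF ?ltr_wpDl ?sqr_ge0 ?exprn_gt0|exact: shell_den_cont].
Qed.

Lemma shell_im_cont d : 0 < d -> continuous (shell_im d).
Proof.
move=> d0 x; apply: cvgM; first exact: cvg_cst.
by apply: cvgV; [rewrite gt_eqF ?ltr_wpDl ?sqr_ge0 ?exprn_gt0|exact: shell_den_cont].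
Qed.

Lemma measurable_shell_re d : 0 < d -> measurable_fun setT (shell_re d).
Proof. by move=> d0; apply: continuous_measurable; exact: shell_re_cont. Qed.

Lemma measurable_shell_im d : 0 < d -> measurable_fun setT (shell_im d).
Proof. by move=> d0; apply: continuous_measurable; exact: shell_im_cont. Qed.

Lemma shell_radial_bound n : exists2 C : R, 0 <= C & forall t r d, 0 < t -> 0 < d ->
  `|radial (fun p => expR (- p) * shell_re d (p - 1)) t (@axis n.+1 r) 0| <= C /\
  `|radial (fun p => expR (- p) * shell_im d (p - 1)) t (@axis n.+1 r) 0| <= C.
Proof.
have [C C0 hC] := shell_integral n.
(* 4 pi is the constant of the slice bounds, and C * 2 that of [shell_integral] at c = 1, where the
   weight is at most 1. *)
exists (4 * pi * (C * 2)); first by rewrite !mulr_ge0 ?pi_ge0.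
move=> t r d t0 d0; have t1 : 0 < t + 1 by rewrite addr_gt0.
have W0 : (0 <= \int[lt n]_z (expR (- sqn z) * shell_weight d (1 - sqn z))%:E)%E.
  by apply: integral_ge0 => z _; rewrite lee_fin mulr_ge0 ?expR_ge0 ?shell_weight_ge0.
have hW : (\int[lt n]_z (expR (- sqn z) * shell_weight d (1 - sqn z))%:E <= (C * 2)%:E)%E.
  rewrite (le_trans (hC d 1 d0))// lee_fin ler_wpM2l// -[leRHS]/(1 + 1) lerD2l.
  rewrite /shell_weight normr1 powRN invf_le1 ?powR_gt0 ?addr_gt0//.
  by rewrite -[leLHS](powRr0 (1 + d)) ler_powR// lerDl ltW.
have fW : (\int[lt n]_z (expR (- sqn z) * shell_weight d (1 - sqn z))%:E < +oo)%E.
  by rewrite (le_lt_trans hW)// ltry.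
have fWle : 4 * pi * fine (\int[lt n]_z (expR (- sqn z) * shell_weight d (1 - sqn z))%:E)%E <= 4 * pi * (C * 2).
  rewrite ler_wpM2l ?mulr_ge0 ?pi_ge0// -lee_fin fineK ?ge0_fin_numE//.
have pi4 : 0 <= 4 * pi :> R by rewrite mulr_ge0 ?pi_ge0.
split; apply: (le_trans _ fWle); apply: (@radial_slices _ _ d^-1) => //.
- exact: measurable_shell_re.
- by move=> p; exact: norm_shell_re_le.
- by move=> c; exact: slice_re.
- exact: measurable_shell_im.
- by move=> p; exact: norm_shell_im_le.
- by move=> c; exact: slice_im.
Qed.

End slices.

(** * Decomposition of the symbol *)

Section symbol.
Context {R : realType}.
Notation mu := (@lebesgue_measure R).
Notation lt n := (@lebesgue_tuple R n).
Notation tup n := (n.-tuple (measurableTypeR R)).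

Lemma powR_two_sided (b : R) : exists2 c : R * R, 0 < c.1 & forall x, 1 / 2 <= x <= 2 -> c.1 <= x `^ b <= c.2.
Proof.
have h0 : 0 < 1 / 2 :> R by [].
have [b0|b0] := leP 0 b.
  exists ((1 / 2) `^ b, 2 `^ b); first by rewrite powR_gt0.
  move=> x /andP[x1 x2] /=; have x0 := lt_le_trans h0 x1.
  by rewrite !ge0_ler_powR ?nnegrE ?(ltW x0)// ltW.
exists (2 `^ b, (1 / 2) `^ b); first by rewrite powR_gt0.
move=> x /andP[x1 x2] /=; have x0 := lt_le_trans h0 x1.
have bb : b = - (- b) by rewrite opprK.
by rewrite bb !powRN_le// oppr_ge0 ltW.
Qed.

(** The mean value theorem between 1 and [p]. The control of |x - 1| allows a second application at
    [x] with exponent b - 1, which is how [powR_linearization] gets a quadratic error. *)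
Lemma powR_sub1 (b p : R) : 1 / 2 <= p <= 2 -> exists x,
  [/\ 1 / 2 <= x <= 2, `|x - 1| <= `|p - 1| & p `^ b - 1 = b * x `^ (b - 1) * (p - 1)].
Proof.
move=> /andP[p1 p2]; have p0 : 0 < p by lra.
have c01 (u v : R) : 0 < u -> {within `[u, v], continuous (@powR R ^~ b)}.
  move=> u0; apply: continuous_in_subspaceT => x; rewrite inE/= in_itv/= => /andP[ux _].
  by apply: powR_cont; exact: lt_le_trans ux.
have d01 (u v : R) : 0 < u -> forall x, x \in `]u, v[%R -> is_derive x 1 (@powR R ^~ b) (b * x `^ (b - 1)).
  move=> u0 x; rewrite in_itv/= => /andP[ux _]; apply: is_derive_powR; exact: lt_trans ux.
have [le1|ge1] := leP p 1.
  have [x] := MVT_segment le1 (d01 _ _ p0) (c01 _ _ p0).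
  rewrite in_itv/= => /andP[px x1] h; exists x; split.
  - by rewrite (le_trans p1)//=; lra.
  - by rewrite !ler0_norm ?subr_le0//; lra.
  - by rewrite powR1 in h; rewrite -opprB h; ring.
have [x] := MVT_segment (ltW ge1) (d01 _ _ ltr01) (c01 _ _ ltr01).
rewrite in_itv/= => /andP[px x1] h; exists x; split.
- by rewrite (le_trans x1)// andbT; lra.
- by rewrite !ger0_norm ?subr_ge0 ?(ltW ge1)//; lra.
- by rewrite powR1 in h.
Qed.

Lemma powR_linearization (a : R) : 0 < a -> exists2 c : R, 0 < c & exists2 C : R, 0 <= C &
  forall p, 1 / 2 <= p <= 2 ->
    c * `|p - 1| <= `|p `^ a - 1| /\ `|p `^ a - 1 - a * (p - 1)| <= C * (p - 1) ^+ 2.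
Proof.
move=> a0; have [[c1 C1]/= c10 h1] := powR_two_sided (a - 1).
have [[c2 C2]/= c20 h2] := powR_two_sided (a - 1 - 1).
exists (a * c1); first exact: mulr_gt0.
have C20 : 0 <= C2.
  have /andP[h3 h4] := h2 1 ltac:(lra).
  by rewrite (le_trans _ h4)// (le_trans _ h3)// ltW.
exists (a * (`|a - 1| * C2)); first by rewrite !mulr_ge0// ltW.
move=> p pI; have [x [xI xp ->]] := powR_sub1 a pI; split.
  rewrite normrM ler_wpM2r// ger0_norm ?mulr_ge0 ?powR_ge0 ?(ltW a0)//.
  by rewrite ler_wpM2l ?(ltW a0)//; have /andP[] := h1 x xI.
rewrite (_ : _ - _ = a * (x `^ (a - 1) - 1) * (p - 1)); last by ring.
rewrite normrM -(real_normK (num_real (p - 1))) [`|p - 1| ^+ 2]expr2 mulrA ler_wpM2r//.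
rewrite normrM (gtr0_norm a0) -!mulrA ler_wpM2l ?(ltW a0)//.
have [y [yI _ ->]] := powR_sub1 (a - 1) xI.
rewrite !normrM -mulrA ler_wpM2l// ler_pM//.
by have /andP[_] := h2 y yI; rewrite ger0_norm ?powR_ge0.
Qed.

(** Real and imaginary part of 1 / (p^a - 1 - i e), the resolvent symbol for lam = 1 with p =
    |xi|^2. *)
Definition symbol_re (a e p : R) : R := (p `^ a - 1) / ((p `^ a - 1) ^+ 2 + e ^+ 2).
Definition symbol_im (a e p : R) : R := e / ((p `^ a - 1) ^+ 2 + e ^+ 2).

(** The bound is |1 / X - 1 / Y|: regularizing by [e] does not increase the difference, so that
    estimates away from the zeros of X and Y hold uniformly in [e]. *)
Lemma ratio_diff_le (e X Y : R) : X != 0 -> Y != 0 ->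
  `|X / (X ^+ 2 + e ^+ 2) - Y / (Y ^+ 2 + e ^+ 2)| <= `|X - Y| / (`|X| * `|Y|).
Proof.
move=> X0 Y0; have pos (Z : R) : Z != 0 -> 0 < Z ^+ 2 + e ^+ 2.
  by move=> Z0; rewrite ltr_wpDr ?sqr_ge0// exprn_even_gt0.
have DX := pos _ X0; have DY := pos _ Y0.
have -> : X / (X ^+ 2 + e ^+ 2) - Y / (Y ^+ 2 + e ^+ 2) =
   (X - Y) * ((e ^+ 2 - X * Y) / ((X ^+ 2 + e ^+ 2) * (Y ^+ 2 + e ^+ 2))).
  by field; rewrite !gt_eqF.
rewrite normrM ler_wpM2l// normrM normfV (gtr0_norm (mulr_gt0 DX DY)) -normrM.
have XY0 : 0 < `|X * Y| by rewrite normr_gt0 mulf_neq0.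
rewrite ler_pdivrMr ?mulr_gt0// ler_pdivlMl//.
rewrite (le_trans (ler_wpM2l (ltW XY0) (ler_normB _ _)))// (ger0_norm (sqr_ge0 e)).
have : 0 <= (`|X| - `|Y|) ^+ 2 by exact: sqr_ge0.
have : 0 <= e ^+ 2 by exact: sqr_ge0.
rewrite normrM -(real_normK (num_real X)) -(real_normK (num_real Y)).
have := normr_ge0 X; have := normr_ge0 Y; move: `|X| `|Y| (e ^+ 2) => x y E y0 x0 E0 h.
have : 0 <= E * (x - y) ^+ 2 by rewrite mulr_ge0.
have : 0 <= E * (x * y) by rewrite !mulr_ge0.
have : 0 <= E * E by rewrite mulr_ge0.
nra.
Qed.

Lemma ratio_le (e X : R) : `|X / (X ^+ 2 + e ^+ 2)| <= `|X|^-1.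
Proof.
have [->|X0] := eqVneq X 0; first by rewrite mul0r normr0 invr0.
have D0 : 0 < X ^+ 2 + e ^+ 2 by rewrite ltr_wpDr ?sqr_ge0// exprn_even_gt0.
rewrite normrM normfV (gtr0_norm D0) ler_pdivrMr//.
rewrite -(real_normK (num_real X)) mulrDr expr2 mulKf ?normr_eq0// lerDl.
by rewrite mulr_ge0 ?sqr_ge0 ?invr_ge0.
Qed.

Lemma ratio_inv_le (e X : R) : 0 < X -> `|X / (X ^+ 2 + e ^+ 2) - X^-1| <= e ^+ 2 / X ^+ 3.
Proof.
move=> X0; have D0 : 0 < X ^+ 2 + e ^+ 2 by rewrite ltr_wpDr ?sqr_ge0// exprn_gt0.
have -> : X / (X ^+ 2 + e ^+ 2) - X^-1 = - (e ^+ 2 / (X * (X ^+ 2 + e ^+ 2))).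
  by field; rewrite !gt_eqF.
rewrite normrN ger0_norm; last by rewrite divr_ge0 ?sqr_ge0 ?mulr_ge0 ?(ltW X0) ?(ltW D0).
rewrite ler_wpM2l ?sqr_ge0// lef_pV2 ?posrE ?mulr_gt0 ?exprn_gt0//.
by rewrite exprS ler_wpM2l ?(ltW X0)// lerDl sqr_ge0.
Qed.

Lemma exp_sub1_le (p : R) : 0 <= p <= 2 -> `|1 - expR (1 - p)| <= expR 1 * `|p - 1|.
Proof.
move=> /andP[p0 p2].
have cE (u v : R) : {within `[u, v], continuous (@expR R)} by apply: continuous_subspaceT; exact: continuous_expR.
have dE (u v : R) : forall x, x \in `]u, v[%R -> is_derive x 1 (@expR R) (expR x) by move=> x _; exact: is_derive_expR.
have [p1|p1] := leP 0 (1 - p).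
  have [x] := MVT_segment p1 (dE _ _) (cE _ _); rewrite in_itv/= expR0 subr0 => /andP[_ xp] h.
  rewrite distrC h normrM distrC ger0_norm ?expR_ge0// ler_wpM2r// ler_expR; lra.
have [x] := MVT_segment (ltW p1) (dE _ _) (cE _ _); rewrite in_itv/= expR0 => /andP[_ xp] h.
rewrite h normrM sub0r opprB ger0_norm ?expR_ge0// ler_wpM2r// ler_expR; lra.
Qed.

End symbol.

(** * Large frequencies and the full decomposition *)

Section decomposition.
Context {R : realType}.
Notation mu := (@lebesgue_measure R).
Notation lt n := (@lebesgue_tuple R n).
Notation tup n := (n.-tuple (measurableTypeR R)).

Lemma integrable_add {d} {T : measurableType d} (nu : {measure set T -> \bar R}) (f g : T -> R) :
  nu.-integrable setT (EFin \o f) -> nu.-integrable setT (EFin \o g) ->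
  nu.-integrable setT (EFin \o (fun x => f x + g x)).
Proof. by move=> fi gi; exact: (integrableD measurableT fi gi). Qed.

Lemma integrable_sub {d} {T : measurableType d} (nu : {measure set T -> \bar R}) (f g : T -> R) :
  nu.-integrable setT (EFin \o f) -> nu.-integrable setT (EFin \o g) ->
  nu.-integrable setT (EFin \o (fun x => f x - g x)).
Proof. by move=> fi gi; exact: (integrableB measurableT fi gi). Qed.

Lemma measurable_expR_lin (c : R) : measurable_fun setT (fun s : R => expR (- (s * c))).
Proof.
apply: continuous_measurable => x; apply: continuous_comp; last exact: continuous_expR.
by apply: cvgN; apply: cvgMl; exact: cvg_id.
Qed.

Section bounded_kernel.
Variables (b C : R) (k : R -> R).
Hypothesis b0 : 0 < b.
Hypothesis mk : measurable_fun setT k.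
Hypothesis k_ge0 : forall s, 0 <= k s.
Hypothesis k_le : forall s, k s <= C * small_power b s.

Let ik : mu.-integrable setT (EFin \o (fun s => C * small_power b s)).
Proof. by apply: integrable_scale => //; exact: integrable_small_power. Qed.

Lemma integrable_bounded_laplace (p : R) : 0 <= p ->
  mu.-integrable setT (EFin \o (fun s => k s * expR (- (s * p)))).
Proof.
move=> p0; apply: integrable_le_norm ik => //.
  by apply: measurable_funM => //; exact: measurable_expR_lin.
move=> s _; rewrite ger0_norm ?mulr_ge0 ?expR_ge0//.
have [s0|s0] := leP s 0.
  have -> : k s = 0.
    apply/eqP; rewrite eq_le k_ge0 andbT (le_trans (k_le s))//.
    by rewrite /small_power small_part0// mulr0.
  by rewrite mul0r (le_trans (k_ge0 s)).
rewrite (le_trans _ (k_le s))// ler_piMr// -expR0 ler_expR oppr_le0 mulr_ge0//.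
exact: ltW.
Qed.

Lemma laplace_bounded (p : R) : 0 <= p -> 0 <= laplace k p <= \int[mu]_s (C * small_power b s).
Proof.
move=> p0; apply/andP; split.
  by apply: Rintegral_ge0 => s _; rewrite mulr_ge0 ?expR_ge0.
apply: le_Rintegral => //; first exact: integrable_bounded_laplace.
move=> s _; have [s0|s0] := leP s 0.
  have -> : k s = 0.
    apply/eqP; rewrite eq_le k_ge0 andbT (le_trans (k_le s))//.
    by rewrite /small_power small_part0// mulr0.
  by rewrite mul0r (le_trans (k_ge0 s)).
rewrite (le_trans _ (k_le s))// ler_piMr// -expR0 ler_expR oppr_le0 mulr_ge0//.
exact: ltW.
Qed.

End bounded_kernel.

Lemma laplace_power_kernel (b p : R) : 0 < b -> 0 < p ->
  laplace (power_kernel b) p = gammaR b * p `^ (- b).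
Proof.
move=> b0 p0; rewrite -[RHS](Rintegral_power_exp b0 p0); apply: eq_Rintegral => s _.
have -> : s * p = p * s by rewrite mulrC.
by [].
Qed.

(** The difference is the part s > 1 of the Laplace integral, where exp(-s p) <= exp(-p / 2) exp(-s
    p / 2). What remains is at most Gamma(b) (p / 2)^(-b), hence at most Gamma(b) for p >= 2. *)
Lemma small_power_tail (b p : R) : 0 < b -> 2 <= p ->
  `|p `^ (- b) - laplace (small_power b) p / gammaR b| <= expR (- (p / 2)).
Proof.
move=> b0 p2; have p0 : 0 < p by rewrite (lt_le_trans _ p2).
have p20 : 0 < p / 2 by rewrite divr_gt0.
have G0 := gammaR_gt0 b0.
have i1 : mu.-integrable setT (EFin \o (fun s => power_kernel b s * expR (- (s * p)))).
  by under [X in EFin \o X]eq_fun do rewrite mulrC -(mulrC p) mulrC; exact: integrable_power_exp.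
have i2 := @integrable_bounded_laplace b 1 (small_power b) b0 (@measurable_small_power R b)
  (@small_power_ge0 R b) (fun s => ltac:(by rewrite mul1r)) p (ltW p0).
have i3 := integrable_power_exp b0 p20.
have -> : p `^ (- b) - laplace (small_power b) p / gammaR b =
  (laplace (power_kernel b) p - laplace (small_power b) p) / gammaR b.
  by rewrite laplace_power_kernel//; field; rewrite gt_eqF.
rewrite /laplace -RintegralB// normrM normfV (gtr0_norm G0) ler_pdivrMr//.
have d0 s : 0 <= power_kernel b s * expR (- (s * p)) - small_power b s * expR (- (s * p)).
  by rewrite -mulrBl mulr_ge0 ?expR_ge0// subr_ge0 small_power_le_power.
rewrite ger0_norm; last by apply: Rintegral_ge0.
rewrite (@le_trans _ _ (\int[mu]_s (expR (- (p / 2)) * (power_kernel b s * expR (- (p / 2 * s))))))//.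
  apply: le_Rintegral => //; [exact: integrable_sub|exact: integrable_scale|] => s _.
  rewrite -mulrBl mulrCA -expRD; have [s1|s1] := leP s 1.
    have -> : power_kernel b s - small_power b s = 0.
      have [s0|s0] := leP s 0; first by rewrite power_kernel0// /small_power small_part0// subrr.
      by rewrite power_kernelE// /small_power small_partE// subrr.
    by rewrite mul0r mulr_ge0 ?expR_ge0 ?power_kernel_ge0.
  rewrite ler_pM ?expR_ge0 ?subr_ge0 ?small_power_le_power//.
    by rewrite lerBlDr lerDl small_power_ge0.
  by rewrite ler_expR; nra.
rewrite RintegralZl// Rintegral_power_exp// ler_wpM2l ?expR_ge0//.
rewrite ler_piMr ?(ltW G0)// powRN invf_le1 ?powR_gt0//.
rewrite -[leLHS](powRr0 (p / 2)) ler_powR ?(ltW b0)//; lra.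
Qed.

Lemma one_powR (a : R) : 1 `^ a = 1 :> R.
Proof. by rewrite powR1. Qed.

Lemma powR_gt1 (a p : R) : 0 < a -> 1 < p -> 1 < p `^ a.
Proof.
move=> a0 p1; rewrite -(one_powR a); apply: gt0_ltr_powR => //; rewrite nnegrE//.
by rewrite (le_trans ler01)// ltW.
Qed.

(** The finite geometric series of 1 / (p^a - 1) in powers of p^(-a). The sum starts at the second
    power since the first is the main term. *)
Lemma geometric_powR (a p : R) N : 0 < a -> 1 < p ->
  \sum_(i < N) p `^ (- (i.+2%:R * a)) =
  (p `^ a - 1)^-1 - p `^ (- a) - p `^ (- (N.+1%:R * a)) / (p `^ a - 1).
Proof.
move=> a0 p1; have p0 : 0 < p by rewrite (lt_trans _ p1).
have y1 := powR_gt1 a0 p1.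
have y0 : 0 < p `^ a - 1 by rewrite subr_gt0.
have y00 : 0 < p `^ a by rewrite powR_gt0.
elim: N => [|N IH].
  rewrite big_ord0 mul1r powRN; field; rewrite !gt_eqF//.
rewrite big_ord_recr/= IH.
have -> : p `^ (- (N.+1%:R * a)) = p `^ (- (N.+2%:R * a)) * p `^ a.
  rewrite -(@powRD _ p (- (N.+2%:R * a)) a) ?(gt_eqF p0) ?implybT//; congr (_ `^ _).
  by rewrite -[N.+2%:R]natr1; ring.
by field; rewrite gt_eqF.
Qed.

Lemma expR_half_le_powR (b : R) : 0 < b -> exists2 C : R, 0 <= C & forall p, 0 < p ->
  expR (- (p / 2)) <= C * p `^ (- b).
Proof.
move=> b0; exists ((b / 2^-1) `^ b); first exact: powR_ge0.
move=> p p0; have h0 : 0 < 2^-1 :> R by rewrite invr_gt0.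
have := powR_expRN_le b0 h0 p0; rewrite powRN [2^-1 * p]mulrC => h.
by rewrite ler_pdivlMr ?powR_gt0// mulrC.
Qed.

(** Each power is replaced by the Laplace transform of its truncated density, up to an exponentially
    small error. On ]0, 1] the densities of higher order are dominated by that of order 2 a, so one
    majorant serves for all terms. *)
Lemma geometric_kernel (a b : R) N : 0 < a -> 0 < b ->
  exists2 k : R -> R, [/\ measurable_fun setT k, forall s, 0 <= k s &
    exists2 C, 0 <= C & forall s, k s <= C * small_power (2 * a) s] &
  exists2 C : R, 0 <= C & forall p, 2 <= p ->
    `|\sum_(i < N) p `^ (- (i.+2%:R * a)) - laplace k p| <= C * p `^ (- b).
Proof.
move=> a0 b0; elim: N => [|N [k [mk k0 [C C0 kC]] [C' C'0 kp]]].
  exists (fun => 0); first split => //.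
    by exists 0 => // s; rewrite mul0r.
  exists 0 => // p p2; rewrite big_ord0 /laplace.
  under eq_Rintegral do rewrite mul0r.
  by rewrite /Rintegral integral0 subrr normr0 mul0r.
set c := N.+2%:R * a; have c0 : 0 < c by rewrite mulr_gt0.
have ac : 2 * a <= c by rewrite ler_wpM2r ?(ltW a0)// ler_nat.
have G0 := gammaR_gt0 c0.
have [D D0 hD] := expR_half_le_powR b0.
have a20 : 0 < 2 * a by rewrite mulr_gt0.
exists (fun s => k s + (gammaR c)^-1 * small_power c s).
  split.
  - by apply: measurable_funD => //; apply: measurable_funM => //; exact: measurable_small_power.
  - by move=> s; rewrite addr_ge0// mulr_ge0 ?small_power_ge0// invr_ge0 ltW.
  exists (C + (gammaR c)^-1); first by rewrite addr_ge0// invr_ge0 ltW.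
  move=> s; rewrite mulrDl lerD// ler_wpM2l ?invr_ge0 ?(ltW G0)//.
  exact: small_power_le.
exists (C' + D); first by rewrite addr_ge0.
move=> p p2; have p0 : 0 < p by rewrite (lt_le_trans _ p2).
have i1 := integrable_bounded_laplace a20 mk k0 kC (ltW p0).
have i2 := @integrable_bounded_laplace c 1 (small_power c) c0 (@measurable_small_power R c)
  (@small_power_ge0 R c) (fun s => ltac:(by rewrite mul1r)) p (ltW p0).
have -> : laplace (fun s => k s + (gammaR c)^-1 * small_power c s) p =
    laplace k p + laplace (small_power c) p / gammaR c.
  rewrite /laplace [X in _ = _ + X]mulrC -RintegralZl// -RintegralD//; last exact: integrable_scale.
  by apply: eq_Rintegral => s _; ring.
rewrite big_ord_recr/= -/c opprD addrACA (le_trans (ler_normD _ _))// mulrDl lerD ?kp//.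
by rewrite (le_trans (small_power_tail c0 p2))// hD.
Qed.

Lemma far_kernel (a b : R) : 0 < a -> 0 < b ->
  exists2 k : R -> R, [/\ measurable_fun setT k, forall s, 0 <= k s &
    exists2 C, 0 <= C & forall s, k s <= C * small_power (2 * a) s] &
  exists2 C : R, 0 <= C & forall p, 2 <= p ->
    `|(p `^ a - 1)^-1 - p `^ (- a) - laplace k p| <= C * p `^ (- b).
Proof.
(* Enough terms for the tail p^(-(N + 1) a) to decay at least like p^(-b). *)
move=> a0 b0; pose N := Num.trunc (b / a).
have Nb : b <= N.+1%:R * a.
  by rewrite -ler_pdivrMr// ltW// /N -natr1; have := truncnS_gt (b / a); rewrite -natr1.
have [k kP [C C0 kC]] := geometric_kernel N a0 b0.
exists k => //; have y2 : 0 < 2 `^ a - 1 :> R by rewrite subr_gt0 powR_gt1// ltr1n.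
exists (C + (2 `^ a - 1)^-1); first by rewrite addr_ge0// invr_ge0 ltW.
move=> p p2; have p1 : 1 < p by rewrite (lt_le_trans _ p2)// ltr1n.
have p0 : 0 < p by rewrite (lt_trans _ p1).
have -> : (p `^ a - 1)^-1 - p `^ (- a) = \sum_(i < N) p `^ (- (i.+2%:R * a)) + p `^ (- (N.+1%:R * a)) / (p `^ a - 1).
  by rewrite geometric_powR// subrK.
rewrite addrAC (le_trans (ler_normD _ _))// mulrDl lerD ?kC//.
have yp : 2 `^ a - 1 <= p `^ a - 1 by rewrite lerB// ge0_ler_powR ?nnegrE ?(ltW a0) ?(ltW p0).
have yp0 := lt_le_trans y2 yp.
rewrite ger0_norm ?divr_ge0 ?powR_ge0 ?(ltW yp0)// mulrC ler_pM ?invr_ge0 ?powR_ge0 ?(ltW yp0)//.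
  by rewrite lef_pV2.
by apply: ler_powR; [exact: ltW|rewrite lerN2].
Qed.

(** Equal to p^(-a) for p > 0, and already written as a Laplace transform for [radial_laplace]. *)
Definition riesz (a p : R) := laplace (power_kernel a) p / gammaR a.

Lemma rieszE (a p : R) : 0 < a -> 0 < p -> riesz a p = p `^ (- a).
Proof.
move=> a0 p0; rewrite /riesz laplace_power_kernel// mulrC mulKf// gt_eqF//.
exact: gammaR_gt0.
Qed.

Lemma riesz_ge0 (a p : R) : 0 < a -> 0 <= riesz a p.
Proof.
move=> a0; rewrite /riesz divr_ge0 ?(ltW (gammaR_gt0 a0))//.
by apply: Rintegral_ge0 => s _; rewrite mulr_ge0 ?power_kernel_ge0 ?expR_ge0.
Qed.

(** The model of the symbol at p = 1. Since p^a - 1 is close to a (p - 1), the width is e / a and a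
    factor 1 / a appears; [expR 1] normalizes the damping exp(-p) to 1 on the sphere. *)
Definition shell_part (a e p : R) : R := expR 1 / a * (expR (- p) * shell_re (e / a) (p - 1)).

Lemma shell_partE (a e p : R) : 0 < a -> 0 < e -> shell_part a e p =
  expR (1 - p) * (a * (p - 1) / ((a * (p - 1)) ^+ 2 + e ^+ 2)).
Proof.
move=> a0 e0; rewrite /shell_part /shell_re expRD.
have h : (p - 1) ^+ 2 + (e / a) ^+ 2 = ((a * (p - 1)) ^+ 2 + e ^+ 2) / a ^+ 2.
  by field; rewrite gt_eqF.
have : 0 < (a * (p - 1)) ^+ 2 + e ^+ 2 by rewrite ltr_wpDl ?sqr_ge0 ?exprn_gt0.
rewrite h; move: ((a * (p - 1)) ^+ 2 + e ^+ 2) => D D0.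
by field; rewrite !gt_eqF.
Qed.

Lemma norm_shell_part (a e p : R) : 0 < a -> 0 < e ->
  `|shell_part a e p| <= expR (1 - p) / (a * `|p - 1|).
Proof.
move=> a0 e0; rewrite shell_partE// normrM (ger0_norm (expR_ge0 _)) ler_wpM2l ?expR_ge0//.
by rewrite (le_trans (ratio_le _ _))// normrM (gtr0_norm a0).
Qed.

(** For p <= 1/2 both terms are bounded. Near 1, replacing p^a - 1 by a (p - 1) costs O((p - 1)^2)
    over a product of that size, and the damping costs O(|p - 1|) over |p - 1|; both are bounded
    uniformly in [e]. *)
Lemma symbol_re_near (a : R) : 0 < a -> exists2 K : R, 0 <= K & forall e p, 0 < e -> 0 <= p <= 2 ->
  `|symbol_re a e p - shell_part a e p| <= K.
Proof.
move=> a0; have h0 : 0 < 1 / 2 :> R by [].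
have hh : (1 / 2 : R) < 1 by lra.
have c10 : 0 < 1 - (1 / 2) `^ a.
  rewrite subr_gt0 -[ltRHS](one_powR a); apply: gt0_ltr_powR => //; rewrite nnegrE//; exact: ltW.
have [c c0 [C C0 lin]] := powR_linearization a0.
set c1 := 1 - _ in c10; set K1 := c1^-1 + expR 1 * 2 / a; set K2 := C / (c * a) + expR 1 / a.
have K10 : 0 <= K1 by rewrite addr_ge0 ?invr_ge0 ?divr_ge0 ?mulr_ge0 ?expR_ge0 ?(ltW c10) ?(ltW a0).
have K20 : 0 <= K2 by rewrite addr_ge0 ?divr_ge0 ?mulr_ge0 ?expR_ge0 ?(ltW c0) ?(ltW a0).
exists (K1 + K2); first exact: addr_ge0.
move=> e p e0 /andP[p0 p2]; have [ph|ph] := leP p (1 / 2).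
  rewrite (@le_trans _ _ K1)// ?lerDl// (le_trans (ler_normB _ _))// lerD//.
    rewrite (le_trans (ratio_le _ _))// lef_pV2 ?posrE//.
      by rewrite distrC (le_trans _ (ler_norm _))// lerB// ge0_ler_powR ?nnegrE ?(ltW a0).
    rewrite normr_gt0 subr_eq0 lt_eqF// -[ltRHS](one_powR a); apply: gt0_ltr_powR => //.
      by rewrite nnegrE.
    by rewrite (le_lt_trans ph).
  have d0 : 1 / 2 <= `|p - 1| by rewrite distrC (le_trans _ (ler_norm _))//; lra.
  rewrite (le_trans (norm_shell_part _ a0 e0))// -mulrA.
  rewrite ler_pM ?expR_ge0 ?invr_ge0 ?mulr_ge0 ?(ltW a0) ?ler_expR//; first by lra.
  rewrite invfM mulrC ler_wpM2r ?invr_ge0 ?(ltW a0)//.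
  rewrite [leRHS](_ : _ = (1 / 2)^-1); last by field.
  by rewrite lef_pV2 ?posrE// (lt_le_trans h0).
rewrite (@le_trans _ _ K2)// ?lerDr//.
have pI : 1 / 2 <= p <= 2 by rewrite (ltW ph).
(* At p = 1 both terms vanish; elsewhere the divisions below are legitimate. *)
have [->|p1] := eqVneq p 1.
  rewrite shell_partE// /symbol_re powR1 !subrr mulr0 !mul0r mulr0 subrr normr0//.
have p10 : 0 < `|p - 1| by rewrite normr_gt0 subr_eq0.
have [lo up] := lin p pI.
have X0 : 0 < `|p `^ a - 1| by rewrite (lt_le_trans _ lo)// mulr_gt0.
set Y := a * (p - 1); have YE : `|Y| = a * `|p - 1| by rewrite normrM gtr0_norm.
have Y0 : 0 < `|Y| by rewrite YE mulr_gt0.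
rewrite shell_partE// -/Y.
have -> : symbol_re a e p - expR (1 - p) * (Y / (Y ^+ 2 + e ^+ 2)) =
  (symbol_re a e p - Y / (Y ^+ 2 + e ^+ 2)) + (1 - expR (1 - p)) * (Y / (Y ^+ 2 + e ^+ 2)) by ring.
rewrite (le_trans (ler_normD _ _))// lerD//.
  rewrite (le_trans (ratio_diff_le _ _ _)) -?normr_gt0//.
  rewrite ler_pdivrMr ?mulr_gt0// (le_trans up)// YE.
  rewrite -(real_normK (num_real (p - 1))) expr2.
  have -> : C / (c * a) * (`|p `^ a - 1| * (a * `|p - 1|)) = C / c * (`|p `^ a - 1| * `|p - 1|).
    by field; rewrite !gt_eqF.
  rewrite -mulrA ler_wpM2l// mulrA ler_wpM2r//.
  by rewrite ler_pdivlMl.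
rewrite normrM (le_trans (ler_pM _ _ (exp_sub1_le _) (ratio_le _ _)))// ?YE ?p0//.
by rewrite invfM mulrACA mulfV ?gt_eqF// mulr1.
Qed.

(* The error is split by the distance to the shell [p = 1]: bounded near it, and
   at infinity controlled by the geometric series of [1 / (p^a - 1)]. *)
Lemma symbol_re_decomposition (a b : R) : 0 < a -> 0 < b ->
  exists2 k : R -> R, [/\ measurable_fun setT k, forall s, 0 <= k s &
    exists2 C, 0 <= C & forall s, k s <= C * small_power (2 * a) s] &
  exists2 C : R, 0 <= C & forall e p, 0 < e < 1 -> 0 <= p ->
    `|symbol_re a e p - riesz a p - laplace k p - shell_part a e p| <=
    C * (riesz a p * expR (- p) + (1 + p) `^ (- b)) + C * e.
Proof.
move=> a0 b0.
have [k [mk k0 [D D0 kD]] [C1 C10 far]] := far_kernel a0 b0.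
have [K K0 near] := symbol_re_near a0.
have [C2 C20 hC2] := expR_half_le_powR b0.
have a20 : 0 < 2 * a by rewrite mulr_gt0.
exists k; first by split => //; exists D.
set J := \int[mu]_s (D * small_power (2 * a) s).
have lJ p : 0 <= p -> `|laplace k p| <= J.
  by move=> p0; have /andP[l0 l1] := laplace_bounded a20 mk k0 kD p0; rewrite ger0_norm.
have J0 : 0 <= J by rewrite (le_trans _ (lJ 0 _)).
set X2 := 2 `^ a - 1 : R.
have X20 : 0 < X2 by rewrite subr_gt0 powR_gt1// ltr1n.
have P3 : 1 <= 3 `^ b :> R by rewrite -[leLHS](powRr0 3) ler_powR// ?ler1n// ltW.
(* The factors 3^b and 2^b convert bounded terms for p <= 2 and terms p^(-b) for p > 2 into
   multiples of (1 + p)^(-b). [expR 2] compensates the exp(-p) next to the Riesz term for p <= 2,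
   and the cube comes from [ratio_inv_le]. *)
pose L := 3 `^ b * (K + J) + 2 `^ b * C1 + (X2 ^+ 3)^-1 + 2 `^ b * (expR 1 / a * C2) + expR 2.
have L1 : 0 <= 3 `^ b * (K + J) by rewrite mulr_ge0 ?powR_ge0 ?addr_ge0.
have L2 : 0 <= 2 `^ b * C1 by rewrite mulr_ge0 ?powR_ge0.
have L3 : 0 <= (X2 ^+ 3)^-1 by rewrite invr_ge0 exprn_ge0// ltW.
have L4 : 0 <= 2 `^ b * (expR 1 / a * C2) by rewrite !mulr_ge0 ?powR_ge0 ?expR_ge0 ?invr_ge0 ?(ltW a0).
have L5 : 0 <= expR (2 : R) by exact: expR_ge0.
have L0 : 0 <= L by rewrite !addr_ge0.
have [La Lb Lc] : [/\ 3 `^ b * (K + J) <= L, (X2 ^+ 3)^-1 <= L & expR 2 <= L] by split; rewrite /L; lra.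
have Ld : 2 `^ b * C1 + 2 `^ b * (expR 1 / a * C2) <= L by rewrite /L; lra.
exists L => // e p /andP[e0 e1] p0.
have r0 := riesz_ge0 p a0.
have [p2|p2] := leP p 2.
  rewrite ler_wpDr ?mulr_ge0 ?(ltW e0)//.
  have -> : symbol_re a e p - riesz a p - laplace k p - shell_part a e p =
    (symbol_re a e p - shell_part a e p - laplace k p) - riesz a p by ring.
  rewrite (le_trans (ler_normB _ _))// mulrDr addrC lerD//.
    rewrite (ger0_norm r0) mulrCA -[leLHS]mulr1 ler_wpM2l//.
    rewrite (@le_trans _ _ (expR 2 * expR (- p)))//.
      by rewrite -expRD -[leLHS]expR0 ler_expR subr_ge0.
    by rewrite ler_wpM2r ?expR_ge0.
  rewrite (le_trans (ler_normB _ _))// (@le_trans _ _ (K + J))//.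
    by rewrite lerD ?lJ// near// p0.
  rewrite (@le_trans _ _ (3 `^ b * (K + J) * (1 + p) `^ (- b)))//.
    rewrite mulrAC ler_peMl ?addr_ge0// powRN ler_pdivlMr ?powR_gt0 ?ltr_wpDr// mul1r.
    by apply: ge0_ler_powR; rewrite ?nnegrE ?addr_ge0 ?(ltW b0)//; lra.
  by rewrite ler_wpM2r ?powR_ge0.
have pp : 0 < p by rewrite (lt_trans _ p2).
have pX : X2 <= p `^ a - 1.
  by rewrite lerB// ge0_ler_powR ?nnegrE ?(ltW a0) ?(ltW p2).
have X0 := lt_le_trans X20 pX.
have bp : p `^ (- b) <= 2 `^ b * (1 + p) `^ (- b).
  rewrite [(1 + p) `^ _]powRN ler_pdivlMr ?powR_gt0 ?addr_gt0// powRN mulrC ler_pdivrMr ?powR_gt0//.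
  rewrite -powRM ?(ltW pp)//; apply: ge0_ler_powR; rewrite ?nnegrE ?addr_ge0 ?mulr_ge0 ?(ltW b0) ?(ltW pp)//; lra.
have -> : symbol_re a e p - riesz a p - laplace k p - shell_part a e p =
    ((symbol_re a e p - (p `^ a - 1)^-1) + ((p `^ a - 1)^-1 - p `^ (- a) - laplace k p)) - shell_part a e p.
  by rewrite rieszE//; ring.
rewrite (le_trans (ler_normB _ _))// (le_trans (lerD (ler_normD _ _) (lexx _)))//.
have h1 : `|symbol_re a e p - (p `^ a - 1)^-1| <= L * e.
  rewrite (le_trans (ratio_inv_le _ X0))// (@le_trans _ _ ((X2 ^+ 3)^-1 * e))//.
    rewrite mulrC ler_pM ?invr_ge0 ?exprn_ge0 ?(ltW e0) ?(ltW X0)//.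
      by rewrite lef_pV2 ?posrE ?exprn_gt0// lerXn2r ?nnegrE ?(ltW X0) ?(ltW X20).
    by rewrite expr2 ler_piMl ?(ltW e0) ?(ltW e1).
  by rewrite ler_wpM2r ?(ltW e0).
have h2 : `|(p `^ a - 1)^-1 - p `^ (- a) - laplace k p| <= 2 `^ b * C1 * (1 + p) `^ (- b).
  by rewrite (le_trans (far p (ltW p2)))// mulrAC [leRHS]mulrC ler_wpM2l.
have h3 : `|shell_part a e p| <= 2 `^ b * (expR 1 / a * C2) * (1 + p) `^ (- b).
  rewrite (le_trans (norm_shell_part _ a0 e0))//.
  rewrite (@le_trans _ _ (expR 1 / a * expR (- (p / 2))))//.
    have d1 : 1 <= `|p - 1| by rewrite (le_trans _ (ler_norm _))//; lra.
    rewrite expRD -!mulrA ler_wpM2l ?expR_ge0// mulrC ler_pM ?expR_ge0 ?invr_ge0 ?mulr_ge0 ?(ltW a0)//.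
      by rewrite lef_pV2 ?posrE ?mulr_gt0 ?(lt_le_trans _ d1)// ler_peMr// ltW.
    by rewrite ler_expR; lra.
  rewrite [leRHS](_ : _ = expR 1 / a * (C2 * (2 `^ b * (1 + p) `^ (- b)))); last by ring.
  rewrite ler_wpM2l ?divr_ge0 ?expR_ge0 ?(ltW a0)//.
  by rewrite (le_trans (hC2 p pp))// ler_wpM2l.
rewrite (le_trans (lerD (lerD h1 h2) h3))//.
rewrite -addrA addrC lerD2r -mulrDl mulrDr.
apply: ler_wpDl; first exact: (mulr_ge0 L0 (mulr_ge0 r0 (expR_ge0 _))).
by rewrite ler_wpM2r ?powR_ge0.
Qed.

End decomposition.

(** * Uniform bounds and limits *)

Section radial_bounds.
Context {R : realType}.
Notation mu := (@lebesgue_measure R).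
Notation lt n := (@lebesgue_tuple R n).
Notation tup n := (n.-tuple (measurableTypeR R)).

Lemma measurable_symbol_re (a e : R) : 0 < e -> measurable_fun setT (symbol_re a e).
Proof.
move=> e0; apply: (measurableT_comp (measurable_shell_re e0)); apply: measurable_funB => //; exact: measurable_powR.
Qed.

Lemma measurable_symbol_im (a e : R) : 0 < e -> measurable_fun setT (symbol_im a e).
Proof.
move=> e0; apply: (measurableT_comp (measurable_shell_im e0)); apply: measurable_funB => //; exact: measurable_powR.
Qed.

Lemma norm_symbol_re_le (a e p : R) : 0 < e -> `|symbol_re a e p| <= e^-1.
Proof. exact: norm_shell_re_le. Qed.

Lemma norm_symbol_im_le (a e p : R) : 0 < e -> `|symbol_im a e p| <= e^-1.
Proof. exact: norm_shell_im_le. Qed.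

(** Symbols matter for p >= 0 only; composing with [|p|] gives the continuity on the whole line that
    [radial_transform] asks for. *)
Lemma powR_norm_cont (a : R) : 0 < a -> continuous (fun p : R => `|p| `^ a).
Proof.
move=> a0 x; have [->|x0] := eqVneq x 0; last first.
  apply: (@continuous_comp _ _ _ (fun p : R => `|p|) (@powR R ^~ a)); first exact: norm_continuous.
  by apply: powR_cont; rewrite normr_gt0.
rewrite /continuous_at normr0 powR0 ?gt_eqF//; apply/cvgrPdist_lt => e e0.
near=> y; rewrite sub0r normrN ger0_norm ?powR_ge0//.
rewrite -[ltRHS]powRr1 ?(ltW e0)// -(mulVf (lt0r_neq0 a0)) powRrM.
apply: gt0_ltr_powR => //; rewrite ?nnegrE ?powR_ge0//.
near: y; have d0 : 0 < e `^ a^-1 by rewrite powR_gt0.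
by have := @nbhs0_lt R R^o _ d0; apply.
Unshelve. all: by end_near. Qed.

Lemma symbol_re_cont (a e : R) : 0 < a -> 0 < e -> continuous (fun p : R => symbol_re a e `|p|).
Proof.
move=> a0 e0 x; apply: (@continuous_comp _ _ _ (fun p : R => `|p| `^ a - 1) (shell_re e)).
  by apply: cvgB; [exact: powR_norm_cont|exact: cvg_cst].
exact: shell_re_cont.
Qed.

Lemma symbol_im_cont (a e : R) : 0 < a -> 0 < e -> continuous (fun p : R => symbol_im a e `|p|).
Proof.
move=> a0 e0 x; apply: (@continuous_comp _ _ _ (fun p : R => `|p| `^ a - 1) (shell_im e)).
  by apply: cvgB; [exact: powR_norm_cont|exact: cvg_cst].
exact: shell_im_cont.
Qed.

(** [G] is the integrable part of the majorant, while the constant [D] is integrable only against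
    the Gaussian. The Gaussian mass stays explicit because [D] will be O(e) and vanish as e -> 0 at
    fixed [t]. *)
Lemma radial_norm_le n (phi : R -> R) (G : tup n -> R) (D t : R) (v : 'I_n -> R) (th : R) :
  0 < t -> measurable_fun setT phi -> (lt n).-integrable setT (EFin \o G) ->
  (forall z, `|phi (sqn z)| * expR (- (t * sqn z)) <= G z + D * expR (- (t * sqn z))) ->
  `|radial phi t v th| <= \int[lt n]_z G z + D * \int[lt n]_z expR (- (t * sqn z)).
Proof.
move=> t0 mphi iG phiG.
have ie : (lt n).-integrable setT (EFin \o (fun z : tup n => expR (- (t * sqn z)))) := integrable_gauss_sqn n t0.
have ih := integrable_add iG (integrable_scale D measurableT ie).
have fh (z : tup n) : `|phi (sqn z) * (expR (- (t * sqn z)) * cos (lin v z + th))| <= G z + D * expR (- (t * sqn z)).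
  exact: le_trans (norm_radial _ _ _ _ _) (phiG z).
have mf := @measurable_radial R n phi t v th mphi.
have iF := integrable_le_norm measurableT mf (fun z _ => fh z) ih.
rewrite /radial (le_trans (le_normr_Rintegral measurableT iF))//.
rewrite (le_trans (le_Rintegral measurableT _ ih (fun z _ => fh z)))//; first exact: integrable_norm.
by rewrite RintegralD//; [rewrite RintegralZl|exact: integrable_scale].
Qed.

Lemma radial_sub n (phi psi : R -> R) (t : R) (v : 'I_n -> R) (th : R) :
  (lt n).-integrable setT (EFin \o (fun z : tup n => phi (sqn z) * (expR (- (t * sqn z)) * cos (lin v z + th)))) ->
  (lt n).-integrable setT (EFin \o (fun z : tup n => psi (sqn z) * (expR (- (t * sqn z)) * cos (lin v z + th)))) ->
  radial (fun p => phi p - psi p) t v th = radial phi t v th - radial psi t v th /\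
  (lt n).-integrable setT (EFin \o (fun z : tup n => (phi (sqn z) - psi (sqn z)) * (expR (- (t * sqn z)) * cos (lin v z + th)))).
Proof.
move=> i1 i2; split.
  by rewrite /radial -RintegralB//; apply: eq_Rintegral => z _; rewrite mulrBl.
have := integrable_sub i1 i2; congr (_.-integrable _ _).
by apply/funext => z /=; rewrite mulrBl.
Qed.

Lemma radialZ n (c : R) (phi : R -> R) (t : R) (v : 'I_n -> R) (th : R) :
  (lt n).-integrable setT (EFin \o (fun z : tup n => phi (sqn z) * (expR (- (t * sqn z)) * cos (lin v z + th)))) ->
  radial (fun p => c * phi p) t v th = c * radial phi t v th /\
  (lt n).-integrable setT (EFin \o (fun z : tup n => c * phi (sqn z) * (expR (- (t * sqn z)) * cos (lin v z + th)))).
Proof.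
move=> i1; split.
  by rewrite /radial -RintegralZl//; apply: eq_Rintegral => z _; rewrite -mulrA.
have := integrable_scale c measurableT i1; congr (_.-integrable _ _).
by apply/funext => z /=; rewrite mulrA.
Qed.

Section fixed_order.
Variables (n : nat) (a : R).
Hypothesis a0 : 0 < a.
Hypothesis an : a < n%:R / 2.

Let pk0 s : s <= 0 -> power_kernel a s = 0 :> R. Proof. exact: power_kernel0. Qed.

Let ipk t : 0 < t -> mu.-integrable setT (EFin \o (fun s => power_kernel a s * gauss_kernel n 0 (s + t))).
Proof.
by move=> t0; apply: (integrable_kernel_gauss_t a0 an) => //; [exact: measurable_power_kernel|exact: power_kernel_ge0].
Qed.

Lemma integrable_radial_riesz (t : R) (v : 'I_n -> R) (th : R) : 0 < t ->
  (lt n).-integrable setT (EFin \o (fun z : tup n => riesz a (sqn z) * (expR (- (t * sqn z)) * cos (lin v z + th)))).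
Proof.
move=> t0; have := integrable_radial_laplace (@measurable_power_kernel R a) (@power_kernel_ge0 R a) pk0 (ltW t0) (ipk t0) v th.
move=> /(integrable_scale (gammaR a)^-1 measurableT); congr (_.-integrable _ _).
by apply/funext => z /=; rewrite /riesz; congr EFin; ring.
Qed.

Lemma radial_riesz (t : R) (v : 'I_n -> R) (th : R) : 0 < t ->
  radial (riesz a) t v th = (gammaR a)^-1 * (cos th * \int[mu]_s (power_kernel a s * gauss_kernel n (\sum_i v i ^+ 2) (s + t))).
Proof.
move=> t0.
rewrite -(radial_laplace (@measurable_power_kernel R a) (@power_kernel_ge0 R a) pk0 (ltW t0) (ipk t0)).
have i1 := integrable_radial_laplace (@measurable_power_kernel R a) (@power_kernel_ge0 R a) pk0 (ltW t0) (ipk t0) v th.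
have [<- _] := radialZ (gammaR a)^-1 i1.
by rewrite /riesz; apply: eq_Rintegral => z _; congr (_ * _); rewrite mulrC.
Qed.

Section high_kernel.
Variables (k : R -> R) (C : R).
Hypothesis mk : measurable_fun setT k.
Hypothesis k_ge0 : forall s, 0 <= k s.
Hypothesis k_le : forall s, k s <= C * small_power (2 * a) s.

Let k0 s : s <= 0 -> k s = 0.
Proof.
move=> s0; apply/eqP; rewrite eq_le k_ge0 andbT (le_trans (k_le s))//.
by rewrite /small_power small_part0// mulr0.
Qed.

Let spk s : small_power (2 * a) s <= power_kernel a s.
Proof. by rewrite (le_trans (small_power_le _ (_ : a <= 2 * a))) ?small_power_le_power//; have := a0; lra. Qed.

Let isp (q t : R) : 0 <= q -> 0 < t ->
  mu.-integrable setT (EFin \o (fun s => C * (small_power (2 * a) s * gauss_kernel n q (s + t)))).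
Proof.
move=> q0 t0; apply: integrable_scale => //; apply: (integrable_kernel_gauss_t a0 an) => //.
  exact: measurable_small_power.
exact: small_power_ge0.
Qed.

Let ik (q t : R) : 0 <= q -> 0 < t -> mu.-integrable setT (EFin \o (fun s => k s * gauss_kernel n q (s + t))).
Proof.
move=> q0 t0; apply: integrable_le_norm (isp q0 t0) => //.
  by apply: measurable_funM => //; exact: measurable_gauss_kernel.
move=> s _; have g0 := gauss_kernel_ge0 n q (s + t); have kg := mulr_ge0 (k_ge0 s) g0.
by rewrite (ger0_norm kg) mulrA ler_wpM2r.
Qed.

Lemma integrable_radial_high (t : R) (v : 'I_n -> R) (th : R) : 0 < t ->
  (lt n).-integrable setT (EFin \o (fun z : tup n => laplace k (sqn z) * (expR (- (t * sqn z)) * cos (lin v z + th)))).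
Proof. by move=> t0; exact: (integrable_radial_laplace mk k_ge0 k0 (ltW t0) (ik (lexx 0) t0)). Qed.

Lemma radial_high_le (t : R) (v : 'I_n -> R) : 0 < t ->
  `|radial (laplace k) t v 0| <= C * \int[mu]_s (small_power (2 * a) s * gauss_kernel n (\sum_i v i ^+ 2) (s + t)).
Proof.
move=> t0; rewrite (radial_laplace mk k_ge0 k0 (ltW t0) (ik (lexx 0) t0)) cos0 mul1r.
have q0 : 0 <= \sum_i v i ^+ 2 by apply: sumr_ge0 => i _; exact: sqr_ge0.
have sp : mu.-integrable setT (EFin \o (fun s => small_power (2 * a) s * gauss_kernel n (\sum_i v i ^+ 2) (s + t))).
  apply: (integrable_kernel_gauss_t a0 an) => //; first exact: measurable_small_power.
  exact: small_power_ge0.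
rewrite ger0_norm; last by apply: Rintegral_ge0 => s _; rewrite mulr_ge0 ?gauss_kernel_ge0.
rewrite -RintegralZl//; apply: le_Rintegral => //; [exact: ik|exact: isp|] => s _.
by rewrite mulrA ler_wpM2r ?gauss_kernel_ge0.
Qed.

End high_kernel.
End fixed_order.

Lemma lin0 n (z : tup n) : lin (fun=> 0 : R) z = 0.
Proof. by rewrite /lin big1// => i _; rewrite mulr0. Qed.

Lemma lin_axis0 n (z : tup n.+1) : lin (@axis R n.+1 0) z = 0.
Proof. by rewrite /lin big1// => i _; rewrite /axis; case: ifP => _; rewrite mulr0. Qed.

Lemma sqr_shell_im_le (c d X Y : R) : 0 < c -> 0 < d -> c * `|Y| <= `|X| ->
  d / (X ^+ 2 + d ^+ 2) <= c^-1 * shell_im (d / c) Y.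
Proof.
move=> c0 d0 h; have D0 : 0 < c ^+ 2 * Y ^+ 2 + d ^+ 2.
  by apply: ltr_wpDl; [rewrite mulr_ge0 ?sqr_ge0|rewrite exprn_gt0].
have -> : c^-1 * shell_im (d / c) Y = d / (c ^+ 2 * Y ^+ 2 + d ^+ 2).
  rewrite /shell_im; have -> : Y ^+ 2 + (d / c) ^+ 2 = (c ^+ 2 * Y ^+ 2 + d ^+ 2) / c ^+ 2.
    by field; rewrite gt_eqF.
  by move: (c ^+ 2 * _ + _) D0 => D D0; field; rewrite !gt_eqF.
have DX : 0 < X ^+ 2 + d ^+ 2 by apply: ltr_wpDl; rewrite ?sqr_ge0 ?exprn_gt0.
rewrite ler_wpM2l ?(ltW d0)// lef_pV2 ?posrE// lerD2r.
rewrite -(real_normK (num_real X)) -(real_normK (num_real Y)) -exprMn.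
by rewrite lerXn2r ?nnegrE ?mulr_ge0 ?(ltW c0).
Qed.

Lemma measurable_exp_shift (f : R -> R) : measurable_fun setT f ->
  measurable_fun setT (fun p : R => expR (- p) * f (p - 1)).
Proof.
move=> mf; apply: measurable_funM; first by apply: measurableT_comp.
by apply: (measurableT_comp mf); exact: measurable_funB.
Qed.

(** The imaginary part is positive and involves no cancellation: the lower bound on |p^a - 1|
    majorizes it by a shell up to p = 2, and beyond that it is O(e). *)
Lemma symbol_im_bound (a : R) : 0 < a -> exists2 c : R, 0 < c & exists2 C : R, 0 <= C &
  forall e p, 0 < e -> 0 <= p -> `|symbol_im a e p| <= C * (expR (- p) * shell_im (e / c) (p - 1)) + C * e.
Proof.
move=> a0; have [c c0 [C _ lin]] := powR_linearization a0.
have h0 : 0 < 1 / 2 :> R by [].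
have c10 : 0 < 1 - (1 / 2) `^ a.
  rewrite subr_gt0 -[ltRHS](one_powR a); apply: gt0_ltr_powR => //; rewrite ?nnegrE//; lra.
(* [c] bounds |p^a - 1| / |p - 1| from below on [1/2, 2]; for p <= 1/2 the bound is [c1], because
   there |p^a - 1| >= c1 and |p - 1| <= 1. *)
set c1 := 1 - _ in c10; set d := Num.min c c1.
have d0 : 0 < d by rewrite lt_min c0.
have X20 : 0 < 2 `^ a - 1 :> R by rewrite subr_gt0 powR_gt1// ltr1n.
set X2 := _ - 1 in X20.
have A1 : 0 <= expR 2 / d by rewrite divr_ge0 ?expR_ge0// ltW.
have A2 : 0 <= (X2 ^+ 2)^-1 by rewrite invr_ge0 sqr_ge0.
exists d => //; exists (expR 2 / d + (X2 ^+ 2)^-1); first exact: addr_ge0.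
move=> e p e0 p0; have s0 (Y g : R) : 0 < g -> 0 <= shell_im g Y.
  by move=> g0; rewrite divr_ge0 ?(ltW g0)// addr_ge0 ?sqr_ge0.
have ed0 : 0 < e / d by rewrite divr_gt0.
rewrite ger0_norm ?s0//; have [p2|p2] := leP p 2.
  apply: ler_wpDr; first by rewrite mulr_ge0 ?addr_ge0// ltW.
  have h : d * `|p - 1| <= `|p `^ a - 1|.
    have [ph|ph] := leP p (1 / 2).
      rewrite (@le_trans _ _ c1)//.
        rewrite (@le_trans _ _ (c1 * `|p - 1|))//; first by rewrite ler_wpM2r// ge_min lexx orbT.
        by rewrite ler_piMr ?(ltW c10)// ler_norml; lra.
      by rewrite distrC (le_trans _ (ler_norm _))// lerB// ge0_ler_powR ?nnegrE ?(ltW a0).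
    have [lo _] := lin p ltac:(by rewrite (ltW ph)).
    by rewrite (le_trans _ lo)// ler_wpM2r// ge_min lexx.
  rewrite /symbol_im (le_trans (sqr_shell_im_le d0 e0 h))//.
  rewrite mulrA ler_wpM2r ?s0//.
  rewrite (@le_trans _ _ (expR 2 / d * expR (- p)))//; last by rewrite ler_wpM2r ?expR_ge0// lerDl.
  rewrite mulrAC ler_peMl ?invr_ge0 ?(ltW d0)// -expRD -[leLHS]expR0 ler_expR subr_ge0//.
apply: ler_wpDl; first exact: (mulr_ge0 (addr_ge0 A1 A2) (mulr_ge0 (expR_ge0 _) (s0 _ _ ed0))).
have pX : X2 <= p `^ a - 1 by rewrite lerB// ge0_ler_powR ?nnegrE ?(ltW a0) ?(ltW p2).
have X0 := lt_le_trans X20 pX.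
rewrite (@le_trans _ _ ((X2 ^+ 2)^-1 * e))//; last by rewrite ler_wpM2r ?(ltW e0)// lerDr.
rewrite /symbol_im mulrC ler_wpM2r ?(ltW e0)// lef_pV2 ?posrE ?ltr_wpDl ?sqr_ge0 ?exprn_gt0//.
by rewrite ler_wpDr ?sqr_ge0// lerXn2r ?nnegrE ?(ltW X0) ?(ltW X20).
Qed.

Lemma radial_symbol_im_bound n (a : R) : 0 < a -> exists2 M : R, 0 <= M & forall t r e, 0 < t -> 0 < e ->
  `|radial (symbol_im a e) t (@axis R n.+1 r) 0| <=
  M + M * e * \int[lt n.+1]_z expR (- (t * sqn z)).
Proof.
move=> a0; have [c c0 [C C0 hC]] := symbol_im_bound a0.
have [S S0 hS] := @shell_radial_bound R n.
exists (C * S + C); first by rewrite addr_ge0 ?mulr_ge0.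
move=> t r e t0 e0; have ec0 : 0 < e / c by rewrite divr_gt0.
pose psi p := expR (- p) * shell_im (e / c) (p - 1).
have mpsi : measurable_fun setT psi.
  by apply: measurable_exp_shift; exact: measurable_shell_im.
have psi_le p : 0 <= p -> `|psi p| <= (e / c)^-1.
  move=> p0; rewrite normrM (ger0_norm (expR_ge0 _)) (le_trans _ (norm_shell_im_le (p - 1) ec0))//.
  by rewrite ler_piMl// -expR0 ler_expR oppr_le0.
have i1 := integrable_radial (@axis R n.+1 0) 0 t0 mpsi psi_le.
have [e1 i2] := radialZ C i1.
have J0 : 0 <= \int[lt n.+1]_z expR (- (t * sqn z)).
  by apply: Rintegral_ge0 => z _; exact: expR_ge0.
have := @radial_norm_le n.+1 (symbol_im a e) _ (C * e) t (@axis R n.+1 r) 0 t0 (@measurable_symbol_im a e e0) i2.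
move=> /(_ _) h; rewrite (le_trans (h _))//.
  move=> z; rewrite lin_axis0 addr0 cos0 mulr1 -mulrDl ler_wpM2r ?expR_ge0//.
  by apply: hC => //; exact: sqn_ge0.
(* The mass of the positive majorant is its radial integral at r = 0, so the uniform shell bound
   applies to it. *)
rewrite [X in X + _](_ : _ = C * radial psi t (@axis R n.+1 0) 0); last by rewrite -e1.
have [_ h2] := hS t 0 (e / c) t0 ec0.
rewrite lerD//.
  rewrite (@le_trans _ _ (C * S))//; last by rewrite lerDl.
  by rewrite ler_wpM2l// (le_trans (ler_norm _)).
by rewrite ler_wpM2r// ler_wpM2r ?(ltW e0)// lerDr mulr_ge0.
Qed.

(** The case t = 0, v = 0 of [integrable_radial_laplace] for the density s^(b - 1) exp(-s):
    integrating the frequency out leaves s^(b - n/2 - 1) exp(-s), integrable because b > n/2. *)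
Lemma integrable_one_plus n (b : R) : n%:R / 2 < b -> 0 < b ->
  (lt n).-integrable setT (EFin \o (fun z : tup n => (1 + sqn z) `^ (- b))).
Proof.
move=> nb b0; pose k (s : R) := power_kernel b s * expR (- (1 * s)).
have mk : measurable_fun setT k by exact: measurable_power_exp.
have k0 s : 0 <= k s by exact: power_exp_ge0.
have k00 s : s <= 0 -> k s = 0 by move=> s0; rewrite /k power_kernel0// mul0r.
have c0 : 0 < b - n%:R / 2 by rewrite subr_gt0.
have ik : mu.-integrable setT (EFin \o (fun s => k s * gauss_kernel n 0 (s + 0))).
  have := integrable_scale (pi `^ (n%:R / 2)) measurableT (integrable_power_exp c0 ltr01).
  congr (_.-integrable _ _); apply/funext => s /=; congr EFin.
  rewrite addr0 /k; have [s0|s0] := leP s 0; first by rewrite !power_kernel0// !mul0r mulr0.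
  rewrite gauss_kernel0 !power_kernelE//.
  have -> : b - n%:R / 2 - 1 = (b - 1) + - (n%:R / 2) by ring.
  rewrite (@powRD _ s (b - 1) (- (n%:R / 2))) ?(gt_eqF s0) ?implybT//; ring.
have G0 := gammaR_gt0 b0.
have := integrable_radial_laplace mk k0 k00 (lexx 0) ik (fun=> 0) 0.
move=> /(integrable_scale (gammaR b)^-1 measurableT); congr (_.-integrable _ _).
apply/funext => z /=; congr EFin; rewrite lin0 addr0 cos0 mul0r oppr0 expR0 !mulr1.
have q0 : 0 < 1 + sqn z by rewrite ltr_wpDr// sqn_ge0.
have -> : laplace k (sqn z) = gammaR b * (1 + sqn z) `^ (- b).
  rewrite -(Rintegral_power_exp b0 q0); apply: eq_Rintegral => s _.
  by rewrite /k -mulrA -expRD; congr (_ * expR _); ring.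
by rewrite mulKf// gt_eqF.
Qed.

Lemma radial_symbol_re_bound n (a : R) : 0 < a -> a < n.+1%:R / 2 ->
  exists2 k : R -> R, [/\ measurable_fun setT k, forall s, 0 <= k s &
    exists2 C, 0 <= C & forall s, k s <= C * small_power (2 * a) s] &
  exists2 M : R, 0 <= M & forall t r e, 0 < t -> 0 < e < 1 ->
  `|radial (symbol_re a e) t (@axis R n.+1 r) 0 - radial (riesz a) t (@axis R n.+1 r) 0
    - radial (laplace k) t (@axis R n.+1 r) 0| <=
  M + M * e * \int[lt n.+1]_z expR (- (t * sqn z)).
Proof.
(* An exponent above half the dimension, so that (1 + |xi|^2)^(-b) is integrable. *)
move=> a0 an; pose b : R := n.+1%:R / 2 + 1.
have b0 : 0 < b by rewrite addr_gt0// divr_gt0.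
have [k [mk k0 [D D0 kD]] [C C0 hC]] := symbol_re_decomposition a0 b0.
have [S S0 hS] := @shell_radial_bound R n.
exists k; first by split => //; exists D.
have iG : (lt n.+1).-integrable setT (EFin \o (fun z : tup n.+1 =>
    C * (riesz a (sqn z) * expR (- sqn z) + (1 + sqn z) `^ (- b)))).
  apply: integrable_scale => //; apply: integrable_add; last by apply: integrable_one_plus => //; rewrite /b ltrDl.
  (* riesz(p) exp(-p) is the radial Riesz integrand at t = 1 and v = 0. *)
  have := integrable_radial_riesz a0 an (fun=> 0) 0 ltr01; congr (_.-integrable _ _).
  by apply/funext => z /=; rewrite lin0 addr0 cos0 mulr1 mul1r.
set I := \int[lt n.+1]_z (C * (riesz a (sqn z) * expR (- sqn z) + (1 + sqn z) `^ (- b))).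
have I0 : 0 <= I.
  by apply: Rintegral_ge0 => z _; rewrite mulr_ge0// addr_ge0 ?powR_ge0// mulr_ge0 ?riesz_ge0 ?expR_ge0.
have ea : 0 <= expR 1 / a by rewrite divr_ge0 ?expR_ge0// ltW.
exists (I + expR 1 / a * S + C); first by rewrite !addr_ge0// mulr_ge0.
move=> t r e t0 /andP[e0 e1]; set v := @axis R n.+1 r.
have ea0 : 0 < e / a by rewrite divr_gt0.
pose psi p := expR (- p) * shell_re (e / a) (p - 1).
have mpsi : measurable_fun setT psi.
  by apply: measurable_exp_shift; exact: measurable_shell_re.
have psi_le p : 0 <= p -> `|psi p| <= (e / a)^-1.
  move=> p0; rewrite normrM (ger0_norm (expR_ge0 _)) (le_trans _ (norm_shell_re_le (p - 1) ea0))//.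
  by rewrite ler_piMl// -expR0 ler_expR oppr_le0.
have iS := integrable_radial v 0 t0 mpsi psi_le.
have [eS iS'] := radialZ (expR 1 / a) iS.
have iA := integrable_radial v 0 t0 (@measurable_symbol_re a e e0) (fun p _ => norm_symbol_re_le a p e0).
have iR := integrable_radial_riesz a0 an v 0 t0.
have iL := integrable_radial_high a0 an mk k0 kD v 0 t0.
have [E1 i1] := radial_sub iA iR; rewrite -E1.
have [E2 i2] := @radial_sub n.+1 (fun p => symbol_re a e p - riesz a p) (laplace k) t v 0 i1 iL; rewrite -E2.
have [E3 i3] := @radial_sub n.+1 (fun p => symbol_re a e p - riesz a p - laplace k p) (fun p => expR 1 / a * psi p) t v 0 i2 iS'.
have J0 : 0 <= \int[lt n.+1]_z expR (- (t * sqn z)).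
  by apply: Rintegral_ge0 => z _; exact: expR_ge0.
have mphi : measurable_fun setT (fun p => symbol_re a e p - riesz a p - laplace k p - expR 1 / a * psi p).
  apply: measurable_funB; last exact: measurable_funM.
  apply: measurable_funB; last exact: measurable_laplace.
  apply: measurable_funB; first exact: measurable_symbol_re.
  apply: measurable_funM => //; apply: measurable_laplace; first exact: measurable_power_kernel.
  exact: power_kernel_ge0.
have h3 := @radial_norm_le n.+1 _ _ (C * e) t v 0 t0 mphi iG.
have h4 : `|expR 1 / a * radial psi t v 0| <= expR 1 / a * S.
  by have [h _] := hS t r (e / a) t0 ea0; rewrite normrM (ger0_norm ea) ler_wpM2l.
rewrite -[X in `|X|](subrK (radial (fun p => expR 1 / a * psi p) t v 0)) -E3.
rewrite (le_trans (ler_normD _ _))// eS (le_trans (lerD (h3 _) h4))//.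
  move=> z; have q0 := sqn_ge0 z; rewrite (le_trans (ler_wpM2r (expR_ge0 _) (hC e _ _ q0)))//.
    by rewrite e0.
  rewrite mulrDl lerD2r ler_piMr//.
    by rewrite mulr_ge0// addr_ge0 ?powR_ge0// mulr_ge0 ?riesz_ge0 ?expR_ge0.
  by rewrite -[leRHS]expR0 ler_expR oppr_le0 mulr_ge0// ltW.
rewrite -/I addrAC lerD//; first by rewrite lerDl.
by rewrite ler_wpM2r// ler_wpM2r ?(ltW e0)// lerDr addr_ge0// mulr_ge0.
Qed.

(** The Fourier transform of |xi|^(-2 a) at distance 1 from the origin, without the factor (2
    pi)^(-n). *)
Definition riesz_const n (a : R) : R :=
  (gammaR a)^-1 * \int[mu]_s (power_kernel a s * gauss_kernel n 1 s).

(** At fixed [u i] the mass term disappears as e -> 0. What remains is [M], independent of [i], so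
    it survives the second limit. The limits are data here; a kernel will supply them. *)
Lemma iterated_limit_im n (a : R) : 0 < a -> exists2 M : R, 0 <= M & forall (r : R) (u L : nat -> R) (Q : R),
  (forall i, 0 < u i) ->
  (forall i, radial (symbol_im a e) (u i) (@axis R n.+1 r) 0 @[e --> 0^'+] --> L i) ->
  L i @[i --> \oo] --> Q -> `|Q| <= M.
Proof.
move=> a0; have [M M0 hM] := radial_symbol_im_bound n a0.
exists M => // r u L Q u0 cL cQ.
have hL i : `|L i| <= M.
  have h : M + M * e * \int[lt n.+1]_z expR (- (u i * sqn z)) @[e --> 0^'+] --> M.
    rewrite -[X in _ --> X]addr0; apply: cvgD; first exact: cvg_cst.
    rewrite -[X in _ --> X](mul0r (\int[lt n.+1]_z expR (- (u i * sqn z)))); apply: cvgMl.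
    rewrite -[X in _ --> X](mulr0 M); apply: cvgMr; exact: (cvg_at_right_filter cvg_id).
  apply: (ler_cvg_to (cvg_norm (cL i)) h).
  by near=> e; apply: hM.
by apply: (ler_cvg_to (cvg_norm cQ) (cvg_cst M)); apply: nearW.
Unshelve. all: by end_near. Qed.

(** After e -> 0 the distance from [L i] to the Gaussian-regularized Riesz term [T i] is at most M +
    [U i]. As i grows, [T i] tends to the main term and [U i] to a multiple of [high_part]. *)
Lemma iterated_limit_re n (a : R) : 0 < a -> a < n.+1%:R / 2 ->
  exists2 M : R, 0 <= M & forall (r : R) (u L : nat -> R) (Q : R),
  0 < r -> (forall i, 0 < u i) -> u i @[i --> \oo] --> (0 : R) ->
  (forall i, radial (symbol_re a e) (u i) (@axis R n.+1 r) 0 @[e --> 0^'+] --> L i) ->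
  L i @[i --> \oo] --> Q ->
  `|Q - riesz_const n.+1 a * r `^ (2 * a - n.+1%:R)| <= M * error_bound n.+1 a r.
Proof.
move=> a0 an; have [k [mk k0 [D D0 kD]] [M M0 hM]] := radial_symbol_re_bound a0 an.
have [H H0 hH] := high_part_bound n.+1 a0.
exists (M + D * H); first by rewrite addr_ge0 ?mulr_ge0.
move=> r u L Q r0 u0 ucvg cL cQ; set v := @axis R n.+1 r.
have r20 : 0 < r ^+ 2 by rewrite exprn_gt0.
pose T i := radial (riesz a) (u i) v 0.
pose U i := D * \int[mu]_s (small_power (2 * a) s * gauss_kernel n.+1 (r ^+ 2) (s + u i)).
have hL i : `|L i - T i| <= M + U i.
  have h : (M + M * e * \int[lt n.+1]_z expR (- (u i * sqn z))) + U i @[e --> 0^'+] --> M + U i.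
    apply: cvgD; last exact: cvg_cst.
    rewrite -[X in _ --> X]addr0; apply: cvgD; first exact: cvg_cst.
    rewrite -[X in _ --> X](mul0r (\int[lt n.+1]_z expR (- (u i * sqn z)))); apply: cvgMl.
    rewrite -[X in _ --> X](mulr0 M); apply: cvgMr; exact: (cvg_at_right_filter cvg_id).
  have hd : radial (symbol_re a e) (u i) v 0 - T i @[e --> 0^'+] --> L i - T i.
    by apply: cvgB; [exact: cL|exact: cvg_cst].
  apply: (ler_cvg_to (cvg_norm hd) h).
  near=> e; have e01 : 0 < e < 1 by apply/andP; split.
  have := radial_high_le a0 an mk k0 kD v (u0 i).
  rewrite (sum_axis n r) -/(U i) => hU.
  rewrite -[X in `|X|](subrK (radial (laplace k) (u i) v 0)).
  by rewrite (le_trans (ler_normD _ _))// lerD// hM.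
have sp s : small_power (2 * a) s <= power_kernel a s.
  by rewrite (le_trans (small_power_le _ (_ : a <= 2 * a))) ?small_power_le_power//; lra.
have cT : T i @[i --> \oo] --> riesz_const n.+1 a * r `^ (2 * a - n.+1%:R).
  have -> : riesz_const n.+1 a * r `^ (2 * a - n.+1%:R) =
      (gammaR a)^-1 * \int[mu]_s (power_kernel a s * gauss_kernel n.+1 (r ^+ 2) s).
    rewrite power_kernel_gauss_scale// /riesz_const -[r ^+ 2]powR_mulrn ?(ltW r0)// -powRrM.
    have -> : 2 * (a - n.+1%:R / 2) = 2 * a - n.+1%:R by field.
    ring.
  rewrite /T; under eq_fun do rewrite radial_riesz// cos0 mul1r (sum_axis n r).
  apply: cvgMr; apply: (kernel_gauss_cvg a0 an) => //; first exact: measurable_power_kernel.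
  exact: power_kernel_ge0.
have cU : M + U i @[i --> \oo] --> M + D * high_part n.+1 a (r ^+ 2).
  apply: cvgD; first exact: cvg_cst.
  apply: cvgMr; apply: (kernel_gauss_cvg a0 an) => //; first exact: measurable_small_power.
  exact: small_power_ge0.
apply: (le_trans (ler_cvg_to (cvg_norm (cvgB cQ cT)) cU _)); first by apply: nearW => i; exact: hL.
rewrite mulrDl lerD//; first by rewrite ler_peMr// error_bound_ge1.
by rewrite -mulrA ler_wpM2l// hH.
Unshelve. all: by end_near. Qed.

End radial_bounds.

(** * Reduction to unit frequency and to the first axis *)

Section frequency_scaling.
Context {R : realType}.
Notation mu := (@lebesgue_measure R).
Notation lt n := (@lebesgue_tuple R n).
Notation tup n := (n.-tuple (measurableTypeR R)).

Lemma cvg_right_scale (c : R) (F : R -> R) (l : R) : 0 < c ->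
  F e @[e --> 0^'+] --> l -> F (c * e) @[e --> 0^'+] --> l.
Proof.
move=> c0 Fl; apply: (cvg_comp (fun e : R => c * e) F _ Fl) => P [d /= d0 Pd].
exists (d / c); first by rewrite /= divr_gt0.
move=> x /= xd x0; apply: Pd => /=; last by rewrite mulr_gt0.
move: xd; rewrite !sub0r !normrN normrM (gtr0_norm c0) => xd.
by rewrite mulrC -ltr_pdivlMr.
Qed.

Lemma shell_re_scale (s e x : R) : 0 < s -> 0 < e ->
  shell_re e (s * x) = s^-1 * shell_re (e / s) x.
Proof.
move=> s0 e0; rewrite /shell_re.
have -> : x ^+ 2 + (e / s) ^+ 2 = ((s * x) ^+ 2 + e ^+ 2) / s ^+ 2 by field; rewrite gt_eqF.
have : 0 < (s * x) ^+ 2 + e ^+ 2 by rewrite ltr_wpDl ?sqr_ge0 ?exprn_gt0.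
by move: (_ + _) => D D0; field; rewrite !gt_eqF.
Qed.

Lemma shell_im_scale (s e x : R) : 0 < s -> 0 < e ->
  shell_im e (s * x) = s^-1 * shell_im (e / s) x.
Proof.
move=> s0 e0; rewrite /shell_im.
have -> : x ^+ 2 + (e / s) ^+ 2 = ((s * x) ^+ 2 + e ^+ 2) / s ^+ 2 by field; rewrite gt_eqF.
have : 0 < (s * x) ^+ 2 + e ^+ 2 by rewrite ltr_wpDl ?sqr_ge0 ?exprn_gt0.
by move: (_ + _) => D D0; field; rewrite !gt_eqF.
Qed.

Variables (a lam : R).
Hypothesis a0 : 0 < a.
Hypothesis lam0 : 0 < lam.

Let s0 : 0 < lam `^ (2 * a). Proof. by rewrite powR_gt0. Qed.

Lemma powR_freq (p : R) : 0 <= p ->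
  p `^ a - lam `^ (2 * a) = lam `^ (2 * a) * (((lam ^+ 2)^-1 * p) `^ a - 1).
Proof.
move=> p0; have -> : lam `^ (2 * a) = (lam ^+ 2) `^ a by rewrite -powR_mulrn ?(ltW lam0)// -powRrM.
rewrite mulrBr mulr1; congr (_ - _).
have l20 : 0 < lam ^+ 2 by rewrite exprn_gt0.
rewrite -(powRM _ (ltW l20)); last by rewrite mulr_ge0// invr_ge0 ltW.
by rewrite mulVKf// gt_eqF.
Qed.

(** [radial_transform] with c = lam^(-2): the Jacobian gives lam^n, the homogeneity of the symbol
    gives lam^(-2 a), and the Gaussian parameter becomes lam^2 t. Any vector of length [r] can be
    replaced by the axis. *)
Lemma radial_frequency n (phi psi : R -> R) (M t r : R) (v : 'I_n.+1 -> R) (th : R) :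
  0 < t -> continuous (fun p : R => phi `|p|) -> (forall p, 0 <= p -> `|phi p| <= M) ->
  (forall p, 0 <= p -> psi p = (lam `^ (2 * a))^-1 * phi ((lam ^+ 2)^-1 * p)) ->
  \sum_i v i ^+ 2 = r ^+ 2 ->
  radial psi t v th =
  cos th * (lam `^ (n.+1%:R - 2 * a) * radial phi (lam ^+ 2 * t) (@axis R n.+1 (lam * r)) 0).
Proof.
move=> t0 cphi phiM psiE vr; have l20 : 0 < lam ^+ 2 by rewrite exprn_gt0.
have c0 : 0 < (lam ^+ 2)^-1 by rewrite invr_gt0.
have lt0 : 0 < lam ^+ 2 * t by rewrite mulr_gt0.
have vw : \sum_i v i ^+ 2 = (lam ^+ 2)^-1 * \sum_i @axis R n.+1 (lam * r) i ^+ 2.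
  by rewrite (sum_axis n (lam * r)) exprMn mulKf// gt_eqF.
have := radial_transform th c0 lt0 cphi phiM vw.
rewrite mulKf ?gt_eqF// => h.
have -> : radial psi t v th = (lam `^ (2 * a))^-1 * radial (fun p => phi ((lam ^+ 2)^-1 * p)) t v th.
  have mphi : measurable_fun setT (fun p => phi `|(lam ^+ 2)^-1 * p|).
    apply: continuous_measurable => x.
    apply: (@continuous_comp _ _ _ (fun p => (lam ^+ 2)^-1 * p) (fun p => phi `|p|)); last exact: cphi.
    by apply: cvgMr; exact: cvg_id.
  have i1 := @integrable_radial R n.+1 (fun p => phi `|(lam ^+ 2)^-1 * p|) M t v th t0 mphi
    (fun p _ => phiM _ (normr_ge0 _)).
  have [e1 _] := @radialZ R n.+1 (lam `^ (2 * a))^-1 (fun p => phi `|(lam ^+ 2)^-1 * p|) t v th i1.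
  have pos (z : tup n.+1) : 0 <= (lam ^+ 2)^-1 * sqn z by rewrite mulr_ge0 ?sqn_ge0// ltW.
  rewrite [X in _ = _ * X](_ : _ = radial (fun p => phi `|(lam ^+ 2)^-1 * p|) t v th); last first.
    by apply: eq_Rintegral => z _; rewrite (ger0_norm (pos z)).
  rewrite -e1; apply: eq_Rintegral => z _; rewrite psiE ?sqn_ge0//.
  by rewrite (ger0_norm (pos z)).
rewrite h; have -> : (Num.sqrt (lam ^+ 2)^-1) ^- n.+1 = lam `^ n.+1%:R.
  by rewrite sqrtrV ?sqr_ge0// sqrtr_sqr (gtr0_norm lam0) exprVn invrK powR_mulrn// ltW.
have -> : lam `^ (n.+1%:R - 2 * a) = lam `^ n.+1%:R * (lam `^ (2 * a))^-1.
  by rewrite -powRN -(@powRD _ lam n.+1%:R) // (gt_eqF lam0) implybT.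
ring.
Qed.

Lemma radial_freq_re n (e t r : R) (v : 'I_n.+1 -> R) (th : R) : 0 < e -> 0 < t ->
  \sum_i v i ^+ 2 = r ^+ 2 ->
  radial (fun p => shell_re e (p `^ a - lam `^ (2 * a))) t v th =
  cos th * (lam `^ (n.+1%:R - 2 * a) *
    radial (symbol_re a (e / lam `^ (2 * a))) (lam ^+ 2 * t) (@axis R n.+1 (lam * r)) 0).
Proof.
move=> e0 t0 vr; have es0 : 0 < e / lam `^ (2 * a) by rewrite divr_gt0.
apply: (@radial_frequency n (symbol_re a (e / lam `^ (2 * a))) _ (e / lam `^ (2 * a))^-1) => //.
- exact: symbol_re_cont.
- by move=> p _; exact: norm_symbol_re_le.
- by move=> p p0; rewrite powR_freq// shell_re_scale.
Qed.

Lemma radial_freq_im n (e t r : R) (v : 'I_n.+1 -> R) (th : R) : 0 < e -> 0 < t ->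
  \sum_i v i ^+ 2 = r ^+ 2 ->
  radial (fun p => shell_im e (p `^ a - lam `^ (2 * a))) t v th =
  cos th * (lam `^ (n.+1%:R - 2 * a) *
    radial (symbol_im a (e / lam `^ (2 * a))) (lam ^+ 2 * t) (@axis R n.+1 (lam * r)) 0).
Proof.
move=> e0 t0 vr; have es0 : 0 < e / lam `^ (2 * a) by rewrite divr_gt0.
apply: (@radial_frequency n (symbol_im a (e / lam `^ (2 * a))) _ (e / lam `^ (2 * a))^-1) => //.
- exact: symbol_im_cont.
- by move=> p _; exact: norm_symbol_im_le.
- by move=> p p0; rewrite powR_freq// shell_im_scale.
Qed.

Lemma cvg_freq n (F G : R -> R) (l : R) :
  (forall e, 0 < e -> F e = lam `^ (n.+1%:R - 2 * a) * G (e / lam `^ (2 * a))) ->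
  F e @[e --> 0^'+] --> l -> G e @[e --> 0^'+] --> (lam `^ (n.+1%:R - 2 * a))^-1 * l.
Proof.
move=> FG /(cvg_right_scale s0) h.
have k0 : 0 < lam `^ (n.+1%:R - 2 * a) by rewrite powR_gt0.
have : (lam `^ (n.+1%:R - 2 * a))^-1 * F (lam `^ (2 * a) * e) @[e --> 0^'+] --> (lam `^ (n.+1%:R - 2 * a))^-1 * l.
  by apply: cvgMr.
apply: cvg_trans; apply: near_eq_cvg; near=> e.
have e0 : 0 < e by [].
by rewrite FG ?mulr_gt0// mulKf ?gt_eqF// [_ * e]mulrC mulfK// gt_eqF.
Unshelve. all: by end_near. Qed.

End frequency_scaling.

Section frequency_limits.
Context {R : realType}.

Lemma frequency_limit_im n (a : R) : 0 < a -> exists2 M : R, 0 <= M &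
  forall (lam r : R) (v : 'I_n.+1 -> R) (u L : nat -> R) (Q : R),
  0 < lam -> 0 < r -> \sum_i v i ^+ 2 = r ^+ 2 -> (forall i, 0 < u i) ->
  (forall i, radial (fun p => shell_im e (p `^ a - lam `^ (2 * a))) (u i) v 0 @[e --> 0^'+] --> L i) ->
  L i @[i --> \oo] --> Q ->
  `|Q| <= M * lam `^ (n.+1%:R - 2 * a).
Proof.
move=> a0; have [M M0 hM] := iterated_limit_im n a0; exists M => //.
move=> lam r v u L Q lam0 r0 vr u0 cL cQ; set k := lam `^ (n.+1%:R - 2 * a).
have k0 : 0 < k by rewrite powR_gt0.
suff : `|k^-1 * Q| <= M by rewrite normrM normfV (gtr0_norm k0) ler_pdivrMl// mulrC.
apply: (hM (lam * r) (fun i => lam ^+ 2 * u i) (fun i => k^-1 * L i)).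
- by move=> i; rewrite mulr_gt0// exprn_gt0.
- move=> i; apply: (cvg_freq lam0 _ (cL i)) => e e0.
  by rewrite (radial_freq_im a0 lam0 0 e0 (u0 i) vr) cos0 mul1r.
- exact: cvgMr.
Qed.

Lemma frequency_limit_re n (a : R) : 0 < a -> a < n.+1%:R / 2 -> exists2 M : R, 0 <= M &
  forall (lam r : R) (v : 'I_n.+1 -> R) (u L : nat -> R) (Q : R),
  0 < lam -> 0 < r -> \sum_i v i ^+ 2 = r ^+ 2 -> (forall i, 0 < u i) -> u i @[i --> \oo] --> (0 : R) ->
  (forall i, radial (fun p => shell_re e (p `^ a - lam `^ (2 * a))) (u i) v 0 @[e --> 0^'+] --> L i) ->
  L i @[i --> \oo] --> Q ->
  `|Q - riesz_const n.+1 a * r `^ (2 * a - n.+1%:R)| <= M * (lam `^ (n.+1%:R - 2 * a) * error_bound n.+1 a (lam * r)).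
Proof.
move=> a0 an; have [M M0 hM] := iterated_limit_re a0 an; exists M => //.
move=> lam r v u L Q lam0 r0 vr u0 ucvg cL cQ; set k := lam `^ (n.+1%:R - 2 * a).
have k0 : 0 < k by rewrite powR_gt0.
suff : `|k^-1 * Q - riesz_const n.+1 a * (lam * r) `^ (2 * a - n.+1%:R)| <= M * error_bound n.+1 a (lam * r).
  rewrite powRM ?(ltW lam0) ?(ltW r0)//.
  have -> : lam `^ (2 * a - n.+1%:R) = k^-1 by rewrite /k -powRN opprB.
  by rewrite mulrCA -mulrBr normrM normfV (gtr0_norm k0) ler_pdivrMl// mulrCA.
apply: (hM (lam * r) (fun i => lam ^+ 2 * u i) (fun i => k^-1 * L i)).
- exact: mulr_gt0.
- by move=> i; rewrite mulr_gt0// exprn_gt0.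
- by rewrite -[X in _ --> X](mulr0 (lam ^+ 2)); apply: cvgMr.
- move=> i; apply: (cvg_freq lam0 _ (cL i)) => e e0.
  by rewrite (radial_freq_re a0 lam0 0 e0 (u0 i) vr) cos0 mul1r.
- exact: cvgMr.
Qed.

End frequency_limits.

(** * Gaussians as test functions *)

Section gaussian_schwartz.
Context {R : realType} {n : nat}.
Notation V := ('rV[R]_n).

Lemma is_derive_line (f : V -> R) (x v : V) (d : R) :
  is_derive (0 : R) 1 (fun h : R => f (h *: v + x)) d -> is_derive x v f d.
Proof.
have E : (fun h : R => h^-1 *: (((fun h : R => f (h *: v + x)) \o shift 0) (h *: 1) - f (0 *: v + x))) =
         (fun h : R => h^-1 *: ((f \o shift x) (h *: v) - f x)).
  by apply/funext => h /=; rewrite /shift/= addr0 scale0r add0r [h%:A]mulr1.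
move=> [dg vg]; apply: DeriveDef.
  by move: dg; rewrite /derivable E.
by move: vg; rewrite /derive E.
Qed.

(** The polynomial functions, given inductively: stability under partial derivatives and polynomial
    growth, each by induction, are all that the Schwartz estimates require. *)
Inductive poly_fun : (V -> R) -> Prop :=
| poly_const c : poly_fun (fun=> c)
| poly_coord i : poly_fun (fun x => x 0 i)
| poly_add f g : poly_fun f -> poly_fun g -> poly_fun (fun x => f x + g x)
| poly_mul f g : poly_fun f -> poly_fun g -> poly_fun (fun x => f x * g x).

Lemma poly_fun_derive f (i : 'I_n) : poly_fun f ->
  exists2 g, poly_fun g & forall x, is_derive x (delta_mx 0 i) f (g x).
Proof.
elim => [c|j|f1 f2 p1 [g1 q1 h1] p2 [g2 q2 h2]|f1 f2 p1 [g1 q1 h1] p2 [g2 q2 h2]].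
- by exists (fun=> 0) => [|x]; [exact: poly_const|exact: is_derive_cst].
- exists (fun=> (i == j)%:R); first exact: poly_const.
  move=> x; apply: is_derive_line.
  rewrite (_ : (fun _ => _) = (fun h : R => (i == j)%:R * h + x 0 j)); last first.
    by apply/funext => h; rewrite !mxE eqxx/= mulrC eq_sym.
  by apply: is_derive_eq; rewrite /GRing.scale/=; ring.
- exists (fun x => g1 x + g2 x); first exact: poly_add.
  by move=> x; exact: (is_deriveD (h1 x) (h2 x)).
exists (fun x => f1 x * g2 x + f2 x * g1 x); first by apply: poly_add; exact: poly_mul.
by move=> x; exact: (is_deriveM (h1 x) (h2 x)).
Qed.

Definition gaussian (c : R) (y x : V) : R := expR (- (c * dot (x - y) (x - y))).

Lemma is_derive_gaussian c y x (i : 'I_n) :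
  is_derive x (delta_mx 0 i) (gaussian c y) ((- 2 * c * (x 0 i - y 0 i)) * gaussian c y x).
Proof.
apply: is_derive_line; set S := dot (x - y) (x - y); set d := x 0 i - y 0 i.
have -> : (fun h : R => gaussian c y (h *: delta_mx 0 i + x)) = (fun h : R => expR (- (c * (S + 2 * h * d + h * h)))).
  apply/funext => h; rewrite /gaussian; congr (expR (- (c * _))); rewrite /S /d /dot.
  rewrite (bigD1 i)//= [in RHS](bigD1 i)//= !mxE !eqxx/=.
  rewrite (eq_bigr (fun j => (x - y) 0 j * (x - y) 0 j)); last first.
    by move=> j ji; rewrite !mxE (negbTE ji) andbF mulr0 add0r.
  ring.
have q0 : is_derive (0 : R) 1 (fun h : R => - (c * (S + 2 * h * d + h * h))) (- 2 * c * d).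
  by apply: is_derive_eq; rewrite /GRing.scale/=; ring.
have := is_derive1_comp (is_derive_expR _) q0 => h.
apply: (is_derive_eq h); rewrite /gaussian -/S !mulr0 !mul0r !addr0; ring.
Qed.

Lemma partials_gaussian c y P (s : seq 'I_n) : poly_fun P -> exists2 Q, poly_fun Q &
  partials s (fun x => P x * gaussian c y x) = (fun x => Q x * gaussian c y x).
Proof.
move=> pP; elim: s => [|i s [Q pQ e]]; first by exists P.
have [Q' pQ' hQ] := poly_fun_derive i pQ.
exists (fun x => Q' x + Q x * (- 2 * c * (x 0 i + - y 0 i))).
  apply: poly_add => //; apply: poly_mul => //; apply: poly_mul; first exact: poly_const.
  by apply: poly_add; [exact: poly_coord|exact: poly_const].
rewrite /= e; apply/funext => x.
have := is_deriveM (hQ x) (is_derive_gaussian c y x i) => -[_ ->].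
rewrite /GRing.scale/=; ring.
Qed.

Lemma dot_ge0 (x : V) : 0 <= dot x x.
Proof. by apply: sumr_ge0 => i _; rewrite -expr2 sqr_ge0. Qed.

Lemma coord_le_enorm (x : V) i : `|x 0 i| <= enorm x.
Proof.
rewrite -sqrtr_sqr ler_wsqrtr// /dot (bigD1 i)//= expr2 lerDl.
by apply: sumr_ge0 => j _; rewrite -expr2 sqr_ge0.
Qed.

Lemma poly_fun_bound f : poly_fun f -> exists2 C : R, 0 <= C & exists m : nat, forall x,
  `|f x| <= C * (1 + enorm x) ^+ m.
Proof.
have e1 (x : V) : 1 <= 1 + enorm x by rewrite lerDl sqrtr_ge0.
elim => [c|j|f1 f2 p1 [C1 C10 [m1 h1]] p2 [C2 C20 [m2 h2]]|f1 f2 p1 [C1 C10 [m1 h1]] p2 [C2 C20 [m2 h2]]].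
- by exists `|c| => //; exists 0%N => x; rewrite expr0 mulr1.
- exists 1 => //; exists 1%N => x; rewrite expr1 mul1r (le_trans (coord_le_enorm _ _))//.
  by rewrite lerDr.
- exists (C1 + C2); first exact: addr_ge0.
  exists (m1 + m2)%N => x; rewrite (le_trans (ler_normD _ _))// mulrDl exprD lerD//.
    by rewrite (le_trans (h1 x))// ler_wpM2l// ler_peMr ?exprn_ge0 ?exprn_ege1// (le_trans ler01).
  by rewrite (le_trans (h2 x))// ler_wpM2l// ler_peMl ?exprn_ge0 ?exprn_ege1// (le_trans ler01).
exists (C1 * C2); first exact: mulr_ge0.
exists (m1 + m2)%N => x; rewrite normrM exprD mulrACA.
by rewrite ler_pM.
Qed.

Lemma gaussian_decay c y N : 0 < c -> exists M : R, forall x,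
  (1 + enorm x) ^+ N * gaussian c y x <= M.
Proof.
move=> c0; have c20 : 0 < c / 2 by rewrite divr_gt0.
(* From 1 + s <= 2 (1 + s^2) and |x - y|^2 >= |x|^2 / 2 - |y|^2, which halves the rate; the extra c
   / 2 completes the exponent to (c / 2) (1 + s^2). *)
exists (2 ^+ N * (expR (c * dot y y + c / 2) * (N.+1%:R / (c / 2)) `^ N.+1%:R)) => x.
set s := enorm x; have s2 : s ^+ 2 = dot x x by rewrite sqr_sqrtr ?dot_ge0.
have s0 : 0 <= s by exact: sqrtr_ge0.
have u0 : 0 < 1 + s ^+ 2 by rewrite ltr_wpDr ?sqr_ge0.
have h1 : (1 + s) ^+ N <= 2 ^+ N * (1 + s ^+ 2) ^+ N.+1.
  rewrite (@le_trans _ _ ((2 * (1 + s ^+ 2)) ^+ N))//.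
    rewrite lerXn2r ?nnegrE ?addr_ge0 ?mulr_ge0 ?(ltW u0)//.
    have := sqr_ge0 (s - 1); have := sqr_ge0 s; rewrite sqrrB1; lra.
  rewrite exprMn ler_wpM2l ?exprn_ge0// [leRHS]exprSr ler_peMr ?exprn_ge0 ?(ltW u0)//.
  by rewrite lerDl sqr_ge0.
have h2 : gaussian c y x <= expR (c * dot y y + c / 2) * expR (- (c / 2 * (1 + s ^+ 2))).
  rewrite -expRD ler_expR s2.
  have : dot x x / 2 - dot y y <= dot (x - y) (x - y).
    rewrite -subr_ge0 /dot mulr_suml -!sumrB; apply: sumr_ge0 => i _; rewrite !mxE.
    have := sqr_ge0 (x 0 i - 2 * y 0 i); lra.
  rewrite -(ler_pM2l c0); lra.
rewrite (le_trans (ler_pM _ _ h1 h2)) ?exprn_ge0 ?expR_ge0 ?addr_ge0//.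
set E := expR (_ + _); set G := expR _; set u := _ ^+ N.+1.
have -> : 2 ^+ N * u * (E * G) = 2 ^+ N * (E * (u * G)) by ring.
rewrite ler_wpM2l ?exprn_ge0// ler_wpM2l ?expR_ge0// /u.
by rewrite -(powR_mulrn N.+1 (ltW u0)) powR_expRN_le// ltr0n.
Qed.

Lemma schwartzR_gaussian c y k : 0 < c -> schwartzR (fun x : V => k * gaussian c y x).
Proof.
move=> c0 s; have [Q pQ ->] := partials_gaussian c y s (poly_const k); split.
  move=> i x; have [Q' _ hQ] := poly_fun_derive i pQ.
  by have := is_deriveM (hQ x) (is_derive_gaussian c y x i) => -[].
move=> N; have [C C0 [m hm]] := poly_fun_bound pQ.
have [M hM] := gaussian_decay y (N + m) c0.
exists (C * M) => x; rewrite normrM [X in _ * (_ * X)]ger0_norm ?expR_ge0//.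
have e0 : 0 <= 1 + enorm x by rewrite addr_ge0// sqrtr_ge0.
rewrite (@le_trans _ _ ((1 + enorm x) ^+ N * (C * (1 + enorm x) ^+ m * gaussian c y x)))//.
  by rewrite ler_wpM2l ?exprn_ge0// ler_wpM2r ?expR_ge0.
have -> : (1 + enorm x) ^+ N * (C * (1 + enorm x) ^+ m * gaussian c y x) =
  C * ((1 + enorm x) ^+ (N + m) * gaussian c y x) by rewrite exprD; ring.
by rewrite ler_wpM2l.
Qed.

Lemma schwartzR0 : schwartzR (fun _ : V => 0).
Proof.
have -> : (fun _ : V => 0 : R) = (fun x : V => 0 * gaussian 1 0 x) by apply/funext => x; rewrite mul0r.
exact: schwartzR_gaussian.
Qed.

End gaussian_schwartz.

Local Open Scope complex_scope.

(** * Explicit resolvents of Gaussians *)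

Section gaussian_resolvent.
Context {R : realType} {n : nat}.
Notation mu := (@lebesgue_measure R).
Notation lt n := (@lebesgue_tuple R n).
Notation tup n := (n.-tuple (measurableTypeR R)).
Notation V := ('rV[R]_n).

Lemma dot_vec (x : V) (z : tup n) : dot x (vec_of_tuple z) = lin (x 0) z.
Proof. by apply: eq_bigr => i _; rewrite mxE mulrC. Qed.

Lemma dot_vecvec (z : tup n) : dot (vec_of_tuple z) (vec_of_tuple z) = sqn z.
Proof. by apply: eq_bigr => i _; rewrite mxE expr2. Qed.

Lemma enorm_powR (a : R) (x : V) : enorm x `^ (2 * a) = (dot x x) `^ a.
Proof.
by rewrite /enorm -powR12_sqrt ?dot_ge0// -powRrM mulrA mulVf ?mul1r// pnatr_eq0.
Qed.

Lemma lin_sub (x y : V) (z : tup n) : lin ((x - y) 0) z = lin (x 0) z - lin (y 0) z.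
Proof. by rewrite /lin -sumrB; apply: eq_bigr => i _; rewrite !mxE mulrBr. Qed.

Definition bounded_measurable (phi : R -> R) :=
  measurable_fun setT phi /\ exists M, forall p, 0 <= p -> `|phi p| <= M.

Lemma bounded_measurable_cst c : bounded_measurable (fun=> c).
Proof. by split => //; exists `|c|. Qed.

Lemma bounded_measurable_re (a l e : R) : 0 < e ->
  bounded_measurable (fun p => shell_re e (p `^ a - l)).
Proof.
move=> e0; split; last by exists e^-1 => p _; exact: norm_shell_re_le.
by apply: (measurableT_comp (measurable_shell_re e0)); apply: measurable_funB => //; exact: measurable_powR.
Qed.

Lemma bounded_measurable_im (a l e : R) : 0 < e ->
  bounded_measurable (fun p => shell_im e (p `^ a - l)).
Proof.
move=> e0; split; last by exists e^-1 => p _; exact: norm_shell_im_le.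
by apply: (measurableT_comp (measurable_shell_im e0)); apply: measurable_funB => //; exact: measurable_powR.
Qed.

Lemma integrable_radial_bm (phi : R -> R) (t : R) (v : 'I_n -> R) (th : R) : 0 < t -> bounded_measurable phi ->
  (lt n).-integrable setT (EFin \o (fun z : tup n => phi (sqn z) * (expR (- (t * sqn z)) * cos (lin v z + th)))).
Proof. by move=> t0 [mphi [M hM]]; exact: integrable_radial hM. Qed.

Lemma radial_comb (phi psi : R -> R) (c d t : R) (v : 'I_n -> R) (th : R) : 0 < t ->
  bounded_measurable phi -> bounded_measurable psi ->
  radial (fun p => c * phi p + d * psi p) t v th = c * radial phi t v th + d * radial psi t v th.
Proof.
move=> t0 bphi bpsi; have i1 := integrable_radial_bm v th t0 bphi; have i2 := integrable_radial_bm v th t0 bpsi.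
rewrite /radial -!RintegralZl// -RintegralD//; try exact: integrable_scale.
by apply: eq_Rintegral => z _; ring.
Qed.

(* [exp(-t|xi|^2 - i y.xi)] times a radial symbol; its inverse Fourier transform at [x]
   only involves radial integrals in the direction [x - y]. *)
Definition gauss_symbol (t : R) (phi psi : R -> R) (y xi : V) : R[i] :=
  (expR (- (t * dot xi xi)))%:C * (phi (dot xi xi) +i* psi (dot xi xi)) * expi (- dot y xi).

Lemma gauss_symbolE (t : R) (phi psi : R -> R) (y xi : V) : gauss_symbol t phi psi y xi =
  (expR (- (t * dot xi xi)) * (phi (dot xi xi) * cos (dot y xi) + psi (dot xi xi) * sin (dot y xi))) +i*
  (expR (- (t * dot xi xi)) * (psi (dot xi xi) * cos (dot y xi) - phi (dot xi xi) * sin (dot y xi))).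
Proof.
rewrite /gauss_symbol /expi cosN sinN.
by apply/eqP; rewrite eq_complex /=; apply/andP; split; apply/eqP; ring.
Qed.

Variable (t : R).
Hypothesis t0 : 0 < t.

Lemma integrable_sin (phi : R -> R) (v : 'I_n -> R) : bounded_measurable phi ->
  (lt n).-integrable setT (EFin \o (fun z : tup n => phi (sqn z) * (expR (- (t * sqn z)) * sin (lin v z)))).
Proof.
move=> b; have := integrable_radial_bm v (- (pi / 2)) t0 b.
by congr (_.-integrable _ _); apply/funext => z /=; rewrite cosBpihalf.
Qed.

Lemma integrable_cos (phi : R -> R) (v : 'I_n -> R) : bounded_measurable phi ->
  (lt n).-integrable setT (EFin \o (fun z : tup n => phi (sqn z) * (expR (- (t * sqn z)) * cos (lin v z)))).
Proof.
move=> b; have := integrable_radial_bm v 0 t0 b.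
by congr (_.-integrable _ _); apply/funext => z /=; rewrite addr0.
Qed.

Lemma gauss_symbol_L1_L2 (phi psi : R -> R) (y : V) :
  bounded_measurable phi -> bounded_measurable psi -> L1_L2 (gauss_symbol t phi psi y).
Proof.
move=> b1 b2; split; first split.
- have := integrable_add (integrable_cos (y 0) b1) (integrable_sin (y 0) b2).
  rewrite /integrable_Rn; congr (_.-integrable _ _); apply/funext => z; rewrite /comp gauss_symbolE/= dot_vecvec dot_vec.
  by congr EFin; ring.
- have := integrable_sub (integrable_cos (y 0) b2) (integrable_sin (y 0) b1).
  rewrite /integrable_Rn; congr (_.-integrable _ _); apply/funext => z; rewrite /comp gauss_symbolE/= dot_vecvec dot_vec.
  by congr EFin; ring.
(* The squared modulus of the symbol is exp(-2 t p) (phi^2 + psi^2). One factor exp(-t p) is moved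
   into the bounded symbol, so that [integrable_cos] applies with v = 0. *)
have b3 : bounded_measurable (fun p => (phi p ^+ 2 + psi p ^+ 2) * expR (- (t * `|p|))).
  have [m1 [M1 h1]] := b1; have [m2 [M2 h2]] := b2; split.
    apply: measurable_funM; first by apply: measurable_funD; exact: measurable_funX.
    apply: measurableT_comp => //; apply: measurableT_comp => //; exact: measurable_funM.
  exists (M1 ^+ 2 + M2 ^+ 2) => p p0; rewrite normrM ger0_norm ?addr_ge0 ?sqr_ge0// (ger0_norm (expR_ge0 _)).
  rewrite (@le_trans _ _ (phi p ^+ 2 + psi p ^+ 2))//.
    by rewrite ler_piMr ?addr_ge0 ?sqr_ge0// -expR0 ler_expR oppr_le0 mulr_ge0 ?(ltW t0).
  rewrite -(real_normK (num_real (phi p))) -(real_normK (num_real (psi p))).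
  by rewrite lerD// lerXn2r ?nnegrE ?(le_trans _ (h1 _ p0)) ?(le_trans _ (h2 _ p0))// ?h1 ?h2.
have := integrable_cos (fun=> 0) b3.
rewrite /integrable_Rn; congr (_.-integrable _ _); apply/funext => z; rewrite /comp gauss_symbolE/= dot_vecvec dot_vec lin0 cos0 mulr1.
congr EFin; rewrite sqr_sqrtr ?addr_ge0 ?sqr_ge0// (ger0_norm (sqn_ge0 z)).
set E := expR _; set th := lin _ z; set A := phi _; set B := psi _.
have -> : (E * (A * cos th + B * sin th)) ^+ 2 + (E * (B * cos th - A * sin th)) ^+ 2 =
  E ^+ 2 * (A ^+ 2 + B ^+ 2) * (cos th ^+ 2 + sin th ^+ 2) by ring.
by rewrite cos2Dsin2; ring.
Qed.

Lemma inv_fourier_gauss_symbol (phi psi : R -> R) (x y : V) :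
  bounded_measurable phi -> bounded_measurable psi ->
  inv_fourier (gauss_symbol t phi psi y) x = ((2 * pi) ^- n)%:C *
   ((radial phi t ((x - y) 0) 0 - radial psi t ((x - y) 0) (- (pi / 2))) +i*
    (radial phi t ((x - y) 0) (- (pi / 2)) + radial psi t ((x - y) 0) 0)).
Proof.
move=> b1 b2; rewrite /inv_fourier; congr (_ * _).
have i1 := integrable_radial_bm ((x - y) 0) 0 t0 b1.
have i2 := integrable_radial_bm ((x - y) 0) 0 t0 b2.
have i3 := integrable_radial_bm ((x - y) 0) (- (pi / 2)) t0 b1.
have i4 := integrable_radial_bm ((x - y) 0) (- (pi / 2)) t0 b2.
rewrite /integralC /radial -RintegralB// -RintegralD//; congr (_ +i* _).
  apply: eq_Rintegral => z _; rewrite gauss_symbolE/= !dot_vecvec !dot_vec cosBpihalf addr0 lin_sub.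
  rewrite cosB sinB; ring.
apply: eq_Rintegral => z _; rewrite gauss_symbolE/= !dot_vecvec !dot_vec cosBpihalf addr0 lin_sub.
rewrite cosB sinB; ring.
Qed.

Variables (a l e : R) (y : V).
Hypothesis l0 : 0 <= l.
Hypothesis e0 : 0 < e.

Let A (p : R) := shell_re e (p `^ a - l).
Let B (p : R) := shell_im e (p `^ a - l).

Let bA : bounded_measurable A. Proof. exact: bounded_measurable_re. Qed.

Let bB : bounded_measurable B. Proof. exact: bounded_measurable_im. Qed.

Let D0 X : 0 < X ^+ 2 + e ^+ 2.
Proof. by rewrite ltr_wpDl ?sqr_ge0 ?exprn_gt0. Qed.

(** Writing p^a = (p^a - l) + l, the first part times the resolvent symbol is bounded by 1 and the
    second by l / e. *)
Let bpA : bounded_measurable (fun p => p `^ a * A p).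
Proof.
split; first by apply: measurable_funM; [exact: measurable_powR|exact: bA.1].
exists (1 + l / e) => p _; rewrite -[p `^ a](subrK l) mulrDl (le_trans (ler_normD _ _))// lerD//.
  rewrite /A /shell_re mulrA normrM normfV (gtr0_norm (D0 _)) ler_pdivrMr// mul1r -expr2.
  by rewrite ger0_norm ?sqr_ge0// lerDl sqr_ge0.
by rewrite normrM ger0_norm// ler_wpM2l// norm_shell_re_le.
Qed.

Let bpB : bounded_measurable (fun p => p `^ a * B p).
Proof.
split; first by apply: measurable_funM; [exact: measurable_powR|exact: bB.1].
exists (1 + l / e) => p _; rewrite -[p `^ a](subrK l) mulrDl (le_trans (ler_normD _ _))// lerD//.
  rewrite /B /shell_im mulrA normrM normfV (gtr0_norm (D0 _)) ler_pdivrMr// mul1r.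
  set X := p `^ a - l; have := sqr_ge0 (`|X| - e).
  rewrite normrM (gtr0_norm e0) -(real_normK (num_real X)).
  have := normr_ge0 X; have := e0; have := sqr_ge0 `|X|; have := sqr_ge0 e; nra.
by rewrite normrM ger0_norm// ler_wpM2l// norm_shell_im_le.
Qed.

Lemma radial_one (v : 'I_n -> R) (th : R) : radial (fun=> 1) t v th =
  cos th * (Num.sqrt (pi / t) ^+ n * expR (- ((\sum_i v i ^+ 2) / (4 * t)))).
Proof.
rewrite mulrA /radial /Rintegral (eq_integral (fun z => (expR (- (t * sqn z)) * cos (lin v z + th))%:E)).
  by rewrite integral_gauss_wave.
by move=> z _; rewrite mul1r.
Qed.

(** The heat kernel at time [t] centred at [y]: it has unit mass and Fourier transform exp(-t |xi|^2
    - i y.xi). *)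
Definition heat (x : V) : R := (2 * pi) ^- n * Num.sqrt (pi / t) ^+ n * gaussian (4 * t)^-1 y x.

(** The identity (p^a - l - i e) (A + i B) = 1, separated into real part [E1] and imaginary part
    [E2], leaves the transform of the Gaussian alone. *)
Lemma resolvent_gauss_symbol :
  resolvent a (l +i* e) (fun x => (heat x)%:C) (inv_fourier (gauss_symbol t A B y)).
Proof.
have mE : (fun xi : V => (enorm xi `^ (2 * a))%:C * gauss_symbol t A B y xi) =
    gauss_symbol t (fun p => p `^ a * A p) (fun p => p `^ a * B p) y.
  apply/funext => xi; rewrite !gauss_symbolE enorm_powR.
  by apply/eqP; rewrite eq_complex /=; apply/andP; split; apply/eqP; ring.
exists (inv_fourier (gauss_symbol t (fun p => p `^ a * A p) (fun p => p `^ a * B p) y)).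
  exists (gauss_symbol t A B y); rewrite mE; split => //; exact: gauss_symbol_L1_L2.
move=> x; rewrite !inv_fourier_gauss_symbol//; set v := (x - y) 0.
have b1 := bounded_measurable_cst 1.
have E1 th : radial (fun p => p `^ a * A p) t v th = l * radial A t v th - e * radial B t v th + radial (fun=> 1) t v th.
  rewrite -mulNr -radial_comb//; rewrite -[X in X + _]mul1r -[X in _ + X]mul1r -radial_comb//; last first.
    split; first by apply: measurable_funD; apply: measurable_funM => //; [exact: bA.1|exact: bB.1].
    exists (l * e^-1 + e * e^-1) => p _; rewrite (le_trans (ler_normD _ _))// (normrM l) (normrM (- e)) normrN.
    by rewrite (ger0_norm l0) (gtr0_norm e0) lerD// ler_wpM2l ?(ltW e0)// ?norm_shell_re_le ?norm_shell_im_le.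
  apply: eq_Rintegral => z _; congr (_ * _); rewrite !mul1r /A /B /shell_re /shell_im.
  have := D0 (sqn z `^ a - l); move: (sqn z `^ a) => X XD; field; rewrite gt_eqF//.
have E2 th : radial (fun p => p `^ a * B p) t v th = l * radial B t v th + e * radial A t v th.
  rewrite -radial_comb//; apply: eq_Rintegral => z _; congr (_ * _).
  rewrite /A /B /shell_re /shell_im.
  have := D0 (sqn z `^ a - l); move: (sqn z `^ a) => X XD; field; rewrite gt_eqF//.
rewrite !E1 !E2 !radial_one cosN cos_pihalf cos0 mul0r mul1r.
apply/eqP; rewrite eq_complex /=; apply/andP; split; apply/eqP; last by ring.
rewrite /heat /gaussian /dot.
have -> : (4 * t)^-1 * \sum_i (x - y) 0 i * (x - y) 0 i = (\sum_i v i ^+ 2) / (4 * t).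
  by rewrite mulrC; congr (_ / _); apply: eq_bigr => i _; rewrite expr2.
ring.
Qed.

Lemma schwartz_heat : schwartz (fun x => (heat x)%:C).
Proof.
split; last exact: schwartzR0.
by apply: schwartzR_gaussian; rewrite invr_gt0 mulr_gt0.
Qed.

End gaussian_resolvent.

(** * The kernel *)

Section approximate_identity.
Context {R : realType}.
Notation mu := (@lebesgue_measure R).
Notation lt n := (@lebesgue_tuple R n).
Notation tup n := (n.-tuple (measurableTypeR R)).

Definition sqdist n (c : 'I_n -> R) (z : tup n) : R := \sum_i (tnth z i - c i) ^+ 2.

Lemma measurable_gauss_sqdist n (s : R) c : measurable_fun setT (fun z : tup n => expR (- (s * sqdist c z))).
Proof.
apply: measurableT_comp => //; apply: measurableT_comp => //; apply: measurable_funM => //.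
apply: measurable_sum => i; apply: measurable_funX; apply: measurable_funB => //.
exact: measurable_tnth.
Qed.

Lemma integral_gauss_sqdist n (s : R) c : 0 < s ->
  (\int[lt n]_z (expR (- (s * sqdist c z)))%:E = (Num.sqrt (pi / s) ^+ n)%:E)%E.
Proof.
move=> s0; elim: n c => [|n IH] c.
  rewrite [LHS]integral_dirac//; last by apply/measurable_EFinP; exact: measurable_gauss_sqdist.
  by rewrite diracT mul1e /sqdist big_ord0 mulr0 oppr0 expR0 expr0.
rewrite ge0_integral_cons//; last by apply/measurable_EFinP; exact: measurable_gauss_sqdist.
pose c' (i : 'I_n) := c (lift ord0 i).
have E x (z : tup n) : sqdist c (tuple_cons (x, z)) = (x - c ord0) ^+ 2 + sqdist c' z.
  rewrite /sqdist big_ord_recl tnth_cons0; congr (_ + _).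
  by apply: eq_bigr => i _; rewrite tnth_consS.
under eq_integral => x _.
  under eq_integral => t _.
    rewrite E mulrDr opprD expRD EFinM; over.
  rewrite ge0_integralZl//=; last by apply/measurable_EFinP; exact: measurable_gauss_sqdist.
  rewrite IH; over.
rewrite ge0_integralZr//; last first.
  apply/measurable_EFinP; apply: measurableT_comp => //; apply: measurableT_comp => //.
  by apply: measurable_funM => //; apply: measurable_funX; exact: measurable_funB.
by rewrite integral_gauss_center// -EFinM exprS.
Qed.

Lemma heat_vec n (t : R) (y : 'rV[R]_n) (z : tup n) : heat t y (vec_of_tuple z) =
  (2 * pi) ^- n * Num.sqrt (pi / t) ^+ n * expR (- ((4 * t)^-1 * sqdist (y 0) z)).
Proof.
rewrite /heat /gaussian; congr (_ * expR (- (_ * _))).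
by apply: eq_bigr => i _; rewrite !mxE -expr2.
Qed.

Lemma heat_ge0 n (t : R) (y : 'rV[R]_n) x : 0 <= heat t y x.
Proof. by rewrite /heat !mulr_ge0 ?expR_ge0 ?exprn_ge0 ?sqrtr_ge0// invr_ge0 exprn_ge0// mulr_ge0 ?pi_ge0. Qed.

Lemma integrable_heat n (t : R) (y : 'rV[R]_n) : 0 < t ->
  (lt n).-integrable setT (EFin \o (fun z => heat t y (vec_of_tuple z))).
Proof.
move=> t0; have s0 : 0 < (4 * t)^-1 by rewrite invr_gt0 mulr_gt0.
have i1 : (lt n).-integrable setT (EFin \o (fun z : tup n => expR (- ((4 * t)^-1 * sqdist (y 0) z)))).
  apply/integrableP; split; first by apply/measurable_EFinP; exact: measurable_gauss_sqdist.
  under eq_integral do rewrite gee0_abs ?lee_fin ?expR_ge0//.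
  by rewrite integral_gauss_sqdist// ltry.
have := integrable_scale ((2 * pi) ^- n * Num.sqrt (pi / t) ^+ n) measurableT i1.
by congr (_.-integrable _ _); apply/funext => z; rewrite /comp heat_vec.
Qed.

Lemma integral_heat n (t : R) (y : 'rV[R]_n) : 0 < t -> \int[lt n]_z heat t y (vec_of_tuple z) = 1.
Proof.
move=> t0; have s0 : 0 < (4 * t)^-1 by rewrite invr_gt0 mulr_gt0.
have i1 : (lt n).-integrable setT (EFin \o (fun z : tup n => expR (- ((4 * t)^-1 * sqdist (y 0) z)))).
  apply/integrableP; split; first by apply/measurable_EFinP; exact: measurable_gauss_sqdist.
  under eq_integral do rewrite gee0_abs ?lee_fin ?expR_ge0//.
  by rewrite integral_gauss_sqdist// ltry.
under eq_Rintegral do rewrite heat_vec.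
rewrite RintegralZl// /Rintegral integral_gauss_sqdist//= -exprVn -!exprMn.
rewrite -[X in X ^+ n](_ : 1 = _) ?expr1n//.
have p0 : 0 < pi :> R by exact: pi_gt0.
rewrite -mulrA -sqrtrM ?divr_ge0 ?pi_ge0 ?(ltW t0)//.
have -> : pi / t * (pi / (4 * t)^-1) = (2 * pi) ^+ 2 by field; rewrite gt_eqF.
by rewrite sqrtr_sqr gtr0_norm ?mulr_gt0// mulVf// gt_eqF// mulr_gt0.
Qed.

(** Away from [y] a narrow heat kernel is O(1 / (i + 1)) times the one at time 1. The far part of an
    integral is thus controlled by integrability against a single Gaussian, with no growth condition
    on the other factor. *)
Lemma heat_far n (y : 'rV[R]_n) (h : R) : 0 < h -> exists2 D : R, 0 <= D &
  forall i (z : tup n), h <= sqdist (y 0) z ->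
    heat i.+1%:R^-1 y (vec_of_tuple z) <= D * i.+1%:R^-1 * heat 1 y (vec_of_tuple z).
Proof.
move=> h0; set c := h / 4; have c0 : 0 < c by rewrite divr_gt0.
exists (expR c * (n.+1%:R / c) `^ n.+1%:R); first by rewrite mulr_ge0 ?expR_ge0 ?powR_ge0.
move=> i z hz; set x : R := i.+1%:R; have x1 : 1 <= x by rewrite ler1n.
have x0 : 0 < x by rewrite (lt_le_trans _ x1).
rewrite !heat_vec divr1 mulr1; set N := (2 * pi) ^- n; set q := sqdist _ z in hz *.
have N0 : 0 <= N by rewrite invr_ge0 exprn_ge0// mulr_ge0 ?pi_ge0.
have -> : N * Num.sqrt (pi / x^-1) ^+ n * expR (- ((4 * x^-1)^-1 * q)) =
    (Num.sqrt x ^+ n * expR (- ((x - 1) / 4 * q))) * (N * Num.sqrt pi ^+ n * expR (- (4^-1 * q))).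
  rewrite invrK sqrtrM ?pi_ge0// exprMn.
  have -> : - ((4 * x^-1)^-1 * q) = - ((x - 1) / 4 * q) + - (4^-1 * q) by field; rewrite gt_eqF.
  by rewrite expRD; ring.
rewrite ler_wpM2r ?mulr_ge0 ?expR_ge0 ?exprn_ge0 ?sqrtr_ge0//.
rewrite ler_pdivlMr//.
have := powR_expRN_le (ltr0Sn R n) c0 x0; rewrite [x `^ _]powR_mulrn ?(ltW x0)// => hx.
rewrite (@le_trans _ _ (expR c * (x ^+ n.+1 * expR (- (c * x)))))//; last by rewrite ler_wpM2l ?expR_ge0.
have sx : Num.sqrt x ^+ n <= x ^+ n.
  rewrite lerXn2r ?nnegrE ?sqrtr_ge0 ?(ltW x0)//.
  by rewrite -[leRHS](ger0_norm (ltW x0)) -sqrtr_sqr ler_wsqrtr// expr2 ler_peMl// ltW.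
have ex : expR (- ((x - 1) / 4 * q)) <= expR c * expR (- (c * x)).
  rewrite -expRD ler_expR /c.
  have : 0 <= (x - 1) * (q - h) by rewrite mulr_ge0 ?subr_ge0.
  lra.
have -> : expR c * (x ^+ n.+1 * expR (- (c * x))) = x ^+ n * (expR c * expR (- (c * x))) * x by rewrite exprS; ring.
by rewrite ler_wpM2r ?(ltW x0)// ler_pM ?exprn_ge0 ?sqrtr_ge0 ?expR_ge0.
Qed.

(** Continuity at [y] controls the near part and [heat_far] the rest, so [k] may be singular
    elsewhere, as a kernel is on the diagonal. *)
Lemma heat_cvg n (k : 'rV[R]_n -> R) (y : 'rV[R]_n) : {for y, continuous k} ->
  (forall i, integrable_Rn (fun x => k x * heat i.+1%:R^-1 y x)) ->
  integral_Rn (fun x => k x * heat i.+1%:R^-1 y x) @[i --> \oo] --> k y.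
Proof.
move=> ck ik; apply/cvgrPdist_lt => e e0.
have e20 : 0 < e / 2 by rewrite divr_gt0.
have /cvgrPdist_lt/(_ _ e20)/nbhs_ballP[d /= d0 hd] := ck.
(* Balls of ['rV[R]_n] are those of the sup norm, which the Euclidean distance dominates. *)
have dist_small (z : tup n) : sqdist (y 0) z < d ^+ 2 -> `|k (vec_of_tuple z) - k y| <= e / 2.
  move=> qd; rewrite distrC ltW//; apply: hd; split=> // i j; rewrite (ord1 i) /ball/= mxE distrC.
  rewrite -(@ltr_pXn2r _ 2) ?nnegrE ?(ltW d0)// real_normK ?num_real// (le_lt_trans _ qd)//.
  by rewrite /sqdist (bigD1 j)//= lerDl; apply: sumr_ge0 => a _; exact: sqr_ge0.
have [D D0 hD] := heat_far y (exprn_gt0 2 d0).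
pose h i (z : tup n) := heat i.+1%:R^-1 y (vec_of_tuple z).
have h0 i z : 0 <= h i z by exact: heat_ge0.
have ti i : 0 < i.+1%:R^-1 :> R by rewrite invr_gt0.
pose g (z : tup n) := k (vec_of_tuple z) - k y.
have iH i : (lt n).-integrable setT (EFin \o h i) by exact: integrable_heat.
have iK i : (lt n).-integrable setT (EFin \o (fun z => k (vec_of_tuple z) * h i z)) := ik i.
have iG i : (lt n).-integrable setT (EFin \o (fun z => g z * h i z)).
  have := integrable_sub (iK i) (integrable_scale (k y) measurableT (iH i)).
  by congr (_.-integrable _ _); apply/funext => z /=; rewrite /g mulrBl.
have iA i : (lt n).-integrable setT (EFin \o (fun z => `|g z| * h i z)).
  have := integrable_norm (iG i).
  by congr (_.-integrable _ _); apply/funext => z /=; rewrite normrM (ger0_norm (h0 i z)).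
pose J := \int[lt n]_z (`|g z| * h 0%N z).
have cJ : D * J * i.+1%:R^-1 @[i --> \oo] --> (0 : R).
  by rewrite -[X in _ --> X](mulr0 (D * J)); apply: cvgMr; exact: cvg_harmonic.
near=> i.
have small : `|D * J * i.+1%:R^-1| < e / 2.
  near: i; have /cvgrPdist_lt/(_ _ e20) := cJ.
  by apply: filterS => i; rewrite sub0r normrN.
have gE : \int[lt n]_z (g z * h i z) = integral_Rn (fun x => k x * heat i.+1%:R^-1 y x) - k y.
  have kyE : \int[lt n]_z (k y * h i z) = k y by rewrite RintegralZl ?integral_heat ?mulr1.
  rewrite -[X in _ = _ - X]kyE /integral_Rn -RintegralB//; last by apply: integrable_scale => //; exact: iH.
    by apply: eq_Rintegral => z _; rewrite /g mulrBl.
  exact: iK.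
rewrite -opprB -gE.
rewrite normrN (le_lt_trans (le_normr_Rintegral measurableT (iG i)))//.
have i1 := integrable_add (integrable_scale (e / 2) measurableT (iH i)) (integrable_scale (D * i.+1%:R^-1) measurableT (iA 0%N)).
rewrite (@le_lt_trans _ _ (\int[lt n]_z (e / 2 * h i z + D * i.+1%:R^-1 * (`|g z| * h 0%N z))))//.
  apply: le_Rintegral => //; first exact: integrable_norm.
  move=> z _; rewrite normrM (ger0_norm (h0 i z)).
  have Di : 0 <= D * i.+1%:R^-1 by rewrite mulr_ge0.
  have [qd|qd] := ltP (sqdist (y 0) z) (d ^+ 2).
    apply: ler_wpDr; first exact: (mulr_ge0 Di (mulr_ge0 (normr_ge0 _) (h0 _ _))).
    by rewrite ler_wpM2r// dist_small.
  apply: ler_wpDl; first by rewrite mulr_ge0// ltW.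
  rewrite [leRHS]mulrCA ler_wpM2l// (le_trans (hD i z qd))// /h invr1//.
rewrite RintegralD//; [|exact: integrable_scale|exact: integrable_scale].
rewrite (RintegralZl _ measurableT (iH i)) (RintegralZl _ measurableT (iA 0%N)) integral_heat// mulr1 -/J.
rewrite [X in _ < X](splitr e) ltrD2l (le_lt_trans _ small)// mulrAC.
exact: ler_norm.
Unshelve. all: by end_near. Qed.

End approximate_identity.

(** * Identification of the kernel and the final estimates *)

Section main_theorem.
Context {R : realType}.
Notation lt n := (@lebesgue_tuple R n).
Notation tup n := (n.-tuple (measurableTypeR R)).

Lemma enorm_sqr n (x : 'rV[R]_n) : \sum_i (x 0 i) ^+ 2 = enorm x ^+ 2.
Proof. by rewrite sqr_sqrtr ?dot_ge0//; apply: eq_bigr => i _; rewrite expr2. Qed.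

(* The iterated limit (first [eps -> 0], then the width [1 / (i + 1)] of the
   Gaussian tends to [0]) that computes [(2 pi)^n] times the kernel. *)
Definition kernel_limit n (a lam r : R) (Q : R * R) := exists L : (nat -> R) * (nat -> R),
  [/\ forall i, radial (fun p => shell_re e (p `^ a - lam `^ (2 * a))) i.+1%:R^-1 (@axis R n.+1 r) 0 @[e --> 0^'+] --> L.1 i,
      forall i, radial (fun p => shell_im e (p `^ a - lam `^ (2 * a))) i.+1%:R^-1 (@axis R n.+1 r) 0 @[e --> 0^'+] --> L.2 i,
      L.1 i @[i --> \oo] --> Q.1 & L.2 i @[i --> \oo] --> Q.2].

Lemma kernel_limit_unique n (a lam r : R) Q Q' :
  kernel_limit n a lam r Q -> kernel_limit n a lam r Q' -> Q = Q'.
Proof.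
move=> [[L1 L2] /= [h1 h2 h3 h4]] [[L1' L2'] /= [h1' h2' h3' h4']].
have e1 : L1 = L1' by apply/funext => i; exact: (cvg_unique _ (h1 i) (h1' i)).
have e2 : L2 = L2' by apply/funext => i; exact: (cvg_unique _ (h2 i) (h2' i)).
subst L1' L2'; case: Q Q' h3 h4 h3' h4' => q1 q2 [q1' q2'] /= h3 h4 h3' h4'.
by congr pair; [exact: (cvg_unique _ h3 h3')|exact: (cvg_unique _ h4 h4')].
Qed.

(** [K] is tested against heat kernels centred at [y], whose resolvents are explicit: the hypothesis
    on [K] gives the limit in eps, and continuity of [K x] at [y] gives the limit as the width tends
    to 0. *)
Lemma kernel_limit_resolvent n (a lam : R) (K : 'rV[R]_n.+1 -> 'rV[R]_n.+1 -> R[i]) :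
  0 < a -> 0 < lam -> limiting_resolvent_kernel a (lam `^ (2 * a)) K ->
  forall x y, x != y -> kernel_limit n a lam (enorm (x - y))
    ((2 * pi) ^+ n.+1 * complex.Re (K x y), (2 * pi) ^+ n.+1 * complex.Im (K x y)).
Proof.
move=> a0 lam0 [Kc Ki Kl] x y xy; set l := lam `^ (2 * a) in Kl *.
have l0 : 0 <= l by exact: powR_ge0.
have [cre cim] := Kc x y xy.
have pc : (fun z : 'rV[R]_n.+1 => (x, z)) @ y --> (x, y).
  by apply: (cvg_pair (F := nbhs y) (G := nbhs x) (H := nbhs y) (f := fun=> x) (g := id)); [exact: cvg_cst|exact: cvg_id].
have cre' : {for y, continuous (fun z => complex.Re (K x z))} by apply: (cvg_comp _ _ pc cre).
have cim' : {for y, continuous (fun z => complex.Im (K x z))} by apply: (cvg_comp _ _ pc cim).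
pose t i : R := i.+1%:R^-1; have t0 i : 0 < t i by rewrite invr_gt0.
set P : R := (2 * pi) ^+ n.+1; have P0 : 0 < P by rewrite exprn_gt0// mulr_gt0// pi_gt0.
set v := (x - y) 0; set r := enorm (x - y).
have vr : \sum_i v i ^+ 2 = r ^+ 2 by exact: enorm_sqr.
have ar : \sum_i (@axis R n.+1 r) i ^+ 2 = r ^+ 2 by exact: sum_axis.
pose A e (p : R) := shell_re e (p `^ a - l); pose B e (p : R) := shell_im e (p `^ a - l).
have RE i : (fun z => complex.Re (K x z * (heat (t i) y z)%:C)) = (fun z => complex.Re (K x z) * heat (t i) y z).
  by apply/funext => z; case: (K x z) => p q /=; rewrite mulr0 subr0.
have IM i : (fun z => complex.Im (K x z * (heat (t i) y z)%:C)) = (fun z => complex.Im (K x z) * heat (t i) y z).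
  by apply/funext => z; case: (K x z) => p q /=; rewrite mulr0 add0r.
have int i := Ki _ (schwartz_heat (t0 i) y) x.
have lim i := Kl _ (schwartz_heat (t0 i) y) (fun e => inv_fourier (gauss_symbol (t i) (A e) (B e) y))
  (fun e e0 => resolvent_gauss_symbol (t0 i) a y l0 e0) x.
have invE i e : 0 < e -> inv_fourier (gauss_symbol (t i) (A e) (B e) y) x =
   (P^-1 * radial (A e) (t i) (@axis R n.+1 r) 0) +i* (P^-1 * radial (B e) (t i) (@axis R n.+1 r) 0).
  move=> e0.
  have bA : bounded_measurable (A e) by exact: bounded_measurable_re.
  have bB : bounded_measurable (B e) by exact: bounded_measurable_im.
  rewrite (inv_fourier_gauss_symbol (t0 i) x y bA bB) -/v.
  (* The direction x - y and the axis have the same length, so both reduce to the same scaled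
     integral; the integrals with phase -pi / 2 vanish. *)
  rewrite !(radial_freq_re a0 lam0 _ e0 (t0 i) vr) !(radial_freq_im a0 lam0 _ e0 (t0 i) vr).
  rewrite (radial_freq_re a0 lam0 _ e0 (t0 i) ar) (radial_freq_im a0 lam0 _ e0 (t0 i) ar).
  rewrite cosN cos_pihalf cos0 !mul0r subr0 add0r.
  by apply/eqP; rewrite eq_complex /=; apply/andP; split; apply/eqP; ring.
exists ((fun i => P * integral_Rn (fun z => complex.Re (K x z) * heat (t i) y z)),
        (fun i => P * integral_Rn (fun z => complex.Im (K x z) * heat (t i) y z))).
split => /=.
- move=> i; have [h _] := lim i; move: h; rewrite /= RE => h.
  have : P * complex.Re (inv_fourier (gauss_symbol (t i) (A e) (B e) y) x) @[e --> 0^'+] -->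
    P * integral_Rn (fun z => complex.Re (K x z) * heat (t i) y z) by apply: cvgMr.
  apply: cvg_trans; apply: near_eq_cvg; near=> e.
  have e0 : 0 < e by [].
  by rewrite invE//= mulVKf// gt_eqF.
- move=> i; have [_ h] := lim i; move: h; rewrite /= IM => h.
  have : P * complex.Im (inv_fourier (gauss_symbol (t i) (A e) (B e) y) x) @[e --> 0^'+] -->
    P * integral_Rn (fun z => complex.Im (K x z) * heat (t i) y z) by apply: cvgMr.
  apply: cvg_trans; apply: near_eq_cvg; near=> e.
  have e0 : 0 < e by [].
  by rewrite invE//= mulVKf// gt_eqF.
- by apply: cvgMr; apply: heat_cvg => // i; have [h _] := int i; rewrite -RE.
- by apply: cvgMr; apply: heat_cvg => // i; have [_ h] := int i; rewrite -IM.
Unshelve. all: by end_near. Qed.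

Lemma kernel_limit_bound n (a : R) : 0 < a -> a < n.+1%:R / 2 -> exists2 M : R, 0 <= M &
  forall lam r Q, 0 < lam -> 0 < r -> kernel_limit n a lam r Q ->
  `|Q.1 - riesz_const n.+1 a * r `^ (2 * a - n.+1%:R)| + `|Q.2| <=
  M * (lam `^ (n.+1%:R - 2 * a) * error_bound n.+1 a (lam * r)).
Proof.
move=> a0 an; have [M1 M10 h1] := frequency_limit_re a0 an; have [M2 M20 h2] := frequency_limit_im n a0.
exists (M1 + M2); first exact: addr_ge0.
move=> lam r [Q1 Q2] lam0 r0 [[L1 L2] /= [c1 c2 c3 c4]].
have t0 i : 0 < i.+1%:R^-1 :> R by rewrite invr_gt0.
have ar : \sum_i (@axis R n.+1 r) i ^+ 2 = r ^+ 2 by exact: sum_axis.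
rewrite [leRHS]mulrDl lerD//; first exact: (h1 lam r _ _ L1 Q1 lam0 r0 ar t0 cvg_harmonic c1 c3).
rewrite (le_trans (h2 lam r _ _ L2 Q2 lam0 r0 ar t0 c2 c4))// ler_wpM2l// ler_peMr ?powR_ge0//.
exact: error_bound_ge1.
Qed.

Definition kernel_const n (a : R) : R := (2 * pi) ^- n * riesz_const n a.

(** Chosen from the iterated limit so that [K] is not mentioned. When there is no limit the value 0
    keeps the bounds valid. *)
Definition kernel_error n (a lam r : R) : R[i] :=
  if pselect (exists Q, kernel_limit n a lam r Q) is left h then
    let Q := projT1 (cid h) in
    ((2 * pi) ^- n.+1 * (Q.1 - riesz_const n.+1 a * r `^ (2 * a - n.+1%:R))) +i*
    ((2 * pi) ^- n.+1 * Q.2)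
  else 0.

Lemma kernel_errorE n (a lam r : R) Q : kernel_limit n a lam r Q ->
  kernel_error n a lam r =
  ((2 * pi) ^- n.+1 * (Q.1 - riesz_const n.+1 a * r `^ (2 * a - n.+1%:R))) +i*
  ((2 * pi) ^- n.+1 * Q.2).
Proof.
move=> hQ; rewrite /kernel_error; case: pselect => [h|/(_ (ex_intro _ Q hQ))//].
by case: cid => Q' hQ' /=; rewrite (kernel_limit_unique hQ' hQ).
Qed.

Lemma normc_le (p q : R) : Normc.normc (p +i* q) <= `|p| + `|q|.
Proof.
rewrite /= -[leRHS](ger0_norm (addr_ge0 (normr_ge0 p) (normr_ge0 q))) -sqrtr_sqr ler_wsqrtr//.
rewrite sqrrD !real_normK ?num_real// addrAC lerDl mulrn_wge0// mulr_ge0//.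
Qed.

Lemma kernel_error_bound n (a : R) : 0 < a -> a < n.+1%:R / 2 -> exists2 M : R, 0 <= M &
  forall lam r, 0 < lam -> 0 < r ->
  Normc.normc (kernel_error n a lam r) <= M * (lam `^ (n.+1%:R - 2 * a) * error_bound n.+1 a (lam * r)).
Proof.
move=> a0 an; have [M M0 hM] := kernel_limit_bound a0 an.
have P0 : 0 <= (2 * pi) ^- n.+1 :> R by rewrite invr_ge0 exprn_ge0// mulr_ge0 ?pi_ge0.
exists ((2 * pi) ^- n.+1 * M); first exact: mulr_ge0.
move=> lam r lam0 r0; rewrite /kernel_error; case: pselect => [h|_]; last first.
  rewrite [Normc.normc 0](_ : _ = 0); last by rewrite /= expr0n addr0 sqrtr0.
  by rewrite !mulr_ge0 ?powR_ge0// (le_trans ler01)// error_bound_ge1.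
case: cid => Q hQ; rewrite /= (le_trans (normc_le _ _))// (normrM _ (Q.1 - _)) (normrM _ Q.2) (ger0_norm P0) -mulrDr -[leRHS]mulrA.
by rewrite ler_wpM2l//; exact: hM.
Qed.

End main_theorem.

Theorem proposition2p2 (R : realType) (n : nat) (alpha : R)
    (alpha_gt0 : 0 < alpha) (alpha_lt : 2 * alpha < n%:R) :
  exists (C : R[i]) (E : R -> R -> R[i]),
    (forall (lam : R) (K : 'rV[R]_n -> 'rV[R]_n -> R[i]),
      0 < lam < 1 ->
      limiting_resolvent_kernel alpha (lam `^ (2 * alpha)) K ->
      forall x y : 'rV[R]_n, x != y ->
        K x y = C / (enorm (x - y) `^ (n%:R - 2 * alpha))%:C
                + E lam (enorm (x - y))) /\
    (n%:R < 4 * alpha ->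
      exists M : R, forall lam r : R, 0 < lam < 1 -> 0 < r ->
        Normc.normc (E lam r) <= M * lam `^ (n%:R - 2 * alpha)) /\
    (n%:R = 4 * alpha ->
      exists M : R, forall lam r : R, 0 < lam < 1 -> 0 < r ->
        Normc.normc (E lam r) <=
          M * (lam `^ (n%:R - 2 * alpha) * (1 + log_minus (lam * r)))) /\
    (4 * alpha < n%:R ->
      exists M : R, forall lam r : R, 0 < lam < 1 -> 0 < r ->
        Normc.normc (E lam r) <=
          M * (lam `^ (n%:R - 2 * alpha)
               + lam `^ (2 * alpha) * r `^ (4 * alpha - n%:R))).
Proof.
case: n alpha_lt => [|n] alpha_lt; first by exfalso; move: alpha_lt; rewrite mulr0n; lra.
have an : alpha < n.+1%:R / 2 by rewrite ltr_pdivlMr// mulrC.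
have [M M0 hM] := kernel_error_bound alpha_gt0 an.
exists (kernel_const n.+1 alpha)%:C, (kernel_error n alpha); split; [|split; [|split]].
- move=> lam K /andP[lam0 _] hK x y xy.
  have hQ := kernel_limit_resolvent alpha_gt0 lam0 hK xy.
  rewrite (kernel_errorE hQ) /=; set r := enorm (x - y).
  have P0 : (2 * pi) ^+ n.+1 != 0 :> R by rewrite expf_neq0// mulf_neq0// gt_eqF// pi_gt0.
  have -> : (kernel_const n.+1 alpha)%:C / (r `^ (n.+1%:R - 2 * alpha))%:C =
      (kernel_const n.+1 alpha * r `^ (2 * alpha - n.+1%:R))%:C.
    by rewrite -fmorphV -rmorphM/= -powRN opprB.
  rewrite /kernel_const; case: (K x y) => p q /=.
  by apply/eqP; rewrite eq_complex /=; apply/andP; split; apply/eqP; field.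
- move=> na; exists M => lam r /andP[lam0 _] r0; have := hM lam r lam0 r0.
  by rewrite /error_bound na mulr1.
- move=> na; exists M => lam r /andP[lam0 _] r0; have := hM lam r lam0 r0.
  by rewrite /error_bound na ltxx eqxx.
move=> na; exists M => lam r /andP[lam0 _] r0; have := hM lam r lam0 r0.
rewrite /error_bound ltNge (ltW na) /= (lt_eqF na) mulrDr mulr1 powRM ?(ltW lam0) ?(ltW r0)// mulrA.
rewrite -(@powRD _ lam) ?(gt_eqF lam0) ?implybT//.
by have -> : n.+1%:R - 2 * alpha + (4 * alpha - n.+1%:R) = 2 * alpha by ring.
Qed.
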